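(* $L_0^{\min}$ is a positive hermitian operator with deficiency indices $(1,1)$, and its Friedrichs and Krein extensions coincide and are equal to $H_0=H_0^{\pi/2}$. The domain of $H_0$ is a dense subspace of $\mathcal{D}(A_{1/2})$ (for the graph topology) and for $f\in\mathcal{D}(H_0)$ we have $\langle f,H_0f\rangle=\|A_{1/2}f\|^2$. Thus the quadratic form of $H_0$ is that of $A_{1/2}^*A_{1/2}$. If $0\le\theta<\pi$ and $\theta\ne\pi/2$, then the self-adjoint extension $H_0^\theta$ of $L_0^{\min}$ has exactly one strictly negative eigenvalue.
   Context: Write $L^2=L^2(0,\infty)$ (complex-valued functions). Let $\tilde L_0=-\partial_x^2-\tfrac14x^{-2}$ act on distributions on $(0,\infty)$. $L_0^{\max}$ is its restriction to $\{f\in L^2:\tilde L_0f\in L^2\}$ and $L_0^{\min}$ is the closure in $L^2$ of its restriction to $C_c^\infty(0,\infty)$. Let $\xi$ be a smooth function on $(0,\infty)$ with $\xi=1$ on $(0,1]$ and $\xi=0$ on $[2,\infty)$. $H_0$ is the restriction of $L_0^{\max}$ to $\mathcal{D}(L_0^{\min})+\mathbb{C}\,\xi(x)\sqrt{x}$. For $0\le\theta<\pi$ let $u_\theta(x)=x^{1/2}\ln x\,\cos\theta+x^{1/2}\sin\theta$ and let $H_0^\theta$ be the restriction of $L_0^{\max}$ to the set of $f\in\mathcal{D}(L_0^{\max})$ with $\lim_{x\to0}\big(u_\theta(x)f'(x)-u_\theta'(x)f(x)\big)=0$. $A_{1/2}$ is the operator $-i\partial_x+\frac{i}{2x}$ (acting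 on distributions on $(0,\infty)$) restricted to $\{f\in L^2: -if'+\frac{i}{2x}f\in L^2\}$; it coincides with the closure in $L^2$ of its restriction to $C_c^\infty(0,\infty)$. The Friedrichs extension $F$ and the Krein extension $K$ of a positive hermitian operator $S$ are the positive self-adjoint extensions of $S$ such that every positive self-adjoint extension $H$ of $S$ satisfies $K\le H\le F$ in the sense of quadratic forms. *)

(* Defs.v *)
From HB Require Import structures.
From mathcomp Require Import all_boot all_order all_algebra.
From mathcomp Require Import complex.
From mathcomp Require Import all_classical all_reals all_analysis.

Set Implicit Arguments.
Unset Strict Implicit.
Unset Printing Implicit Defensive.

Import Order.TTheory GRing.Theory Num.Theory.
Import numFieldNormedType.Exports.

Local Open Scope classical_set_scope.
Local Open Scope ring_scope.
Local Open Scope complex_scope.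

Section HalfLine.
Context (R : realType).
Implicit Types (f g u v phi : R -> R[i]) (x : R) (c : R[i]).

(** * Functions on the half-line

  A complex function on (0, oo) is a total map [R -> R[i]]; its values outside
  (0, oo) play no role.  Elements of L^2(0, oo) are represented by functions,
  their equality being [eqL2]; sets of elements of L^2 and operators on L^2
  are sets of such representatives which are stable under [eqL2]. *)

Definition halfline : set R := `]0, +oo[%classic.

Definition Rpart f : R -> R := fun x => complex.Re (f x).
Definition Ipart f : R -> R := fun x => complex.Im (f x).

Definition integral_hl f : R[i] :=
  (\int[lebesgue_measure]_(x in halfline) Rpart f x)%R +i*
  (\int[lebesgue_measure]_(x in halfline) Ipart f x)%R.

Definition L2 : set (R -> R[i]) := [set f |
  [/\ measurable_fun halfline (Rpart f), measurable_fun halfline (Ipart f) &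
      (\int[lebesgue_measure]_(x in halfline)
         (Rpart f x ^+ 2 + Ipart f x ^+ 2)%:E < +oo)%E]].

Definition eqL2 f g : Prop := ae_eq lebesgue_measure halfline f g.

Definition scale c f : R -> R[i] := fun x => c * f x.

(* antilinear in the first argument *)
Definition inner f g : R[i] := integral_hl (fun x => (f x)^*%C * g x).

Definition norm2 f : R := Num.sqrt (complex.Re (inner f f)).

Definition cderiv f : R -> R[i] :=
  fun x => derive1 (Rpart f) x +i* derive1 (Ipart f) x.

Definition smooth_hl f : Prop := forall (n : nat) (x : R), 0 < x ->
  derivable (derive1n n (Rpart f)) x 1 /\ derivable (derive1n n (Ipart f)) x 1.

Definition C1 f : Prop := forall x : R, 0 < x ->
  [/\ derivable (Rpart f) x 1, derivable (Ipart f) x 1,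
      {for x, continuous (derive1 (Rpart f))} &
      {for x, continuous (derive1 (Ipart f))}].

(* Elements of C_c^oo(0, oo), extended by 0 to the real line. *)
Definition test_function phi : Prop :=
  smooth_hl phi /\
  exists a b : R, 0 < a /\ forall x, ~ (a <= x <= b) -> phi x = 0.

(** * Distributions on (0, oo)

  All the distributions below are obtained from square-integrable functions by
  derivation and multiplication by smooth functions, so that their continuity
  is automatic and is not recorded. *)

Definition distribution : Type := (R -> R[i]) -> R[i].
Implicit Types T S : distribution.

Definition eqD T S : Prop := forall phi, test_function phi -> T phi = S phi.

Definition dist_of f : distribution :=
  fun phi => integral_hl (fun x => f x * phi x).
Definition dist_deriv T : distribution := fun phi => - T (cderiv phi).
Definition dist_mul (a : R -> R[i]) T : distribution :=
  fun phi => T (fun x => a x * phi x).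
Definition dist_add T S : distribution := fun phi => T phi + S phi.
Definition dist_scale c T : distribution := fun phi => c * T phi.

(* - d^2/dx^2 - 1/(4 x^2) *)
Definition L0_dist T : distribution :=
  dist_add (dist_scale (- 1) (dist_deriv (dist_deriv T)))
           (dist_scale (- 4^-1) (dist_mul (fun x => (x ^- 2)%:C) T)).

(* - i d/dx + i/(2 x) *)
Definition A_half_dist T : distribution :=
  dist_add (dist_scale (- 'i%C) (dist_deriv T))
           (dist_mul (fun x => 'i%C * ((2 * x)^-1)%:C) T).

(** * Operators on L^2(0, oo), identified with their graphs *)

Definition operator : Type := set ((R -> R[i]) * (R -> R[i])).
Implicit Types A B F H K : operator.

Definition linear_subspace (V : set (R -> R[i])) : Prop :=
  V (fun=> 0) /\
  forall c f g, V f -> V g -> V (scale c f \+ g).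

Definition is_operator A : Prop :=
  [/\ (forall f g, A (f, g) -> L2 f /\ L2 g),
      (forall f g f' g', A (f, g) -> L2 f' -> L2 g' ->
         eqL2 f f' -> eqL2 g g' -> A (f', g')),
      A (fun=> 0, fun=> 0),
      (forall c f g f' g', A (f, g) -> A (f', g') ->
         A (scale c f \+ f', scale c g \+ g')) &
      (forall f g g', A (f, g) -> A (f, g') -> eqL2 g g')].

Definition domain_op A : set (R -> R[i]) := [set f | exists g, A (f, g)].

Definition restriction A (D : set (R -> R[i])) : operator :=
  [set p | A p /\ D p.1].

Definition closure_op A : operator := [set p |
  [/\ L2 p.1, L2 p.2 &
      forall e : R, 0 < e -> exists u v,
        [/\ A (u, v), norm2 (p.1 \- u) < e & norm2 (p.2 \- v) < e]]].

Definition adjoint_op A : operator := [set p |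
  [/\ L2 p.1, L2 p.2 &
      forall u v, A (u, v) -> inner p.1 v = inner p.2 u]].

(* The product A B, on the f in the domain of B with B f in that of A. *)
Definition comp_op A B : operator :=
  [set p | exists g, B (p.1, g) /\ A (g, p.2)].

Definition densely_defined A : Prop :=
  forall f, L2 f -> forall e : R, 0 < e ->
    exists g, domain_op A g /\ norm2 (f \- g) < e.

Definition hermitian_op A : Prop :=
  [/\ is_operator A, densely_defined A &
      forall f f' g g', A (f, f') -> A (g, g') -> inner f g' = inner f' g].

(* [0 <= z] in R[i] means that z is real and nonnegative. *)
Definition positive_op A : Prop := forall f g, A (f, g) -> 0 <= inner f g.

Definition selfadjoint A : Prop :=
  [/\ is_operator A, densely_defined A & A = adjoint_op A].

Definition eigenvalue_op A c : Prop :=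
  exists f, A (f, scale c f) /\ ~ eqL2 f (fun=> 0).

(* V has dimension n as a space of classes modulo eqL2 *)
Definition has_dim (V : set (R -> R[i])) (n : nat) : Prop :=
  exists b : 'I_n -> (R -> R[i]),
    let comb (a : 'I_n -> R[i]) := (fun x => \sum_i a i * b i x) in
    [/\ forall i, V (b i),
        forall a, eqL2 (comb a) (fun=> 0) -> forall i, a i = 0 &
        forall f, V f -> exists a, eqL2 f (comb a)].

(* dim Ker (A^* - i) = m and dim Ker (A^* + i) = n *)
Definition deficiency_indices A (m n : nat) : Prop :=
  has_dim [set f | adjoint_op A (f, scale 'i%C f)] m /\
  has_dim [set f | adjoint_op A (f, scale (- 'i%C) f)] n.

(** * Quadratic forms

  [quad_form H f q] : f is in the domain of the closed quadratic form h
  associated with the positive self-adjoint operator H, and h(f) = q.  This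
  form is the closure of f |-> <f, H f> on the domain of H: f is the limit in
  L^2 of a sequence in the domain of H which is Cauchy for the form, and q is
  the limit of the values of the form along this sequence. *)

Definition quad_form H f (q : R) : Prop :=
  L2 f /\ exists u v : nat -> (R -> R[i]),
    [/\ forall n, H (u n, v n),
        (fun n => norm2 (u n \- f)) @ \oo --> (0 : R),
        forall e : R, 0 < e -> exists N : nat, forall m n : nat,
          (N <= m)%N -> (N <= n)%N ->
          complex.Re (inner (u m \- u n) (v m \- v n)) < e &
        (fun n => complex.Re (inner (u n) (v n))) @ \oo --> q].

(* K <= H in the sense of quadratic forms *)
Definition form_le K H : Prop := forall f (q : R), quad_form H f q ->
  exists2 q' : R, quad_form K f q' & q' <= q.

Definition pos_selfadjoint_ext A H : Prop :=
  [/\ selfadjoint H, positive_op H & A `<=` H].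

Definition is_Friedrichs A F : Prop :=
  pos_selfadjoint_ext A F /\
  forall H, pos_selfadjoint_ext A H -> form_le H F.

Definition is_Krein A K : Prop :=
  pos_selfadjoint_ext A K /\
  forall H, pos_selfadjoint_ext A H -> form_le K H.

(* D is dense in the domain of A for the graph topology *)
Definition graph_dense (D : set (R -> R[i])) A : Prop :=
  forall f g, A (f, g) -> forall e : R, 0 < e ->
    exists u v, [/\ D u, A (u, v), norm2 (f \- u) < e & norm2 (g \- v) < e].

(** * The operators under study *)

Definition L0max : operator := [set p |
  [/\ L2 p.1, L2 p.2 & eqD (L0_dist (dist_of p.1)) (dist_of p.2)]].

Definition L0min : operator :=
  closure_op (restriction L0max [set f | test_function f]).

Definition H0 (xi : R -> R[i]) : operator :=
  restriction L0max [set f | exists g c, domain_op L0min g /\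
    f = g \+ scale c (fun x => xi x * (Num.sqrt x)%:C)].

Definition u_theta (theta x : R) : R :=
  Num.sqrt x * ln x * cos theta + Num.sqrt x * sin theta.

(* An element of the domain of L0max has a (unique) continuously differentiable
   representative h; the boundary condition is about h. *)
Definition H0theta (theta : R) : operator :=
  restriction L0max [set f | exists h, [/\ C1 h, eqL2 f h &
    (fun x => complex.Re `| (u_theta theta x)%:C * cderiv h x
                            - (derive1 (u_theta theta) x)%:C * h x |)
      @ (0 : R)^'+ --> (0 : R)]].

Definition A_half : operator := [set p |
  [/\ L2 p.1, L2 p.2 & eqD (A_half_dist (dist_of p.1)) (dist_of p.2)]].

End HalfLine.

Arguments halfline R : clear implicits.
Arguments L0max R : clear implicits.
Arguments L0min R : clear implicits.
Arguments A_half R : clear implicits.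

(* Main.v *)
Require Import Defs.
From mathcomp Require Import all_boot all_order all_algebra.
From mathcomp Require Import complex.
From mathcomp Require Import all_classical all_reals all_analysis.
From mathcomp Require Import measurable_realfun.
From mathcomp Require Import ring lra.

Set Implicit Arguments.
Unset Strict Implicit.
Unset Printing Implicit Defensive.

Import Order.TTheory GRing.Theory Num.Theory.
Import numFieldNormedType.Exports.

Local Open Scope classical_set_scope.
Local Open Scope ring_scope.

(** Put L = - d^2/dx^2 - 1/(4 x^2) and A = - i d/dx + i/(2 x), so that L = A^* A
    formally. The idea is to describe all the operators by boundary values at
    0. The substitution f = sqrt x * w turns L f = g into the system
    w' = p / x, p' = - sqrt x * g ([weakL_sol]), and A f into - i p / sqrt x. If
    f and g are square integrable, then p has a limit d at 0 and w - d ln x a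
    limit c ([sol_BV]): f behaves as sqrt x (c + d ln x). In Green's formula
    for L the terms at infinity vanish, and what remains is the nondegenerate
    form c d' - d c' ([green]). Therefore the subspaces P of C^2 parametrise
    the operators between L0min, for which P = 0 ([L_core], [L0minE]), and
    L0max, and taking adjoints is taking orthogonals in C^2
    ([bvop_adjoint]). The operator H0 is the one with d = 0 ([H0E]), and
    H0^theta the one with sin theta * d = cos theta * c ([H0thetaE]).

    If d = 0, then <f, L f> is the integral of p^2 / x, that is |A f|^2
    ([form_sol]); conversely p / sqrt x can only be square integrable if
    d = 0 ([sol_c2_eq0]). Since test functions are a core of A ([A_core]), it
    follows that H0 = A^* A ([Astar_A]), and H0 is positive.

    For |z| = 1 and Re z <= 0 the operator H0 - z is onto ([ran_onto]). Hence
    the function sqrt x * ln x, cut off and corrected by an element of D(H0),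
    gives a square integrable solution of L k = z k with d = 1
    ([kernel_exists]). It spans the solutions, because H0 has no eigenvalue
    outside [0, oo): for z = i and z = - i this gives the deficiency indices.
    For z = - 1, the dilations of k are eigenfunctions for negative
    eigenvalues, and they realise every real ratio c / d ([eigen_dilation]).

    In particular tan theta is such a ratio, so that H0^theta has a negative
    eigenvalue if cos theta is not 0. Two of them would give a plane on which
    the form is negative; this plane contains a nonzero element with d = 0,
    where the form is that of H0 ([theta_eigen_unique]). The same
    eigenfunctions show that H0 is the only positive self-adjoint extension of
    L0min: if the domain of a self-adjoint extension contains f with d != 0,
    then c / d is real, and the domain contains the negative eigenfunction
    with this ratio ([ext_sub_H0]). So H0 is both the Friedrichs and the Krein
    extension. *)

(** * Integrals and square-integrable functions on (0, oo) *)

Section RealIntegrals.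
Context {R : realType}.
Local Notation mu := (@lebesgue_measure R).
Local Notation hl := (halfline R).
Implicit Types (f g h : R -> R) (x c : R).

Definition integ f := mu.-integrable hl (EFin \o f).
Definition I f : R := \int[mu]_(x in hl) f x.
Definition rL2 f := measurable_fun hl f /\ integ (fun x => f x ^+ 2).

Lemma halflineE x : hl x = (0 < x) :> Prop.
Proof. by rewrite /halfline /= in_itv /= andbT. Qed.

Lemma measurable_halfline : measurable (hl : set (measurableTypeR R)).
Proof. exact: measurable_itv. Qed.
Local Hint Resolve measurable_halfline : core.

Lemma integ_meas f : integ f -> measurable_fun hl f.
Proof. by move=> /integrableP[/measurable_EFinP]. Qed.

Lemma eq_integ f g : (forall x, 0 < x -> f x = g x) -> integ f -> integ g.
Proof.
move=> fg; apply: eq_integrable => // x; rewrite inE halflineE => x0 /=.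
by rewrite fg.
Qed.

Lemma eq_I f g : (forall x, 0 < x -> f x = g x) -> I f = I g.
Proof.
by move=> fg; apply: eq_Rintegral => x; rewrite inE halflineE; exact: fg.
Qed.

Lemma integD f g : integ f -> integ g -> integ (fun x => f x + g x).
Proof. by move=> fi gi; have := integrableD measurable_halfline fi gi. Qed.

Lemma integZ c f : integ f -> integ (fun x => c * f x).
Proof. by move=> fi; have := integrableZl measurable_halfline c fi. Qed.

Lemma integN f : integ f -> integ (fun x => - f x).
Proof. by move=> /(integZ (-1)); apply: eq_integ => x _; rewrite mulN1r. Qed.

Lemma integB f g : integ f -> integ g -> integ (fun x => f x - g x).
Proof. by move=> fi /integN gi; exact: integD. Qed.

Lemma integ0 : integ (fun=> 0).
Proof. exact: integrable0. Qed.

Lemma I_D f g : integ f -> integ g -> I (fun x => f x + g x) = I f + I g.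
Proof. exact: RintegralD. Qed.

Lemma I_Z c f : integ f -> I (fun x => c * f x) = c * I f.
Proof. exact: RintegralZl. Qed.

Lemma I_N f : integ f -> I (fun x => - f x) = - I f.
Proof.
by move=> fi; rewrite -mulN1r -I_Z//; apply: eq_I => x _; rewrite mulN1r.
Qed.

Lemma I_B f g : integ f -> integ g -> I (fun x => f x - g x) = I f - I g.
Proof. exact: RintegralB. Qed.

Lemma I0 : I (fun=> 0) = 0.
Proof. by rewrite /I /Rintegral integral0. Qed.

Lemma le_I f g : integ f -> integ g -> (forall x, 0 < x -> f x <= g x) ->
  I f <= I g.
Proof.
by move=> fi gi fg; apply: le_Rintegral => // x; rewrite halflineE; exact: fg.
Qed.

Lemma I_ge0 f : (forall x, 0 < x -> 0 <= f x) -> 0 <= I f.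
Proof. by move=> f0; apply: Rintegral_ge0 => x; rewrite halflineE; exact: f0. Qed.

Lemma integ_norm f : integ f -> integ (fun x => `|f x|).
Proof. exact: integrable_norm. Qed.

Lemma le_integ f g : measurable_fun hl f -> (forall x, 0 < x -> `|f x| <= g x) ->
  integ g -> integ f.
Proof.
move=> mf fg; apply: le_integrable => //; first exact/measurable_EFinP.
move=> x; rewrite halflineE => x0 /=.
by rewrite lee_fin (le_trans (fg _ x0))// ler_norm.
Qed.

Lemma ae_I f g : measurable_fun hl f -> measurable_fun hl g ->
  ae_eq mu hl f g -> I f = I g.
Proof.
move=> mf mg fg; congr fine; apply: ae_eq_integral => //.
- exact/measurable_EFinP.
- exact/measurable_EFinP.
- by apply: filterS fg => x /[apply] ->.
Qed.

Lemma ae_integ f g : measurable_fun hl g -> ae_eq mu hl f g ->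
  integ f -> integ g.
Proof.
move=> mg fg /integrableP[mf fi]; apply/integrableP; split.
  exact/measurable_EFinP.
rewrite (_ : (\int[mu]_(x in _) _)%E = (\int[mu]_(x in hl) `|(EFin \o f) x|)%E)//.
apply: ae_eq_integral => //.
- by apply: measurableT_comp => //; exact/measurable_EFinP.
- by apply: measurableT_comp.
- by apply: filterS fg => x /[apply] /= ->.
Qed.

Lemma I_eq0 f : integ f -> (forall x, 0 < x -> 0 <= f x) -> I f = 0 ->
  ae_eq mu hl f (fun=> 0).
Proof.
move=> fi f0 If0.
have /measurable_EFinP mf := integ_meas fi.
have /(ae_eq_integral_abs mu measurable_halfline mf) :
    (\int[mu]_(x in hl) `|(EFin \o f) x| = 0)%E.
  rewrite (_ : (\int[mu]_(x in _) _)%E = (\int[mu]_(x in hl) (EFin \o f) x)%E).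
    rewrite -[LHS]fineK; last exact: integrable_fin_num.
    by rewrite -[fine _]/(I f) If0.
  apply: eq_integral => x; rewrite inE halflineE => x0 /=.
  by rewrite ger0_norm// f0.
by apply: filterS => x /[apply] /= -[].
Qed.

Lemma rL2_mul f g : rL2 f -> rL2 g -> integ (fun x => f x * g x).
Proof.
move=> [mf fi] [mg gi].
apply: (@le_integ _ (fun x => f x ^+ 2 + g x ^+ 2)).
- exact: measurable_funM.
- move=> x _; rewrite normrM -(real_normK (num_real (f x))).
  rewrite -(real_normK (num_real (g x))).
  have := sqr_ge0 (`|f x| - `|g x|); have := normr_ge0 (f x).
  have := normr_ge0 (g x); nra.
- exact: integD.
Qed.

Lemma rL2D f g : rL2 f -> rL2 g -> rL2 (fun x => f x + g x).
Proof.
move=> fL gL; have fg := rL2_mul fL gL; case: fL gL => mf fi [mg gi].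
split; first exact: measurable_funD.
apply: (@eq_integ (fun x => (f x ^+ 2 + 2 * (f x * g x)) + g x ^+ 2)).
  by move=> x _; ring.
by apply: integD => //; apply: integD => //; apply: integZ.
Qed.

Lemma rL2Z c f : rL2 f -> rL2 (fun x => c * f x).
Proof.
move=> [mf fi]; split; first exact: measurable_funM.
apply: (@eq_integ (fun x => c ^+ 2 * f x ^+ 2)); first by move=> x _; ring.
exact: integZ.
Qed.

Lemma rL2N f : rL2 f -> rL2 (fun x => - f x).
Proof.
move=> /(rL2Z (-1)); rewrite (_ : (fun x => -1 * f x) = (fun x => - f x))//.
by apply/funext => x; rewrite mulN1r.
Qed.

Lemma rL2B f g : rL2 f -> rL2 g -> rL2 (fun x => f x - g x).
Proof. by move=> fi /rL2N gi; exact: rL2D. Qed.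

Lemma rL2_0 : rL2 (fun=> 0).
Proof. by split => //; apply: (eq_integ _ integ0) => x _; rewrite expr0n. Qed.

Lemma eq_rL2 f g : (forall x, 0 < x -> f x = g x) -> rL2 f -> rL2 g.
Proof.
move=> fg [mf fi]; split.
  by apply: eq_measurable_fun mf => x; rewrite inE halflineE; exact: fg.
by apply: eq_integ fi => x x0; rewrite fg.
Qed.

Lemma ae_rL2 f g : measurable_fun hl g -> ae_eq mu hl f g -> rL2 f -> rL2 g.
Proof.
move=> mg fg [mf fi]; split=> //.
apply: ae_integ fi; first exact: measurable_funX.
by apply: filterS fg => x /[apply] ->.
Qed.

Lemma aeeq_sub0 f g : ae_eq mu hl (fun x => f x - g x) (fun=> 0) ->
  ae_eq mu hl f g.
Proof. by apply: filterS => x /[apply] /eqP; rewrite subr_eq0 => /eqP. Qed.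

Definition dotp f g : R := I (fun x => f x * g x).

Lemma dotpC f g : dotp f g = dotp g f.
Proof. by apply: eq_I => x _; rewrite mulrC. Qed.

Lemma dotp_ge0 f : 0 <= dotp f f.
Proof. by apply: I_ge0 => x _; rewrite -expr2 sqr_ge0. Qed.

Lemma dotpDl f g h : rL2 f -> rL2 g -> rL2 h ->
  dotp (fun x => f x + g x) h = dotp f h + dotp g h.
Proof.
move=> fL gL hL; rewrite /dotp -I_D; [|exact: rL2_mul..].
by apply: eq_I => x _; rewrite mulrDl.
Qed.

Lemma dotpZl c f g : rL2 f -> rL2 g -> dotp (fun x => c * f x) g = c * dotp f g.
Proof.
move=> fL gL; rewrite /dotp -I_Z; last exact: rL2_mul.
by apply: eq_I => x _; rewrite mulrA.
Qed.

Lemma dotpNl f g : rL2 f -> rL2 g -> dotp (fun x => - f x) g = - dotp f g.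
Proof.
move=> fL gL; rewrite /dotp -I_N; last exact: rL2_mul.
by apply: eq_I => x _; rewrite mulNr.
Qed.

Lemma dotpBl f g h : rL2 f -> rL2 g -> rL2 h ->
  dotp (fun x => f x - g x) h = dotp f h - dotp g h.
Proof. by move=> fL gL hL; rewrite dotpDl ?dotpNl//; exact: rL2N. Qed.

Lemma dotp0 f : rL2 f -> dotp f f = 0 -> ae_eq mu hl f (fun=> 0).
Proof.
move=> fL f0.
have : ae_eq mu hl (fun x => f x * f x) (fun=> 0).
  apply: I_eq0 => //; first exact: rL2_mul.
  by move=> x _; rewrite -expr2 sqr_ge0.
by apply: filterS => x /[apply] /eqP; rewrite mulf_eq0 orbb => /eqP.
Qed.

Lemma ae_dotp f f' g g' : rL2 f -> rL2 f' -> rL2 g -> rL2 g' ->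
  ae_eq mu hl f f' -> ae_eq mu hl g g' -> dotp f g = dotp f' g'.
Proof.
move=> fL fL' gL gL' ff' gg'; apply: ae_I.
- by apply: integ_meas; apply: rL2_mul.
- by apply: integ_meas; apply: rL2_mul.
- by apply: filterS2 ff' gg' => x h1 h2 x0; rewrite h1// h2.
Qed.

(** The quadratic polynomial t |-> |f - t g|^2 is nonnegative, so that its
    discriminant is nonpositive. *)
Lemma dotp_CS f g : rL2 f -> rL2 g -> dotp f g ^+ 2 <= dotp f f * dotp g g.
Proof.
move=> fL gL.
have key t : 0 <= dotp f f - 2 * t * dotp f g + t ^+ 2 * dotp g g.
  have [ff fg gg] : [/\ integ (fun x => f x * f x), integ (fun x => f x * g x) &
    integ (fun x => g x * g x)] by split; exact: rL2_mul.
  apply: le_trans (dotp_ge0 (fun x => f x - t * g x)) _.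
  rewrite /dotp -!I_Z// -I_B//; last exact: integZ.
  rewrite -I_D; [|by apply: integB => //; exact: integZ|exact: integZ].
  by rewrite le_eqVlt; apply/orP; left; apply/eqP/eq_I => x _; ring.
have [g0|g0] := eqVneq (dotp g g) 0.
  rewrite g0 mulr0.
  have [->|fg0] := eqVneq (dotp f g) 0; first by rewrite expr0n.
  have := key ((dotp f f + 1) / (2 * dotp f g)).
  rewrite g0 mulr0 addr0.
  have -> : 2 * ((dotp f f + 1) / (2 * dotp f g)) * dotp f g = dotp f f + 1.
    by field.
  by lra.
have gp : 0 < dotp g g by rewrite lt_neqAle eq_sym g0 dotp_ge0.
have := key (dotp f g / dotp g g).
have -> : dotp f f - 2 * (dotp f g / dotp g g) * dotp f g +
  (dotp f g / dotp g g) ^+ 2 * dotp g g =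
  (dotp f f * dotp g g - dotp f g ^+ 2) / dotp g g by field.
by rewrite pmulr_lge0 ?invr_gt0// subr_ge0.
Qed.

End RealIntegrals.
#[global] Hint Resolve measurable_halfline : core.

(** * Derivatives and test functions on (0, oo) *)

Section Smooth.
Context {R : realType}.
Implicit Types (f g F G : R -> R) (x c : R).

Definition hasD F f := forall x, 0 < x -> is_derive x (1 : R) F (f x).
Definition contp f := forall x, 0 < x -> {for x, continuous f}.

Lemma near_pos x : 0 < x -> \forall y \near x, 0 < y.
Proof. by move=> x0; exact: (@lt_nbhsr R 0 x x0). Qed.

Lemma near_pos_eq f g x : 0 < x -> (forall y, 0 < y -> f y = g y) ->
  \forall y \near x, f y = g y.
Proof. by move=> x0 fg; near do apply: fg; exact: near_pos. Unshelve. all: by end_near. Qed.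

Lemma eq_hasD F G f g : (forall x, 0 < x -> F x = G x) ->
  (forall x, 0 < x -> f x = g x) -> hasD F f -> hasD G g.
Proof.
move=> FG fg Ff x x0; rewrite -fg//.
by apply: near_eq_is_derive (Ff x x0); exact: near_pos_eq.
Qed.

Lemma hasD_eq F f g : (forall x, 0 < x -> f x = g x) -> hasD F f -> hasD F g.
Proof. by move=> fg; exact: eq_hasD. Qed.

Lemma hasD_derive1 F f x : hasD F f -> 0 < x -> F^`()%classic x = f x.
Proof. by move=> Ff x0; rewrite derive1E; have [_ ->] := Ff x x0. Qed.

Lemma hasD_derivable F f x : hasD F f -> 0 < x -> derivable F x 1.
Proof. by move=> Ff x0; have [] := Ff x x0. Qed.

Lemma derivable_hasD F : (forall x, 0 < x -> derivable F x 1) ->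
  hasD F (F^`()%classic).
Proof. by move=> dF x x0; apply: DeriveDef; [exact: dF|rewrite derive1E]. Qed.

Lemma hasD_contp F f : hasD F f -> contp F.
Proof.
move=> Ff x x0; apply: differentiable_continuous; apply/derivable1_diffP.
exact: hasD_derivable Ff x0.
Qed.

Lemma eq_contp f g : (forall x, 0 < x -> f x = g x) -> contp f -> contp g.
Proof.
move=> fg cf x x0; rewrite /prop_for /continuous_at -fg//.
apply: cvg_trans (cf x x0); apply: near_eq_cvg.
by apply: near_pos_eq => // y y0; rewrite fg.
Qed.

Lemma hasD_cst c : hasD (fun=> c) (fun=> 0).
Proof. by move=> x _; exact: is_derive_cst. Qed.

Lemma hasD_id : hasD (fun x => x) (fun=> 1).
Proof. by move=> x _; exact: is_derive_id. Qed.

Lemma hasD_D F G f g : hasD F f -> hasD G g ->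
  hasD (fun x => F x + G x) (fun x => f x + g x).
Proof. by move=> Ff Gg x x0; apply: is_deriveD; [exact: Ff|exact: Gg]. Qed.

Lemma hasD_M F G f g : hasD F f -> hasD G g ->
  hasD (fun x => F x * G x) (fun x => F x * g x + f x * G x).
Proof.
move=> Ff Gg x x0; have := is_deriveM (Ff x x0) (Gg x x0).
by rewrite /GRing.scale /= [G x * _]mulrC.
Qed.

Lemma hasD_Z c F f : hasD F f -> hasD (fun x => c * F x) (fun x => c * f x).
Proof.
move=> Ff; apply: hasD_eq (hasD_M (hasD_cst c) Ff) => x _; rewrite mul0r addr0//.
Qed.

Lemma hasD_N F f : hasD F f -> hasD (fun x => - F x) (fun x => - f x).
Proof.
by move=> /(hasD_Z (-1)); apply: eq_hasD => x _; rewrite mulN1r.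
Qed.

Lemma hasD_B F G f g : hasD F f -> hasD G g ->
  hasD (fun x => F x - G x) (fun x => f x - g x).
Proof. by move=> Ff /hasD_N; exact: hasD_D. Qed.

Lemma hasD_inv : hasD (fun x => x^-1) (fun x => - (x^-1 * x^-1)).
Proof.
move=> x x0; have := @is_deriveV R id x 1 1 (lt0r_neq0 x0) (is_derive_id x 1).
by rewrite /GRing.scale /= mulr1 expr2 invfM.
Qed.

Lemma hasD_sqrt : hasD (@Num.sqrt R) (fun x => 2^-1 * (Num.sqrt x * x^-1)).
Proof.
move=> x x0; have := is_derive1_sqrt x0.
congr (is_derive _ _ _ _); rewrite invfM; congr (_ * _).
have sx : Num.sqrt x != 0 by rewrite gt_eqF// sqrtr_gt0.
by apply: (mulfI sx); rewrite mulfV// mulrA -expr2 sqr_sqrtr ?ltW// mulfV ?gt_eqF.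
Qed.

Lemma hasD_ln : hasD (@ln R) (fun x => x^-1).
Proof. by move=> x x0; exact: is_derive1_ln. Qed.

Lemma hasD_comp F f g h : (forall x, 0 < x -> 0 < g x) -> hasD F f -> hasD g h ->
  hasD (fun x => F (g x)) (fun x => f (g x) * h x).
Proof.
by move=> gp Ff gh x x0; apply: is_derive1_comp; [exact: Ff (gp x x0)|exact: gh].
Qed.

Lemma contp_D f g : contp f -> contp g -> contp (fun x => f x + g x).
Proof. by move=> cf cg x x0; apply: cvgD; [exact: cf|exact: cg]. Qed.

Lemma contp_M f g : contp f -> contp g -> contp (fun x => f x * g x).
Proof. by move=> cf cg x x0; apply: cvgM; [exact: cf|exact: cg]. Qed.

Lemma contp_N f : contp f -> contp (fun x => - f x).
Proof. by move=> cf x x0; apply: cvgN; exact: cf. Qed.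

Lemma contp_cst c : contp (fun=> c).
Proof. by move=> x _; exact: cvg_cst. Qed.

Lemma contp_inv : contp (fun x : R => x^-1).
Proof. exact: hasD_contp hasD_inv. Qed.

Lemma contp_sqrt : contp (@Num.sqrt R).
Proof. exact: hasD_contp hasD_sqrt. Qed.

Lemma contp_id : contp (fun x => x).
Proof. exact: hasD_contp hasD_id. Qed.

Lemma contp_meas f : contp f -> measurable_fun (halfline R) f.
Proof.
move=> cf; apply: open_continuous_measurable_fun; first exact: interval_open.
by move=> x; rewrite inE halflineE => /cf.
Qed.

(** Whereas [smooth] speaks of the derivative of the n-th derivative, this
    recursion peels off the first derivative, as the inductions for products
    and composites require. *)
Fixpoint dn n f : Prop :=
  if n is m.+1 then (forall x, 0 < x -> derivable f x 1) /\ dn m (f^`()%classic)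
  else True.

Definition smooth f := forall n x, 0 < x -> derivable (derive1n n f) x 1.

Lemma smooth_dn f : smooth f <-> forall n, dn n f.
Proof.
split => [sf n|].
  elim: n f sf => //= n IH f sf; split; first by move=> x /(sf 0%N).
  by apply: IH => m x x0; rewrite -derive1Sn; exact: sf.
move=> df n; elim: n f df => [|n IH] f df x x0; first exact: (df 1%N).1.
by rewrite derive1Sn; apply: IH => // m; exact: (df m.+1).2.
Qed.

Lemma dn_ext n f g : (forall x, 0 < x -> f x = g x) -> dn n f -> dn n g.
Proof.
elim: n f g => //= n IH f g fg [df dnf]; split.
  move=> x x0; apply: near_eq_derivable (df x x0).
  exact: near_pos_eq.
apply: IH dnf => x x0; rewrite !derive1E; apply: near_eq_derive.
exact: near_pos_eq.
Qed.

Lemma dnS n F f : hasD F f -> dn n f -> dn n.+1 F.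
Proof.
move=> Ff df; split; first by move=> x; exact: hasD_derivable Ff.
by apply: dn_ext df => x x0; rewrite (hasD_derive1 Ff).
Qed.

Lemma dnW n f : dn n.+1 f -> dn n f.
Proof. by elim: n f => //= n IH f [df dnf]; split => //; exact: IH. Qed.

Lemma dn_hasD n f : dn n.+1 f -> hasD f (f^`()%classic).
Proof. by move=> [df _]; exact: derivable_hasD. Qed.

Lemma dn_cst n c : dn n (fun=> c).
Proof. by elim: n c => // n IH c; apply: dnS (@hasD_cst c) (IH 0). Qed.

Lemma dn_D n f g : dn n f -> dn n g -> dn n (fun x => f x + g x).
Proof.
elim: n f g => // n IH f g df dg.
by apply: dnS (hasD_D (dn_hasD df) (dn_hasD dg)) (IH _ _ df.2 dg.2).
Qed.

Lemma dn_M n f g : dn n f -> dn n g -> dn n (fun x => f x * g x).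
Proof.
elim: n f g => // n IH f g df dg.
apply: dnS (hasD_M (dn_hasD df) (dn_hasD dg)) _; apply: dn_D; apply: IH.
- exact: dnW.
- exact: dg.2.
- exact: df.2.
- exact: dnW.
Qed.

Lemma dn_inv n : dn n (fun x : R => x^-1).
Proof.
elim: n => // n IH; apply: (dnS hasD_inv).
apply: (@dn_ext _ (fun x => -1 * (x^-1 * x^-1))) => [x _|]; first by rewrite mulN1r.
by apply: dn_M; [exact: dn_cst|exact: dn_M].
Qed.

Lemma dn_id n : dn n (fun x : R => x).
Proof. by case: n => // n; apply: (dnS hasD_id); exact: dn_cst. Qed.

Lemma dn_sqrt n : dn n (@Num.sqrt R).
Proof.
elim: n => // n IH; apply: (dnS hasD_sqrt).
by apply: dn_M; [exact: dn_cst|apply: dn_M => //; exact: dn_inv].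
Qed.

Lemma dn_comp n f g : (forall x, 0 < x -> 0 < g x) -> dn n f -> dn n g ->
  dn n (fun x => f (g x)).
Proof.
move=> gp; elim: n f => // n IH f df dg.
apply: dnS (hasD_comp gp (dn_hasD df) (dn_hasD dg)) _; apply: dn_M.
- by apply: IH; [exact: df.2|exact: dnW].
- exact: dg.2.
Qed.

Lemma smooth_ext f g : (forall x, 0 < x -> f x = g x) -> smooth f -> smooth g.
Proof. by move=> fg /smooth_dn df; apply/smooth_dn => n; exact: dn_ext (df n). Qed.

Lemma smooth_hasD f : smooth f -> hasD f (f^`()%classic).
Proof. by move=> sf; apply: derivable_hasD => x; exact: (sf 0%N). Qed.

Lemma smooth_derive f : smooth f -> smooth (f^`()%classic).
Proof. by move=> sf n x x0; rewrite -derive1Sn; exact: sf. Qed.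

Lemma smooth_prim F f : hasD F f -> smooth f -> smooth F.
Proof.
move=> Ff /smooth_dn df; apply/smooth_dn => -[//|n].
exact: (dnS Ff).
Qed.

Lemma smooth_M f g : smooth f -> smooth g -> smooth (fun x => f x * g x).
Proof. by move=> /smooth_dn sf /smooth_dn sg; apply/smooth_dn => n; exact: dn_M. Qed.

Lemma smooth_D f g : smooth f -> smooth g -> smooth (fun x => f x + g x).
Proof. by move=> /smooth_dn sf /smooth_dn sg; apply/smooth_dn => n; exact: dn_D. Qed.

Lemma smooth_cst c : smooth (fun=> c).
Proof. by apply/smooth_dn => n; exact: dn_cst. Qed.

Lemma smooth_Z c f : smooth f -> smooth (fun x => c * f x).
Proof. move=> sf; exact: (smooth_M (@smooth_cst c) sf). Qed.

Lemma smooth_id : smooth (fun x => x).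
Proof. by apply/smooth_dn => n; exact: dn_id. Qed.

Lemma smooth_inv : smooth (fun x => x^-1).
Proof. by apply/smooth_dn => n; exact: dn_inv. Qed.

Lemma smooth_sqrt : smooth (@Num.sqrt R).
Proof. by apply/smooth_dn => n; exact: dn_sqrt. Qed.

Lemma smooth_X f n : smooth f -> smooth (fun x => f x ^+ n).
Proof.
move=> sf; elim: n => [|n IH]; first exact: smooth_cst.
apply: (@smooth_ext (fun x => f x * f x ^+ n)); last exact: (smooth_M sf IH).
by move=> x _; rewrite exprS.
Qed.

Lemma smooth_comp f g : (forall x, 0 < x -> 0 < g x) -> smooth f -> smooth g ->
  smooth (fun x => f (g x)).
Proof.
by move=> gp /smooth_dn sf /smooth_dn sg; apply/smooth_dn => n; exact: dn_comp.
Qed.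

Lemma smooth_contp f : smooth f -> contp f.
Proof. by move=> /smooth_hasD; exact: hasD_contp. Qed.

Definition csupp f := exists a b, 0 < a /\ forall x, ~ (a <= x <= b) -> f x = 0.

Definition rtest f := smooth f /\ csupp f.

Lemma csupp_M f g : csupp g -> csupp (fun x => f x * g x).
Proof.
by move=> [a [b [a0 g0]]]; exists a, b; split => // x /g0 ->; rewrite mulr0.
Qed.

Lemma csupp_D f g : csupp f -> csupp g -> csupp (fun x => f x + g x).
Proof.
move=> [a [b [a0 f0]]] [a' [b' [a'0 g0]]].
exists (Num.min a a'), (Num.max b b'); split; first by rewrite lt_min a0.
move=> x xab; rewrite f0 ?g0 ?addr0// => /andP[h1 h2]; apply: xab.
- by rewrite ge_min h1 orbT le_max h2 orbT.
- by rewrite ge_min h1 le_max h2.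
Qed.

(** Outside [a, b] the function vanishes near the point as well. *)
Lemma csupp_derive f : csupp f -> csupp (f^`()%classic).
Proof.
move=> [a [b [a0 f0]]]; exists a, b; split => // x xab.
suff f0x : \forall y \near x, f y = cst 0 y.
  by rewrite derive1E (near_eq_derive _ f0x) derive_cst.
have [xa|ax] := ltP x a.
  near=> y; apply: f0 => /andP[ay _].
  have : y < a by near: y; exact: lt_nbhsl.
  by rewrite ltNge ay.
have bx : b < x by rewrite ltNge; apply/negP => xb; apply: xab; rewrite ax.
near=> y; apply: f0 => /andP[_ yb].
have : b < y by near: y; exact: lt_nbhsr.
by rewrite ltNge yb.
Unshelve. all: by end_near. Qed.

Lemma rtest_M f g : smooth f -> rtest g -> rtest (fun x => f x * g x).
Proof. by move=> sf [sg cg]; split; [exact: smooth_M|exact: csupp_M]. Qed.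

Lemma rtest_Z c g : rtest g -> rtest (fun x => c * g x).
Proof. exact/rtest_M/smooth_cst. Qed.

Lemma rtest_D f g : rtest f -> rtest g -> rtest (fun x => f x + g x).
Proof. by move=> [sf cf] [sg cg]; split; [exact: smooth_D|exact: csupp_D]. Qed.

Lemma rtest_N g : rtest g -> rtest (fun x => - g x).
Proof.
move=> /(rtest_Z (-1)); rewrite (_ : (fun x => -1 * g x) = (fun x => - g x))//.
by apply/funext => x; rewrite mulN1r.
Qed.

Lemma rtest_derive f : rtest f -> rtest (f^`()%classic).
Proof. by move=> [sf cf]; split; [exact: smooth_derive|exact: csupp_derive]. Qed.

Lemma rtest0 : rtest (fun=> 0).
Proof. by split; [exact: smooth_cst|exists 1, 1; split]. Qed.

End Smooth.

(** * Locally absolutely continuous functions *)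

Section Primitives.
Context {R : realType}.
Local Notation mu := (@lebesgue_measure R).
Implicit Types (f g h k l F P Q : R -> R) (x a b c : R).

Definition loc_integ f := forall a b, 0 < a -> mu.-integrable `[a, b] (EFin \o f).
Definition IntI a b f : R := \int[mu]_(x in `[a, b]) f x.

Let mI a b : measurable (`[a, b]%classic : set (measurableTypeR R)).
Proof. exact: measurable_itv. Qed.

Lemma within_contp f a b : 0 < a -> contp f -> {within `[a, b], continuous f}.
Proof.
move=> a0 cf; apply: continuous_in_subspaceT => x; rewrite inE /= in_itv /=.
by move=> /andP[ax _]; apply: cf; exact: lt_le_trans ax.
Qed.

Lemma loc_integ_contp f : contp f -> loc_integ f.
Proof.
move=> cf a b a0; apply: continuous_compact_integrable => //.
- exact: segment_compact.
- exact: within_contp.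
Qed.

Lemma loc_integ_meas f a b : 0 < a -> loc_integ f -> measurable_fun `[a, b] f.
Proof. by move=> a0 /(_ a b a0) /integrableP[/measurable_EFinP]. Qed.

Lemma eq_loc_integ f g : (forall x, 0 < x -> f x = g x) -> loc_integ f -> loc_integ g.
Proof.
move=> fg lf a b a0; apply: eq_integrable (lf a b a0) => //.
move=> x; rewrite inE /= in_itv /= => /andP[ax _].
by rewrite fg// (lt_le_trans a0).
Qed.

Lemma loc_integ_D f g : loc_integ f -> loc_integ g -> loc_integ (fun x => f x + g x).
Proof. by move=> lf lg a b a0; have := integrableD (@mI a b) (lf a b a0) (lg a b a0). Qed.

Lemma loc_integ_Z c f : loc_integ f -> loc_integ (fun x => c * f x).
Proof. by move=> lf a b a0; have := integrableZl (@mI a b) c (lf a b a0). Qed.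

Lemma loc_integ_N f : loc_integ f -> loc_integ (fun x => - f x).
Proof. by move=> /(loc_integ_Z (-1)); apply: eq_loc_integ => x _; rewrite mulN1r. Qed.

Lemma loc_integ_B f g : loc_integ f -> loc_integ g -> loc_integ (fun x => f x - g x).
Proof. by move=> lf /loc_integ_N; exact: loc_integ_D. Qed.

Lemma loc_integ_norm f : loc_integ f -> loc_integ (fun x => `|f x|).
Proof. by move=> lf a b a0; have := integrable_norm (lf a b a0). Qed.

Lemma contp_bounded f a b : 0 < a -> contp f ->
  exists2 M, 0 <= M & forall x, a <= x <= b -> `|f x| <= M.
Proof.
move=> a0 cf; have [ab|ba] := leP a b; last first.
  exists 0 => // x /andP[ax xb].
  by have := lt_le_trans ba (le_trans ax xb); rewrite ltxx.
have cn : {within `[a, b], continuous (fun x => `|f x|)}.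
  apply: within_contp => // x x0; apply: cvg_norm; exact: cf.
have [c _ Hc] := EVT_max ab cn; by exists `|f c|.
Qed.

Lemma loc_integ_M f g : contp g -> loc_integ f -> loc_integ (fun x => g x * f x).
Proof.
move=> cg lf a b a0.
have [M M0 HM] := contp_bounded b a0 cg.
have := @integrableMr _ _ R mu `[a, b] (@mI a b) g (EFin \o f).
apply => //.
- by apply: loc_integ_meas => //; exact: loc_integ_contp.
- exists M; split; first exact: num_real.
  move=> N MN x /=; rewrite in_itv /= => xab.
  by rewrite (le_trans (HM x xab))// ltW.
- exact: lf.
Qed.

Lemma loc_integ_integ f : integ f -> loc_integ f.
Proof.
move=> fi a b a0; apply: integrableS fi => // x /=; rewrite halflineE in_itv /=.
by move=> /andP[ax _]; exact: lt_le_trans ax.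
Qed.

Lemma loc_integ_meas_hl f : loc_integ f -> measurable_fun (halfline R) f.
Proof.
move=> lf.
have -> : halfline R = \bigcup_n `[n.+1%:R^-1, n%:R]%classic.
  apply/seteqP; split => x /=.
    rewrite halflineE => x0.
    have [n1 Hn1] : exists n, n.+1%:R^-1 <= x.
      have /ltr_add_invr[k] := x0; rewrite add0r => kx; exists k; exact: ltW.
    pose m := maxn n1 (Num.truncn x).+1.
    exists m => //=; rewrite in_itv /=; apply/andP; split.
      apply: le_trans Hn1; rewrite lef_pV2 ?posrE ?ltr0n// ler_nat ltnS.
      exact: leq_maxl.
    apply: (le_trans (ltW (truncnS_gt x))).
    by rewrite ler_nat leq_maxr.
  move=> [n _ /=]; rewrite in_itv /= halflineE => /andP[+ _].
  by apply: lt_le_trans; rewrite invr_gt0 ltr0n.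
apply/measurable_fun_bigcup => // n; apply: loc_integ_meas lf.
by rewrite invr_gt0 ltr0n.
Qed.

Lemma loc_integ_rL2 f : rL2 f -> loc_integ f.
Proof.
move=> [mf fi] a b a0.
apply: (@le_integrable _ _ R mu `[a, b] (@mI a b) _ (EFin \o (fun x => 1 + f x ^+ 2))).
- apply/measurable_EFinP; apply: measurable_funS mf; first exact: measurable_halfline.
  by move=> x /=; rewrite halflineE in_itv /= => /andP[ax _]; exact: lt_le_trans ax.
- move=> x _ /=; rewrite lee_fin [leRHS]ger0_norm; last by rewrite addr_ge0// sqr_ge0.
  rewrite -(real_normK (num_real (f x))).
  by have := sqr_ge0 (`|f x| - 1); have := normr_ge0 (f x); nra.
- have := @loc_integ_D (fun=> 1) (fun x => f x ^+ 2); apply => //.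
  + apply: loc_integ_contp; exact: contp_cst.
  + exact: loc_integ_integ.
Qed.

Lemma eq_IntI a b f g : 0 < a -> (forall x, 0 < x -> f x = g x) ->
  IntI a b f = IntI a b g.
Proof.
move=> a0 fg; apply: eq_Rintegral => x; rewrite inE /= in_itv /= => /andP[ax _].
by apply: fg; exact: lt_le_trans ax.
Qed.

Lemma IntI_D a b f g : 0 < a -> loc_integ f -> loc_integ g ->
  IntI a b (fun x => f x + g x) = IntI a b f + IntI a b g.
Proof. by move=> a0 lf lg; apply: RintegralD => //; [exact: lf|exact: lg]. Qed.

Lemma IntI_Z a b c f : 0 < a -> loc_integ f ->
  IntI a b (fun x => c * f x) = c * IntI a b f.
Proof. by move=> a0 lf; apply: RintegralZl => //; exact: lf. Qed.

Lemma IntI_B a b f g : 0 < a -> loc_integ f -> loc_integ g ->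
  IntI a b (fun x => f x - g x) = IntI a b f - IntI a b g.
Proof. by move=> a0 lf lg; apply: RintegralB => //; [exact: lf|exact: lg]. Qed.

Lemma IntI_cat a b c f : 0 < a -> a <= b -> b <= c -> loc_integ f ->
  IntI a c f = IntI a b f + IntI b c f.
Proof.
move=> a0 ab bc lf.
have H := @Rintegral_itvB R f (BLeft a) (BRight c) b (lf a c a0).
rewrite /IntI -[X in _ = _ + X](@Rintegral_itv_obnd_cbnd R b (BRight c) f); last first.
  apply: integrableS (lf b c (lt_le_trans a0 ab)) => //.
  by apply: subset_itvr; rewrite bnd_simp.
by rewrite -H ?bnd_simp//; rewrite addrC subrK.
Qed.

Lemma le_IntI a b f g : 0 < a -> loc_integ f -> loc_integ g ->
  (forall x, a <= x <= b -> f x <= g x) -> IntI a b f <= IntI a b g.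
Proof.
by move=> a0 lf lg fg; apply: le_Rintegral => //; [exact: lf|exact: lg].
Qed.

Lemma norm_IntI a b f : 0 < a -> loc_integ f ->
  `|IntI a b f| <= IntI a b (fun x => `|f x|).
Proof. by move=> a0 lf; apply: le_normr_Rintegral => //; exact: lf. Qed.

Lemma IntI_cst a b c : a <= b -> IntI a b (fun=> c) = c * (b - a).
Proof.
move=> ab; rewrite /IntI Rintegral_cst; last exact: mI.
have := @lebesgue_measure_itv R `[a, b]; rewrite /= lte_fin => muab.
congr (_ * _); rewrite [X in fine X = _]muab.
case: ltP => [_ //|ba]; have -> : b = a by apply/le_anti; rewrite ba.
by rewrite subrr.
Qed.

Lemma IntI_ge0 a b f : (forall x, a <= x <= b -> 0 <= f x) -> 0 <= IntI a b f.
Proof.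
move=> f0; apply: Rintegral_ge0 => x /=; rewrite in_itv; exact: f0.
Qed.

Lemma IntI_le_I a b f : 0 < a -> integ f -> (forall x, 0 < x -> 0 <= f x) ->
  IntI a b f <= I f.
Proof.
move=> a0 fi f0.
rewrite /I -lee_fin !fineK; last 2 first.
- exact: integrable_fin_num.
- by apply: integrable_fin_num => //; exact: (loc_integ_integ fi).
apply: ge0_subset_integral => //.
- by case/integrableP: fi.
- by move=> x; rewrite halflineE lee_fin; exact: f0.
- move=> x /=; rewrite halflineE in_itv /= => /andP[ax _].
  exact: lt_le_trans ax.
Qed.

Lemma IntI_ae a b f g : 0 < a -> loc_integ f -> loc_integ g ->
  ae_eq mu (halfline R) f g -> IntI a b f = IntI a b g.
Proof.
move=> a0 lf lg fg; congr fine; apply: ae_eq_integral => //.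
- by have /integrableP[] := lf a b a0.
- by have /integrableP[] := lg a b a0.
- apply: filterS fg => x fgx /=; rewrite in_itv /= => /andP[ax _].
  by rewrite fgx// halflineE (lt_le_trans a0).
Qed.

(** P is locally absolutely continuous, with derivative k almost everywhere. *)
Definition is_prim P k := loc_integ k /\
  forall a b, 0 < a -> a <= b -> P b - P a = IntI a b k.

Lemma prim_loc_integ P k : is_prim P k -> loc_integ k. Proof. by case. Qed.

Lemma eq_prim P Q k l : (forall x, 0 < x -> P x = Q x) ->
  (forall x, 0 < x -> k x = l x) -> is_prim P k -> is_prim Q l.
Proof.
move=> PQ kl [lk Pk]; split; first exact: eq_loc_integ lk.
move=> a b a0 ab; rewrite -!PQ ?(lt_le_trans a0 ab)// Pk//.
exact: eq_IntI.
Qed.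

Lemma prim_ae P k l : loc_integ l -> ae_eq mu (halfline R) k l ->
  is_prim P k -> is_prim P l.
Proof.
move=> ll kl [lk Pk]; split => // a b a0 ab; rewrite Pk//; exact: IntI_ae.
Qed.

Lemma prim_D P Q k l : is_prim P k -> is_prim Q l ->
  is_prim (fun x => P x + Q x) (fun x => k x + l x).
Proof.
move=> [lk Pk] [ll Ql]; split; first exact: loc_integ_D.
by move=> a b a0 ab; rewrite IntI_D// -Pk// -Ql//; ring.
Qed.

Lemma prim_Z c P k : is_prim P k -> is_prim (fun x => c * P x) (fun x => c * k x).
Proof.
move=> [lk Pk]; split; first exact: loc_integ_Z.
by move=> a b a0 ab; rewrite IntI_Z// -Pk//; ring.
Qed.

Lemma prim_N P k : is_prim P k -> is_prim (fun x => - P x) (fun x => - k x).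
Proof. by move=> /(prim_Z (-1)); apply: eq_prim => x _; rewrite mulN1r. Qed.

Lemma prim_B P Q k l : is_prim P k -> is_prim Q l ->
  is_prim (fun x => P x - Q x) (fun x => k x - l x).
Proof. by move=> Pk /prim_N; exact: prim_D. Qed.

Lemma prim_shift c P k : is_prim P k -> is_prim (fun x => P x + c) k.
Proof.
move=> [lk Pk]; split => // a b a0 ab; rewrite -Pk//; ring.
Qed.

Lemma prim_exists k : loc_integ k -> exists P, is_prim P k.
Proof.
move=> lk; exists (fun x => if 1 <= x then IntI 1 x k else - IntI x 1 k).
split => // a b a0 ab.
have [a1|a1] := leP 1 a.
  by rewrite (le_trans a1 ab) (@IntI_cat 1 a b)// addrAC subrr add0r.
have [b1|b1] := leP 1 b.
  by rewrite opprK addrC -IntI_cat// ltW.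
rewrite (@IntI_cat a b 1)// ?(ltW b1)//; ring.
Qed.

Lemma hasD_prim F f : hasD F f -> contp f -> is_prim F f.
Proof.
move=> Ff cf; split; first exact: loc_integ_contp.
move=> a b a0; rewrite le_eqVlt => /predU1P[<-|ab].
  by rewrite subrr /IntI set_itv1 Rintegral_set1.
rewrite /IntI /Rintegral (@continuous_FTC2 R f F)//.
- exact: within_contp.
- split.
  + move=> x; rewrite in_itv /= => /andP[ax _]; apply: (hasD_derivable Ff).
    exact: lt_trans ax.
  + by apply: cvg_at_right_filter; exact: (hasD_contp Ff a0).
  + by apply: cvg_at_left_filter; apply: (hasD_contp Ff); exact: lt_trans ab.
- move=> x; rewrite in_itv /= => /andP[ax _]; rewrite (hasD_derive1 Ff)//.
  exact: lt_trans ax.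
Qed.

Lemma prim_contp P k : is_prim P k -> contp P.
Proof.
move=> [lk Pk] x x0.
have x20 : 0 < x / 2 by rewrite divr_gt0.
have x2x : x / 2 <= x + 1 by lra.
have := @parameterized_integral_continuous R (x / 2) (x + 1) k x2x (lk _ _ x20).
move=> /continuous_within_itvP; case; first by lra.
move=> /(_ x) + _ _; rewrite in_itv /= => cx.
have {cx} : {for x, continuous (fun y => P (x / 2) + IntI (x / 2) y k)}.
  apply: cvgD; first exact: cvg_cst.
  by apply: cx; apply/andP; split; lra.
rewrite /prop_for /continuous_at.
rewrite -[in X in _ --> X -> _]Pk//; last by lra.
rewrite addrC subrK => H; apply: cvg_trans H; apply: near_eq_cvg.
have xx2 : x / 2 < x by lra.
near=> y; rewrite -Pk//; first by rewrite addrC subrK.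
by apply: ltW; near: y; exact: lt_nbhsr.
Unshelve. all: by end_near. Qed.

Lemma prim_hasD P k : is_prim P k -> contp k -> hasD P k.
Proof.
move=> [lk Pk] ck x x0.
have x20 : 0 < x / 2 by rewrite divr_gt0.
have xx1 : x < x + 1 by lra.
have x2x : x / 2 < x by lra.
have [dF F'] := @continuous_FTC1_closed R k (x / 2) x (x + 1) xx1
  (lk _ _ x20) x2x (ck x x0).
have : is_derive x 1 (fun y => P (x / 2) + IntI (x / 2) y k) (0 + k x).
  apply: (@is_deriveD _ _ _ (fun=> P (x / 2)) (fun y => IntI (x / 2) y k)).
  by apply: DeriveDef; [exact: dF|rewrite -derive1E; exact: F'].
rewrite add0r; apply: near_eq_is_derive.
near=> y; rewrite -Pk//; first by rewrite addrC subrK.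
by apply: ltW; near: y; exact: lt_nbhsr.
Unshelve. all: by end_near. Qed.

Lemma pow2_small (C y : R) : (forall n : nat, `|y| <= C / 2 ^+ n) -> y = 0.
Proof.
move=> H; apply/eqP; rewrite -normr_le0; apply/ler_addgt0Pl => e e0.
rewrite addr0.
have C0 : 0 <= C by have := H 0%N; rewrite expr0 divr1; exact: le_trans.
pose n := (Num.truncn (C / e)).+1.
apply: le_trans (H n) _; rewrite ler_pdivrMr ?exprn_gt0//.
have : C / e < n%:R by exact: truncnS_gt.
rewrite ltr_pdivrMr// => Hn; apply: (le_trans (ltW Hn)).
by rewrite mulrC ler_pM2l// -natrX ler_nat ltnW// ltn_expl.
Qed.

(** Halving the interval n times divides the bound by 2 ^ n. So an identity
    between additive functions of intervals follows from a quadratic estimate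
    of the defect. *)
Lemma additive_eq0 (D N : R -> R -> R) (a b : R) : a <= b ->
  (forall x y z, a <= x -> x <= y -> y <= z -> z <= b -> D x z = D x y + D y z) ->
  (forall x y z, a <= x -> x <= y -> y <= z -> z <= b -> N x z = N x y + N y z) ->
  (forall x y, a <= x -> x <= y -> y <= b -> `|D x y| <= (y - x) * N x y) ->
  D a b = 0.
Proof.
move=> ab Dadd Nadd DN; apply: (@pow2_small ((b - a) * N a b)) => n.
have : forall x y, a <= x -> x <= y -> y <= b ->
    `|D x y| <= ((y - x) * N x y) / 2 ^+ n; last by apply.
elim: n => [|n IH] x y ax xy yb; first by rewrite expr0 divr1; exact: DN.
pose m := (x + y) / 2.
have xm : x <= m by rewrite /m; lra.
have my : m <= y by rewrite /m; lra.
rewrite (Dadd x m y)//; apply: (le_trans (ler_normD _ _)).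
have h1 := IH x m ax xm (le_trans my yb).
have h2 := IH m y (le_trans ax xm) my yb.
apply: (le_trans (lerD h1 h2)).
rewrite (Nadd x m y)// exprS.
have -> : m - x = (y - x) / 2 by rewrite /m; field.
have -> : y - m = (y - x) / 2 by rewrite /m; field.
rewrite le_eqVlt; apply/orP; left; apply/eqP.
by field; rewrite expf_neq0.
Qed.

(** On [x, y] the defect of the product rule is the integral of (F y - F s) k
    s + (P x - P s) f s. Each term is at most y - x times a bound of f on [a,
    b] times the integral of |k|, whence the factor 2 in N; [additive_eq0]
    concludes. *)
Lemma prim_M F f P k : hasD F f -> contp f -> is_prim P k ->
  is_prim (fun x => F x * P x) (fun x => F x * k x + f x * P x).
Proof.
move=> Ff cf Pk; have [lk PkE] := Pk.
have cF := hasD_contp Ff; have cP := prim_contp Pk.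
have [lf FfE] := hasD_prim Ff cf.
have lFk : loc_integ (fun x => F x * k x) by exact: loc_integ_M.
have lfP : loc_integ (fun x => f x * P x) by apply: loc_integ_contp; exact: contp_M.
have ll : loc_integ (fun x => F x * k x + f x * P x) by exact: loc_integ_D.
split => // a b a0 ab.
have [L L0 HL] := contp_bounded b a0 cf.
pose D x y := F y * P y - F x * P x - IntI x y (fun x => F x * k x + f x * P x).
pose N x y := 2 * L * IntI x y (fun x => `|k x|).
suff : D a b = 0 by move/eqP; rewrite subr_eq0 => /eqP.
apply: (@additive_eq0 D N a b ab).
- move=> x y z ax xy yz zb; rewrite /D (@IntI_cat x y z)//; first by ring.
  exact: lt_le_trans ax.
- move=> x y z ax xy yz zb; rewrite /N (@IntI_cat x y z)//; first by ring.
    exact: lt_le_trans ax.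
  exact: loc_integ_norm.
move=> x y ax xy yb; have x0 : 0 < x by exact: lt_le_trans ax.
have lkn := loc_integ_norm lk.
have N0 u v : 0 <= IntI u v (fun x => `|k x|) by apply: IntI_ge0.
have -> : D x y = IntI x y (fun s => (F y - F s) * k s) +
                  IntI x y (fun s => (P x - P s) * f s).
  rewrite /D.
  have -> : IntI x y (fun s => (F y - F s) * k s) =
    F y * (P y - P x) - IntI x y (fun s => F s * k s).
    rewrite PkE// -IntI_Z// -IntI_B//; last exact: loc_integ_Z.
    by apply: eq_IntI => // s _; ring.
  have -> : IntI x y (fun s => (P x - P s) * f s) =
    P x * (F y - F x) - IntI x y (fun s => f s * P s).
    rewrite FfE// -IntI_Z// -IntI_B//; last exact: loc_integ_Z.
    by apply: eq_IntI => // s _; ring.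
  by rewrite IntI_D//; ring.
apply: (le_trans (ler_normD _ _)).
have cFy : contp (fun s => F y - F s).
  by apply: contp_D; [exact: contp_cst|exact: contp_N].
have cPx : contp (fun s => P x - P s).
  by apply: contp_D; [exact: contp_cst|exact: contp_N].
have lB1 : loc_integ (fun s => (F y - F s) * k s) by exact: loc_integ_M.
have lB2 : loc_integ (fun s => (P x - P s) * f s).
  by apply: loc_integ_contp; exact: contp_M.
have h1 : `|IntI x y (fun s => (F y - F s) * k s)| <=
    L * (y - x) * IntI x y (fun x => `|k x|).
  apply: (le_trans (norm_IntI _ _ _)) => //; rewrite -IntI_Z//.
  apply: le_IntI => //; [exact: loc_integ_norm|exact: loc_integ_Z|].
  move=> s /andP[xs sy]; rewrite normrM ler_wpM2r//.
  have s0 : 0 < s by exact: lt_le_trans xs.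
  rewrite FfE//; apply: (le_trans (norm_IntI _ _ _)) => //.
  apply: (@le_trans _ _ (IntI s y (fun=> L))).
    apply: le_IntI => //; [exact: loc_integ_norm|exact/loc_integ_contp/contp_cst|].
    move=> t /andP[st ty]; apply: HL.
    by rewrite (le_trans ax (le_trans xs st)) (le_trans ty yb).
  by rewrite IntI_cst// ler_wpM2l// lerB.
have h2 : `|IntI x y (fun s => (P x - P s) * f s)| <=
    L * (y - x) * IntI x y (fun x => `|k x|).
  apply: (le_trans (norm_IntI _ _ _)) => //.
  rewrite mulrAC -IntI_cst//.
  apply: le_IntI => //; [exact: loc_integ_norm|exact/loc_integ_contp/contp_cst|].
  move=> s /andP[xs sy]; rewrite normrM mulrC ler_pM//.
    by apply: HL; rewrite (le_trans ax xs) (le_trans sy yb).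
  rewrite -normrN opprB PkE//; apply: (le_trans (norm_IntI _ _ _)) => //.
  rewrite (@IntI_cat x s y)// lerDl; exact: N0.
apply: (le_trans (lerD h1 h2)); rewrite /N le_eqVlt; apply/orP; left; apply/eqP.
by ring.
Qed.

Lemma I_supp l a b : 0 < a -> (forall x, 0 < x -> ~ (a <= x <= b) -> l x = 0) ->
  I l = IntI a b l.
Proof.
move=> a0 l0; rewrite /I Rintegral_mkcond /IntI [RHS]Rintegral_mkcond.
congr fine; apply: eq_integral => x _; congr EFin; rewrite !patchE.
case: ifPn => [/set_mem|/negP xhl].
  rewrite halflineE => x0; case: ifPn => // /negP xab; apply: l0 => // xab'.
  by apply: xab; rewrite inE /= in_itv.
case: ifPn => // /set_mem /=; rewrite in_itv /= => /andP[ax _].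
by exfalso; apply: xhl; rewrite inE halflineE (lt_le_trans a0).
Qed.

Lemma integ_supp l a b : 0 < a -> loc_integ l ->
  (forall x, 0 < x -> ~ (a <= x <= b) -> l x = 0) -> integ l.
Proof.
move=> a0 ll l0; apply/integrable_mkcond => //.
have := (ll a b a0); move/integrable_mkcond => /(_ (@mI a b)).
apply: eq_integrable => // x _; rewrite !patchE /=.
case: ifPn => [/set_mem /=|/negP xab].
  rewrite in_itv /= => /andP[ax _]; rewrite mem_set// halflineE.
  exact: lt_le_trans ax.
case: ifPn => // /set_mem; rewrite halflineE => x0; rewrite l0// => xab'.
by apply: xab; rewrite inE /= in_itv.
Qed.

Lemma contp_csupp_integ l : contp l -> csupp l -> integ l.
Proof.
move=> cl [a [b [a0 l0]]]; apply: (integ_supp a0) => //; first exact: loc_integ_contp.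
by move=> x _; exact: l0.
Qed.

Lemma csupp_integM k l : loc_integ k -> contp l -> csupp l -> integ (fun x => l x * k x).
Proof.
move=> lk cl [a [b [a0 l0]]]; apply: (integ_supp a0); first exact: loc_integ_M.
by move=> x _ /l0 ->; rewrite mul0r.
Qed.

Lemma I_prim_supp Q l : is_prim Q l -> csupp Q -> csupp l -> I l = 0.
Proof.
move=> [ll Ql] [a [b [a0 Q0]]] [a' [b' [a'0 l0]]].
pose A := Num.min a a' / 2; pose B := Num.max A (Num.max b b' + 1).
have A0 : 0 < A by rewrite divr_gt0// lt_min a0.
have Aa : A < Num.min a a'.
  by rewrite /A ltr_pdivrMr// ltr_pMr ?lt_min ?a0//; lra.
move: Aa; rewrite lt_min => /andP[Aa Aa'].
have Bb : b < B /\ b' < B.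
  have bb : b <= Num.max b b' by rewrite le_max lexx.
  have bb' : b' <= Num.max b b' by rewrite le_max lexx orbT.
  by split; rewrite /B lt_max; apply/orP; right; lra.
have AB : A <= B by rewrite le_max lexx.
rewrite (@I_supp l A B)//; last first.
  move=> x _ xAB; apply: l0 => /andP[h1 h2]; apply: xAB.
  by rewrite (le_trans (ltW Aa') h1) (le_trans h2 (ltW Bb.2)).
rewrite -Ql// !Q0 ?subrr//.
  by move=> /andP[]; rewrite leNgt Aa.
by move=> /andP[_]; rewrite leNgt Bb.1.
Qed.

Lemma I_parts F f P k : hasD F f -> contp f -> csupp F -> csupp f ->
  is_prim P k -> I (fun x => P x * f x) = - I (fun x => F x * k x).
Proof.
move=> Ff cf sF sf Pk.
have cF := hasD_contp Ff; have cP := prim_contp Pk; have lk := prim_loc_integ Pk.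
have Q := prim_M Ff cf Pk.
have QsF : csupp (fun x => F x * P x).
  by case: sF => a [b [a0 F0]]; exists a, b; split => // x /F0 ->; rewrite mul0r.
have QsFk : csupp (fun x => F x * k x).
  by case: sF => a [b [a0 F0]]; exists a, b; split => // x /F0 ->; rewrite mul0r.
have QsfP : csupp (fun x => f x * P x).
  by case: sf => a [b [a0 f0]]; exists a, b; split => // x /f0 ->; rewrite mul0r.
have := I_prim_supp Q QsF (csupp_D QsFk QsfP).
rewrite I_D; last 2 first.
- exact: csupp_integM.
- by apply: csupp_integM => //; exact: loc_integ_contp.
move/eqP; rewrite addrC addr_eq0 => /eqP <-.
by apply: eq_I => x _; rewrite mulrC.
Qed.

Lemma cvg_IntI h (a_ b_ : nat -> R) : integ h -> (forall n, 0 < a_ n) ->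
  a_ n @[n --> \oo] --> 0 -> b_ n @[n --> \oo] --> +oo ->
  IntI (a_ n) (b_ n) h @[n --> \oo] --> I h.
Proof.
move=> hi an0 a0 boo.
pose h_ n := h \_ `[a_ n, b_ n].
have E n : IntI (a_ n) (b_ n) h = I (h_ n).
  rewrite /I /h_ -Rintegral_mkcondr; congr Rintegral; rewrite setIidr//.
  move=> x /=; rewrite halflineE in_itv /= => /andP[+ _].
  exact: lt_le_trans.
have mh_ n : measurable_fun (halfline R) (EFin \o h_ n).
  apply/measurable_EFinP; apply/measurable_restrict; [|exact: measurable_halfline|].
    exact: mI.
  apply: measurable_funS (integ_meas hi); first exact: measurable_halfline.
  exact: subIsetl.
have : (\int[mu]_(x in halfline R) (h_ n x)%:E @[n --> \oo] -->
        \int[mu]_(x in halfline R) (h x)%:E)%E.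
  have [] // := @dominated_convergence _ _ R mu (halfline R) _
    (fun n => EFin \o h_ n) (EFin \o h) (EFin \o (fun x => `|h x|)).
  - by apply/measurable_EFinP; exact: integ_meas hi.
  - apply: aeW => x; rewrite halflineE => x0.
    apply: cvg_near_cst; near=> n; rewrite /= /h_ patchE mem_set//= in_itv /=.
    apply/andP; split.
      apply: ltW; near: n; exact: (cvgr_lt _ a0).
    by near: n; move/cvgryPge: boo; exact.
  - exact: integ_norm.
  - apply: aeW => x n _ /=; rewrite /h_ patchE lee_fin.
    by case: ifPn => // _; rewrite normr0.
have hfin : (\int[mu]_(x in halfline R) (h x)%:E)%E \is a fin_num.
  exact: integrable_fin_num.
rewrite -[X in _ --> X -> _](fineK hfin) => /fine_cvg H.
apply: cvg_trans H.
by apply: near_eq_cvg; near=> n; rewrite /= E.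
Unshelve. all: by end_near. Qed.

End Primitives.

(** * The fundamental lemma of the calculus of variations *)

Section TestFunctions.
Context {R : realType}.
Local Notation mu := (@lebesgue_measure R).
Implicit Types (f g F phi psi : R -> R) (x a b c : R).

Definition cutoff eta := [/\ @smooth R eta,
  forall x, 0 < x -> x <= 1 -> eta x = 1 & forall x, 2 <= x -> eta x = 0].

Variable eta : R -> R.
Hypothesis eta_cut : cutoff eta.

Lemma rtest_contp phi : rtest phi -> contp phi.
Proof. by move=> [s _]; exact: smooth_contp. Qed.

Lemma rtest_hasD phi : rtest phi -> hasD phi (phi^`()%classic).
Proof. by move=> [s _]; exact: smooth_hasD. Qed.

Lemma rtest_integ phi : rtest phi -> integ phi.
Proof.
by move=> t; apply: contp_csupp_integ; [exact: rtest_contp|case: t].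
Qed.

Lemma rtest_integM F phi : loc_integ F -> rtest phi -> integ (fun x => phi x * F x).
Proof.
by move=> lF t; apply: csupp_integM => //; [exact: rtest_contp|case: t].
Qed.

Lemma contp_csupp_rL2 phi : contp phi -> csupp phi -> rL2 phi.
Proof.
move=> cp sp; split; first exact: contp_meas.
apply: (eq_integ (fun x _ => esym (expr2 (phi x)))).
by apply: csupp_integM => //; exact: loc_integ_contp.
Qed.

Lemma rtest_rL2 phi : rtest phi -> rL2 phi.
Proof. by move=> t; apply: contp_csupp_rL2; [exact: rtest_contp|case: t]. Qed.

Lemma eta_bounded : exists2 M, 0 <= M & forall x, 0 < x -> `|eta x| <= M.
Proof.
have [se e1 e0] := eta_cut.
have [M M0 HM] := contp_bounded 2 ltr01 (smooth_contp se).
exists (M + 1); first by rewrite addr_ge0.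
move=> x x0; have [x1|/ltW x1] := leP x 1; first by rewrite e1// normr1 lerDr.
have [x2|x2] := leP 2 x; first by rewrite e0// normr0 addr_ge0.
by rewrite (le_trans (HM x _)) ?lerDl// x1 ltW.
Qed.

(** As m grows this tends to the indicator function of ]a, b], because eta (t
    ^ m) tends to that of ]0, 1]: in this way one cutoff function yields
    enough test functions. *)
Definition step a b m x : R :=
  if 0 < x then eta ((x / b) ^+ m.+1) - eta ((x / a) ^+ m.+1) else 0.

Lemma step_smooth a b m : 0 < a -> 0 < b -> smooth (step a b m).
Proof.
move=> a0 b0; have [se _ _] := eta_cut.
have aux c : 0 < c -> smooth (fun x => eta ((x / c) ^+ m.+1)).
  move=> c0; apply: (@smooth_comp _ eta (fun x => (x / c) ^+ m.+1) _ se).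
    by move=> x x0; rewrite exprn_gt0// divr_gt0.
  apply: (@smooth_X _ (fun x => x / c)); apply: (@smooth_ext _ (fun x => c^-1 * x)).
    by move=> x _; rewrite mulrC.
  by apply: smooth_Z; exact: smooth_id.
apply: (@smooth_ext _
  (fun x => eta ((x / b) ^+ m.+1) + -1 * eta ((x / a) ^+ m.+1))).
  by move=> x x0; rewrite /step x0 mulN1r.
apply: smooth_D; first exact: aux.
by apply: smooth_Z; exact: aux.
Qed.

Lemma step_supp a b m x : 0 < a -> a <= b -> ~ (a <= x <= 2 * b) ->
  step a b m x = 0.
Proof.
have [_ e1 e0] := eta_cut; move=> a0 ab; rewrite /step.
case: ifPn => // x0 xab.
have b0 : 0 < b by exact: lt_le_trans ab.
have [xa|ax] := ltP x a.
  rewrite !e1 ?subrr// ?exprn_gt0 ?divr_gt0//; apply: exprn_ile1.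
  - by rewrite divr_ge0 ?ltW.
  - by rewrite ler_pdivrMr// mul1r ltW.
  - by rewrite divr_ge0 ?ltW.
  - by rewrite ler_pdivrMr// mul1r ltW// (lt_le_trans xa).
have xb : 2 * b < x by rewrite ltNge; apply/negP => xb; apply: xab; rewrite ax.
have aux c : 0 < c -> c <= b -> 2 <= (x / c) ^+ m.+1.
  move=> c0 cb; have x2 : 2 <= x / c by rewrite ler_pdivlMr//; lra.
  apply: (le_trans x2); rewrite -[leLHS]expr1.
  by apply: ler_weXn2l => //; lra.
by rewrite !e0 ?subrr//; apply: aux.
Qed.

Lemma step_rtest a b m : 0 < a -> a <= b -> rtest (step a b m).
Proof.
move=> a0 ab; have b0 := lt_le_trans a0 ab.
split; first exact: step_smooth.
by exists a, (2 * b); split => // x; exact: step_supp.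
Qed.

Lemma expn_big (y : R) : 1 < y -> \forall m \near \oo, 2 <= y ^+ m.+1.
Proof.
move=> y1.
have : (y^-1 ^+ n) @[n --> \oo] --> (0 : R).
  by apply: cvg_expr; rewrite ger0_norm ?invr_ge0 ?invf_lt1//; lra.
move=> /(cvgr_lt _) /(_ 2^-1); rewrite invr_gt0 => /(_ (ltr0Sn _ _)) H.
near=> m; have : y^-1 ^+ m < 2^-1 by near: m.
rewrite exprVn ltf_pV2 ?posrE ?exprn_gt0//; last by lra.
move=> /ltW h; apply: (le_trans h); apply: ler_weXn2l => //; lra.
Unshelve. all: by end_near. Qed.

Lemma step_cvg a b x : 0 < a -> a <= b -> 0 < x ->
  step a b m x @[m --> \oo] --> (\1_(`]a, b]%classic) x : R).
Proof.
have [_ e1 e0] := eta_cut; move=> a0 ab x0; have b0 := lt_le_trans a0 ab.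
apply: cvg_near_cst; rewrite indicE.
have small c : 0 < c -> x <= c -> forall m, eta ((x / c) ^+ m.+1) = 1.
  move=> c0 xc m; rewrite e1 ?exprn_gt0 ?divr_gt0//; apply: exprn_ile1.
    by rewrite divr_ge0 ?ltW.
  by rewrite ler_pdivrMr// mul1r.
have big c : 0 < c -> c < x -> \forall m \near \oo, eta ((x / c) ^+ m.+1) = 0.
  move=> c0 cx; have xc : 1 < x / c by rewrite ltr_pdivlMr// mul1r.
  by near=> m; rewrite e0//; near: m; exact: expn_big.
rewrite /step; under eq_near do rewrite x0.
have [xa|ax] := leP x a.
  rewrite memNset/=; last by rewrite in_itv /= ltNge xa.
  by near=> m; rewrite !small ?subrr// (le_trans xa).
have [xb|bx] := leP x b.
  rewrite mem_set/=; last by rewrite in_itv /= ax.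
  by near=> m; rewrite small// (_ : eta (_ ^+ _) = 0) ?subr0//; near: m; exact: big.
rewrite memNset/=; last by rewrite in_itv /= (leNgt x) bx andbF.
near=> m; rewrite (_ : eta ((x / b) ^+ _) = 0); last by near: m; exact: big.
by rewrite (_ : eta (_ ^+ _) = 0) ?subr0//; near: m; exact: big.
Unshelve. all: by end_near. Qed.

Lemma IntI_I_indic F a b : 0 < a -> integ F ->
  I (fun x => F x * \1_(`]a, b]%classic) x) = IntI a b F.
Proof.
move=> a0 Fi.
rewrite /IntI -(@Rintegral_itv_obnd_cbnd R a (BRight b)); last first.
  apply: integrableS (loc_integ_integ Fi b a0) => //.
  by apply: subset_itvr; rewrite bnd_simp.
have -> : `]a, b]%classic = halfline R `&` `]a, b]%classic.
  apply/esym/setIidr => x /=; rewrite halflineE in_itv /= => /andP[+ _].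
  exact: lt_trans.
rewrite Rintegral_mkcondr; apply: eq_Rintegral => x /set_mem xhl.
rewrite patchE indicE in_setI (mem_set xhl) /=.
by case: ifPn => _; rewrite ?mulr1 ?mulr0.
Qed.

Lemma step_integ_cvg F a b : 0 < a -> a <= b -> integ F ->
  I (fun x => step a b m x * F x) @[m --> \oo] --> IntI a b F.
Proof.
move=> a0 ab Fi; have b0 := lt_le_trans a0 ab.
have [M M0 HM] := eta_bounded.
have sF m : integ (fun x => step a b m x * F x).
  by apply: rtest_integM; [exact: loc_integ_integ|exact: step_rtest].
rewrite -(IntI_I_indic b a0 Fi).
have : (\int[mu]_(x in halfline R) (step a b m x * F x)%:E @[m --> \oo] -->
        \int[mu]_(x in halfline R) (F x * \1_(`]a, b]%classic) x)%:E)%E.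
  have [] // := @dominated_convergence _ _ R mu (halfline R) _
    (fun m => EFin \o (fun x => step a b m x * F x))
    (EFin \o (fun x => F x * \1_(`]a, b]%classic) x))
    (EFin \o (fun x => (2 * M) * `|F x|)).
  - by move=> m; apply/measurable_EFinP; exact: integ_meas (sF m).
  - apply/measurable_EFinP; apply: measurable_funM; first exact: integ_meas Fi.
    by apply: measurable_indic; exact: measurable_itv.
  - apply: aeW => x; rewrite halflineE => x0.
    apply: cvg_EFin; first by near=> m.
    rewrite /= mulrC; apply: cvgMl; exact: step_cvg.
  - by apply: integZ; exact: integ_norm.
  - apply: aeW => x m; rewrite halflineE => x0 /=.
    rewrite lee_fin normrM ler_wpM2r// /step x0.
    apply: (le_trans (ler_normB _ _)); rewrite mulr_natl mulr2n lerD// HM//.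
      by rewrite exprn_gt0// divr_gt0.
    by rewrite exprn_gt0// divr_gt0.
have hfin : (\int[mu]_(x in halfline R) (F x * \1_(`]a, b]%classic) x)%:E)%E
    \is a fin_num.
  apply: integrable_fin_num => //.
  have : integ (fun x => F x * \1_(`]a, b]%classic) x) => //.
  apply: le_integ (integ_norm Fi).
    apply: measurable_funM; first exact: integ_meas Fi.
    by apply: measurable_indic; exact: measurable_itv.
  move=> x _; rewrite normrM indicE; case: (_ \in _).
    by rewrite normr1 mulr1.
  by rewrite normr0 mulr0.
rewrite -[X in _ --> X -> _](fineK hfin) => /fine_cvg H.
exact: cvg_trans H.
Unshelve. all: by end_near. Qed.

Lemma restr_integ F a b : 0 < a -> loc_integ F -> integ (F \_ `[a, b]).
Proof.
move=> a0 lF; rewrite /integ -restrict_EFin.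
apply/integrable_restrict => //; rewrite setIidr; first exact: lF.
move=> x /=; rewrite halflineE in_itv /= => /andP[+ _].
exact: lt_le_trans.
Qed.

Lemma restrE F a b x : a <= x <= b -> (F \_ `[a, b]) x = F x.
Proof. by move=> xab; rewrite patchE mem_set//= in_itv. Qed.

Lemma test_IntI F : loc_integ F ->
  (forall phi, rtest phi -> I (fun x => phi x * F x) = 0) ->
  forall a b, 0 < a -> a <= b -> IntI a b F = 0.
Proof.
move=> lF F0 a b a0 ab; have b0 := lt_le_trans a0 ab.
have Fi := restr_integ (2 * b) a0 lF.
have := step_integ_cvg a0 ab Fi.
have E m : I (fun x => step a b m x * (F \_ `[a, 2 * b]) x) = 0.
  rewrite -(F0 _ (step_rtest m a0 ab)); apply: eq_I => x x0.
  have [xab|/negP xab] := boolP (a <= x <= 2 * b); first by rewrite restrE.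
  by rewrite step_supp// !mul0r.
under eq_fun do rewrite E.
move=> H; have <- : IntI a b (F \_ `[a, 2 * b]) = 0.
  by apply: (cvg_unique _ H) => //; exact: cvg_cst.
apply: eq_Rintegral => x.
rewrite inE /= in_itv /= => /andP[ax xb]; rewrite restrE// ax (le_trans xb)//.
by rewrite ler_peMl ?ltW//; lra.
Qed.

(** Testing with [step] shows that F has integral 0 over all compact
    intervals; Lebesgue's differentiation theorem recovers F from these
    integrals. *)
Lemma fund_lemma F : loc_integ F ->
  (forall phi, rtest phi -> I (fun x => phi x * F x) = 0) ->
  ae_eq mu (halfline R) F (fun=> 0).
Proof.
move=> lF F0; have FI := test_IntI lF F0.
pose c n : R := n.+2%:R^-1; pose d n : R := n.+2%:R.
have c0 n : 0 < c n by rewrite invr_gt0 ltr0n.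
pose f n := F \_ `[c n, d n].
have key n : {ae mu, forall x, c n < x < d n -> F x = 0}.
  have fi : mu.-integrable setT (EFin \o f n).
    rewrite /f -restrict_EFin; apply/integrable_restrict => //.
    by rewrite setTI; exact: lF.
  have floc : locally_integrable setT (f n).
    by apply: integrable_locally_restrict => //; exact: lF.
  have := @FTC1Ny R (f n) _ floc; case.
    by move=> y; apply: integrableS fi.
  move=> N [mN N0 sub]; exists N; split => //.
  apply: subset_trans sub => x /= /not_implyP[xcd Fx0] [_ H].
  apply: Fx0; case/andP: (xcd) => cx xd.
  rewrite -(@restrE F (c n) (d n)); last by rewrite (ltW cx) ltW.
  rewrite -[LHS]H.
  set G : R -> R := fun y : R => \int[mu]_(t in `]-oo, y]) f n t.
  suff G0 : \forall y \near (x : R), G y = cst 0 y.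
    by rewrite derive1E (near_eq_derive _ G0) derive_cst.
  near=> y.
  have cy : c n < y by near: y; exact: lt_nbhsr.
  have yd : y < d n by near: y; exact: lt_nbhsl.
  rewrite /= -(FI (c n) y)// ?ltW// /IntI.
  rewrite /G; rewrite Rintegral_mkcond [RHS]Rintegral_mkcond; apply: eq_Rintegral => z _.
  rewrite !patchE /f.
  case: ifPn => [/set_mem /=|/negP zy]; rewrite ?in_itv /=.
    move=> zy; rewrite patchE; case: ifPn => [/set_mem /=|/negP zcd].
      by rewrite in_itv /= => /andP[cz _]; rewrite mem_set//= in_itv /= cz.
    rewrite memNset//= in_itv /= => /andP[cz _]; apply: zcd.
    by rewrite inE /= in_itv /= cz (le_trans zy (ltW yd)).
  rewrite memNset//= in_itv /= => /andP[_ zy']; apply: zy.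
  by rewrite inE /= in_itv.
have Hae : {ae mu, forall x, forall n, c n < x < d n -> F x = 0}.
  exact/ae_foralln.
apply: (@filterS _ _ (ae_filter_ringOfSetsType mu)) Hae => x H; rewrite halflineE => x0.
have [n1 Hn1] : exists n, n.+1%:R^-1 < x.
  by have /ltr_add_invr[k] := x0; rewrite add0r => kx; exists k.
pose m := maxn n1 (Num.truncn x).+1.
apply: (H m); apply/andP; split.
  apply: le_lt_trans Hn1; rewrite /c lef_pV2 ?posrE ?ltr0n// ler_nat.
  by rewrite ltnS ltnW// ltnS leq_maxl.
apply: (lt_le_trans (truncnS_gt x)).
rewrite /d ler_nat; apply: (@leq_trans m); first exact: leq_maxr.
by rewrite -addn2 leq_addr.
Unshelve. all: by end_near. Qed.

Lemma rtest_prim phi : rtest phi -> I phi = 0 ->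
  exists2 chi, rtest chi & hasD chi phi.
Proof.
move=> tp p0; have [sp [a [b [a0 pab]]]] := tp.
have cp := rtest_contp tp.
have [P Pp] := prim_exists (loc_integ_contp cp).
pose a' := a / 2; have a'0 : 0 < a' by rewrite divr_gt0.
have a'a : a' < a by rewrite /a'; lra.
pose chi x := if 0 < x then P x - P a' else 0.
have chiE x : 0 < x -> P x - P a' = chi x by rewrite /chi => ->.
have Dchi : hasD chi phi.
  apply: (eq_hasD chiE (fun x _ => subr0 (phi x))).
  by apply: hasD_B; [exact: prim_hasD Pp cp|exact: hasD_cst].
exists chi; last exact: Dchi.
split; first exact: smooth_prim Dchi sp.
pose b' := Num.max a' b.
exists a', b'; split => // x xab; rewrite /chi; case: ifPn => // x0.
have [xa|ax] := ltP x a'.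
  rewrite -opprB Pp.2// ?ltW//.
  rewrite /IntI /Rintegral integral0_eq ?oppr0// => y /=; rewrite in_itv /=.
  move=> /andP[xy ya]; rewrite pab//; move=> /andP[ay _].
  by have := le_lt_trans (le_trans ay ya) a'a; rewrite ltxx.
have bx : b' < x by rewrite ltNge; apply/negP => xb; apply: xab; rewrite ax.
rewrite Pp.2// -(@I_supp _ phi a' x)// => y y0 yax; apply: pab => /andP[ay yb].
apply: yax; rewrite (le_trans (ltW a'a) ay) (le_trans yb)//.
by rewrite (le_trans _ (ltW bx))// le_max lexx orbT.
Qed.

Lemma exists_rtest1 : exists2 rho : R -> R, rtest rho & I rho = 1.
Proof.
have l12 : (1 : R) <= 2 by lra.
pose one : R -> R := fun=> 1.
have c1 : loc_integ one by apply: loc_integ_contp; exact: contp_cst.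
have [m Hm] : exists m, I (step 1 2 m) != 0.
  apply: contrapT => H.
  have E0 m : I (step 1 2 m) = 0.
    by apply/eqP; apply: contrapT => /negP h; apply: H; exists m.
  have := step_integ_cvg ltr01 l12 (restr_integ (2 * 2) ltr01 c1).
  rewrite (_ : IntI _ _ _ = 1); last first.
    transitivity (@IntI R 1 2 (fun=> 1)); last by rewrite IntI_cst//; lra.
    apply: eq_Rintegral => x; rewrite inE /= in_itv /= => /andP[x1 x2].
    by rewrite restrE// x1; lra.
  have E m : I (fun x => step 1 2 m x * (one \_ `[1, 2 * 2]) x) = 0.
    rewrite -(E0 m); apply: eq_I => x x0.
    have [xab|/negP xab] := boolP (1 <= x <= 2 * 2); first by rewrite restrE// mulr1.
    by rewrite step_supp// mul0r.
  under eq_fun do rewrite E.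
  move=> h; have : (1 : R) = 0 by apply: (cvg_unique _ h) => //; exact: cvg_cst.
  by move/eqP; rewrite oner_eq0.
have tm := step_rtest m ltr01 l12.
exists (fun x => (I (step 1 2 m))^-1 * step 1 2 m x); first exact: rtest_Z.
by rewrite I_Z ?mulVf//; exact: rtest_integ.
Qed.

(** For a fixed test function rho of integral 1, the function phi - (I phi)
    rho has integral 0, so that it is the derivative of a test function. *)
Lemma kill_derivatives (T : (R -> R) -> R) :
  (forall phi psi, (forall x, 0 < x -> phi x = psi x) -> T phi = T psi) ->
  (forall c phi psi, rtest phi -> rtest psi ->
    T (fun x => c * phi x + psi x) = c * T phi + T psi) ->
  (forall chi, rtest chi -> T (chi^`()%classic) = 0) ->
  exists c, forall phi, rtest phi -> T phi = c * I phi.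
Proof.
move=> Text Tlin T0; have [rho tr r1] := exists_rtest1.
exists (T rho) => phi tp.
pose psi x := (- I phi) * rho x + phi x.
have tpsi : rtest psi by apply: rtest_D => //; exact: rtest_Z.
have psi0 : I psi = 0.
  rewrite /psi I_D ?I_Z ?r1 ?mulr1 ?addNr//.
  - exact: rtest_integ.
  - by apply: rtest_integ; exact: rtest_Z.
  - exact: rtest_integ.
have [chi tchi Dchi] := rtest_prim tpsi psi0.
have := T0 _ tchi.
rewrite (Text _ psi); last by move=> x x0; rewrite (hasD_derive1 Dchi).
by rewrite Tlin// mulNr addrC => /eqP; rewrite subr_eq0 mulrC => /eqP.
Qed.

(** The lemma of du Bois-Reymond. *)
Lemma dubois F : loc_integ F ->
  (forall phi, rtest phi -> I (fun x => phi^`()%classic x * F x) = 0) ->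
  exists c, ae_eq mu (halfline R) F (fun=> c).
Proof.
move=> lF F0.
have [|c phi psi tp ts||c Hc] := @kill_derivatives (fun phi => I (fun x => phi x * F x)).
- by move=> phi psi pp; apply: eq_I => x x0; rewrite pp.
- rewrite -I_Z -?I_D.
  + by apply: eq_I => x _; ring.
  + by apply: integZ; exact: rtest_integM.
  + exact: rtest_integM.
  + exact: rtest_integM.
- by move=> chi tc; exact: F0.
exists c; apply: aeeq_sub0; apply: fund_lemma.
  by apply: loc_integ_B => //; apply: loc_integ_contp; exact: contp_cst.
move=> phi tp; have := Hc _ tp.
rewrite -I_Z; last exact: rtest_integ.
move/eqP; rewrite -subr_eq0 -I_B; last 2 first.
- exact: rtest_integM.
- by apply: integZ; exact: rtest_integ.
by move=> /eqP <-; apply: eq_I => x _; ring.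
Qed.

End TestFunctions.

(** * Weak solutions of L f = g and of A f = k *)

Section WeakSolutions.
Context {R : realType}.
Local Notation mu := (@lebesgue_measure R).
Local Notation sq := (@Num.sqrt R).
Implicit Types (f g k w p F P phi psi chi : R -> R) (x a b c : R).

Definition Lop phi x : R :=
  - (phi^`()^`())%classic x - 4^-1 * x ^- 2 * phi x.

(** This is i A, which has real coefficients. *)
Definition Aop phi x : R := phi^`()%classic x - (2 * x)^-1 * phi x.

Definition weakL f g := forall phi, rtest phi ->
  I (fun x => f x * Lop phi x) = I (fun x => g x * phi x).

(** The equation f' - f / (2 x) = k in the sense of distributions. *)
Definition weakA f k := forall phi, rtest phi ->
  I (fun x => f x * (phi^`()%classic x + (2 * x)^-1 * phi x)) =
  - I (fun x => k x * phi x).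

(** The substitution f = sqrt x * w turns L f = g into the system w' = p / x,
    p' = - sqrt x * g, in which p = sqrt x (f' - f / (2 x)). At 0 the pair (w,
    p) has at most a logarithmic singularity. The function w is continuously
    differentiable, whereas p is only absolutely continuous. *)
Definition sol w p g := [/\ rL2 (fun x => sq x * w x), rL2 g,
  hasD w (fun x => p x / x) & is_prim p (fun x => - (sq x * g x))].

Lemma sqr_sq x : 0 < x -> sq x * sq x = x.
Proof. by move=> x0; rewrite -expr2 sqr_sqrtr ?ltW. Qed.

Lemma sq_inv x : 0 < x -> sq x * x^-1 * sq x = 1.
Proof. by move=> x0; rewrite mulrAC sqr_sq// mulfV// gt_eqF. Qed.

Lemma contp_divx p : contp p -> contp (fun x => p x / x).
Proof. by move=> cp; apply: contp_M => //; exact: contp_inv. Qed.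

Lemma hasD_sqinv : hasD (fun x => sq x * x^-1)
  (fun x => - (2^-1 * (sq x * x^-1 * x^-1))).
Proof.
by apply: hasD_eq (hasD_M hasD_sqrt hasD_inv) => x x0; field; rewrite gt_eqF.
Qed.

Lemma contp_rtest_derive phi : rtest phi -> contp (phi^`()%classic).
Proof. by move=> t; apply: rtest_contp; exact: rtest_derive. Qed.

Lemma csupp_ext (f g : R -> R) : (forall x, f x = g x) -> csupp f -> csupp g.
Proof. by move=> fg [a [b [a0 f0]]]; exists a, b; split => // x /f0; rewrite fg. Qed.

Lemma weakA_prim w p phi : hasD w (fun x => p x / x) -> contp p -> rtest phi ->
  I (fun x => sq x * w x * (phi^`()%classic x + (2 * x)^-1 * phi x)) =
  - I (fun x => (sq x * x^-1 * p x) * phi x).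
Proof.
move=> Dw cp tp.
have ts := rtest_M smooth_sqrt tp.
have Ds : hasD (fun x => sq x * phi x)
    (fun x => sq x * (phi^`()%classic x + (2 * x)^-1 * phi x)).
  apply: hasD_eq (hasD_M hasD_sqrt (rtest_hasD tp)) => x x0.
  by field; rewrite gt_eqF.
have tds := rtest_derive ts.
transitivity (I (fun x => w x * (fun x => sq x * phi x)^`()%classic x)).
  by apply: eq_I => x x0; rewrite (hasD_derive1 Ds)//; ring.
rewrite (I_parts (rtest_hasD ts) (contp_rtest_derive ts) ts.2 tds.2
  (hasD_prim Dw (contp_divx cp))).
by congr (- _); apply: eq_I => x x0; ring.
Qed.

(** Two integrations by parts, the first against w and the second against p,
    reproduce the two equations of the system. *)
Lemma sol_weakL w p g : sol w p g -> weakL (fun x => sq x * w x) g.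
Proof.
move=> [_ _ Dw Pp] phi tp; have cp := prim_contp Pp.
have t1 := rtest_derive tp; have t2 := rtest_derive t1.
pose th x := sq x * phi^`()%classic x - 2^-1 * (sq x * x^-1) * phi x.
pose th' x := sq x * (phi^`()^`())%classic x + 4^-1 * (sq x * x^-1 * x^-1) * phi x.
pose chi x := (sq x * x^-1) * phi x.
have Dth : hasD th th'.
  apply: hasD_eq (hasD_B (hasD_M hasD_sqrt (rtest_hasD t1))
     (hasD_M (hasD_Z 2^-1 hasD_sqinv) (rtest_hasD tp))) => x x0.
  by rewrite /th'; field; rewrite gt_eqF.
have csi : contp (fun x => sq x * x^-1) by apply: contp_M; [exact: contp_sqrt|exact: contp_inv].
have Dchi : hasD chi (fun x => x^-1 * th x).
  apply: hasD_eq (hasD_M hasD_sqinv (rtest_hasD tp)) => x x0.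
  by rewrite /th; field; rewrite gt_eqF.
have cth' : contp th'.
  apply: contp_D; first by apply: contp_M; [exact: contp_sqrt|exact: rtest_contp].
  apply: contp_M; last exact: rtest_contp.
  apply: contp_M; first exact: contp_cst.
  by apply: contp_M => //; exact: contp_inv.
have sM f h : csupp h -> csupp (fun x => f x * h x) by exact: csupp_M.
have sth : csupp th.
  apply: (@csupp_ext (fun x => sq x * phi^`()%classic x +
     (- (2^-1 * (sq x * x^-1))) * phi x)); first by move=> x; rewrite /th mulNr.
  by apply: csupp_D; apply: sM; [exact: t1.2|exact: tp.2].
have sth' : csupp th'.
  by apply: csupp_D; apply: sM; [exact: t2.2|exact: tp.2].
have E1 : I (fun x => sq x * w x * Lop phi x) = - I (fun x => w x * th' x).
  rewrite -I_N; last first.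
    apply: (@eq_integ _ (fun x => th' x * w x)); first by move=> x _; rewrite mulrC.
    by apply: csupp_integM => //; apply: loc_integ_contp; exact: hasD_contp Dw.
  apply: eq_I => x x0; rewrite /Lop /th'.
  by field; rewrite gt_eqF.
rewrite E1 (I_parts Dth cth' sth sth' (hasD_prim Dw (contp_divx cp))) opprK.
transitivity (I (fun x => p x * (x^-1 * th x))).
  by apply: eq_I => x x0; ring.
rewrite (I_parts Dchi _ _ _ Pp); last 3 first.
- by apply: contp_M; [exact: contp_inv|exact: hasD_contp Dth].
- by apply: sM; exact: tp.2.
- exact: sM.
rewrite -I_N; last first.
  apply: csupp_integM; [exact: prim_loc_integ Pp|exact: hasD_contp Dchi|].
  by apply: sM; exact: tp.2.
apply: eq_I => x x0; rewrite /chi.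
transitivity ((sq x * x^-1 * sq x) * (g x * phi x)); first by ring.
by rewrite sq_inv// mul1r.
Qed.

Variable eta : R -> R.
Hypothesis eta_cut : cutoff eta.

(** Let w0 = f / sqrt x and let P0 be a primitive of - sqrt x * g. Testing the
    equation with sqrt x * chi shows that the distribution x w0' - P0 kills
    the derivative of chi, so that it is a constant - c by [kill_derivatives].
    With p = P0 - c, the difference of w0 and a primitive of p / x then has
    derivative 0 and is a constant by [dubois]. *)
Lemma weakL_sol f g : rL2 f -> rL2 g -> weakL f g ->
  exists w p, sol w p g /\ ae_eq mu (halfline R) f (fun x => sq x * w x).
Proof.
move=> fL gL fg.
have lg : loc_integ (fun x => - (sq x * g x)).
  by apply: loc_integ_N; apply: loc_integ_M; [exact: contp_sqrt|exact: loc_integ_rL2].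
have [P0 HP0] := prim_exists lg; have cP0 := prim_contp HP0.
have csi : contp (fun x => sq x * x^-1) by apply: contp_M; [exact: contp_sqrt|exact: contp_inv].
pose w0 x := (sq x * x^-1) * f x.
have lw0 : loc_integ w0 by apply: loc_integ_M => //; exact: loc_integ_rL2.
have fw0 x : 0 < x -> f x = sq x * w0 x.
  by move=> x0; rewrite /w0 !mulrA sqr_sq// mulfV ?gt_eqF// mul1r.
have tx phi : rtest phi -> rtest (fun x => x * phi x).
  by apply: rtest_M; exact: smooth_id.
have Dx phi : rtest phi -> hasD (fun x => x * phi x)
    (fun x => phi x + x * phi^`()%classic x).
  move=> tp; apply: hasD_eq (hasD_M hasD_id (rtest_hasD tp)) => x x0.
  by rewrite mul1r addrC.
(* T is the distribution - x w0' + P0. *)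
pose T phi := I (fun x => w0 x * (phi x + x * phi^`()%classic x) + P0 x * phi x).
have iT1 phi : rtest phi ->
    integ (fun x => w0 x * (phi x + x * phi^`()%classic x)).
  move=> tp; apply: (@eq_integ _ (fun x => (fun x => x * phi x)^`()%classic x * w0 x)).
    by move=> x x0; rewrite (hasD_derive1 (Dx _ tp))// mulrC.
  by apply: rtest_integM => //; apply: rtest_derive; exact: tx.
have iT2 P phi : contp P -> rtest phi -> integ (fun x => P x * phi x).
  move=> cP tp; apply: (@eq_integ _ (fun x => phi x * P x)).
    by move=> x _; rewrite mulrC.
  by apply: rtest_integM => //; exact: loc_integ_contp.
have [||chi tc|c Hc] := @kill_derivatives _ eta eta_cut T.
- move=> phi psi pp; apply: eq_I => x x0; rewrite pp//.
  by congr (_ * (_ + _ * _) + _); rewrite !derive1E; apply: near_eq_derive;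
    exact: near_pos_eq.
- move=> c phi psi tp ts; rewrite /T -I_Z -?I_D.
  + apply: eq_I => x x0.
    rewrite (hasD_derive1 (hasD_D (hasD_Z c (rtest_hasD tp)) (rtest_hasD ts)))//.
    by ring.
  + by apply: integZ; apply: integD; [exact: iT1|exact: iT2].
  + by apply: integD; [exact: iT1|exact: iT2].
  + by apply: integD; [exact: iT1|exact: iT2].
- have tc1 := rtest_derive tc; have tc2 := rtest_derive tc1.
  rewrite /T I_D; [|exact: iT1|exact: iT2].
  rewrite (I_parts (rtest_hasD tc) (rtest_contp tc1) tc.2 tc1.2 HP0).
  have ts := rtest_M smooth_sqrt tc.
  have := fg _ ts.
  have Ds1 := hasD_M hasD_sqrt (rtest_hasD tc).
  have Ds2 : hasD ((fun x => sq x * chi x)^`()%classic)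
     (fun x => sq x * (chi^`()^`())%classic x + sq x * x^-1 * chi^`()%classic x
        - 4^-1 * (sq x * x^-1 * x^-1) * chi x).
    apply: (eq_hasD _ _ (hasD_D (hasD_M hasD_sqrt (rtest_hasD tc1))
       (hasD_M (hasD_Z 2^-1 hasD_sqinv) (rtest_hasD tc)))) => x x0.
      by rewrite (hasD_derive1 Ds1).
    rewrite /=; field; rewrite gt_eqF//.
  have -> : I (fun x => f x * Lop (fun x => sq x * chi x) x) =
     - I (fun x => w0 x * (chi^`()%classic x + x * (chi^`()^`())%classic x)).
    rewrite -I_N; last exact: iT1.
    apply: eq_I => x x0; rewrite /Lop (hasD_derive1 Ds2)// /w0.
    by field; rewrite gt_eqF.
  have -> : I (fun x => chi x * - (sq x * g x)) = - I (fun x => g x * (sq x * chi x)).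
    rewrite -I_N; first by apply: eq_I => x x0; ring.
    apply: (@eq_integ _ (fun x => (sq x * chi x) * g x)).
      by move=> x _; rewrite mulrC.
    by apply: rtest_integM => //; exact: loc_integ_rL2.
  by move=> <-; rewrite opprK subrr.
pose p x := P0 x - c.
have Pp : is_prim p (fun x => - (sq x * g x)) by exact: prim_shift.
have cp := prim_contp Pp.
have [W HW] := prim_exists (loc_integ_contp (contp_divx cp)).
have DW := prim_hasD HW (contp_divx cp).
have cW := hasD_contp DW.
have [|psi ts|c' Hc'] := @dubois _ eta eta_cut (fun x => w0 x - W x).
- by apply: loc_integ_B => //; exact: loc_integ_contp.
- pose phi x := x^-1 * psi x.
  have tp : rtest phi by apply: rtest_M => //; exact: smooth_inv.
  have Dxp : hasD psi (fun x => phi x + x * phi^`()%classic x).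
    apply: eq_hasD (Dx _ tp) => // x x0.
    by rewrite /phi mulrA mulfV ?gt_eqF// mul1r.
  have E1 : I (fun x => W x * psi^`()%classic x) = - I (fun x => p x * phi x).
    rewrite (I_parts (rtest_hasD ts) (contp_rtest_derive ts) ts.2
      (rtest_derive ts).2 HW); congr (- _).
    by apply: eq_I => x x0; rewrite /phi; ring.
  have iW : integ (fun x => psi^`()%classic x * W x).
    by apply: rtest_integM; [exact: loc_integ_contp|exact: rtest_derive].
  have iw : integ (fun x => psi^`()%classic x * w0 x).
    by apply: rtest_integM => //; exact: rtest_derive.
  transitivity (I (fun x => psi^`()%classic x * w0 x) -
                I (fun x => psi^`()%classic x * W x)).
    by rewrite -I_B//; apply: eq_I => x _; ring.
  have -> : I (fun x => psi^`()%classic x * W x) = - I (fun x => p x * phi x).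
    by rewrite -E1; apply: eq_I => x _; rewrite mulrC.
  have := Hc _ tp; rewrite /T I_D; [|exact: iT1|exact: iT2].
  have -> : I (fun x => w0 x * (phi x + x * phi^`()%classic x)) =
            I (fun x => psi^`()%classic x * w0 x).
    by apply: eq_I => x x0; rewrite (hasD_derive1 Dxp)// mulrC.
  have -> : I (fun x => p x * phi x) = I (fun x => P0 x * phi x) - c * I phi.
    rewrite -I_Z; last exact: rtest_integ.
    rewrite -I_B; [|exact: iT2|by apply: integZ; exact: rtest_integ].
    by apply: eq_I => x _; rewrite /p; ring.
  by move=> <-; ring.
pose w x := W x + c'.
have fw : ae_eq mu (halfline R) f (fun x => sq x * w x).
  apply: filterS Hc' => x Hx xhl; have x0 : 0 < x by rewrite -halflineE.
  rewrite fw0//; congr (_ * _).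
  by have := Hx xhl; rewrite /w => /eqP; rewrite subr_eq addrC => /eqP.
have Dw : hasD w (fun x => p x / x).
  apply: hasD_eq (hasD_D DW (hasD_cst c')) => x _; exact: addr0.
exists w, p; split => //; split => //.
apply: ae_rL2 fL => //; apply: contp_meas.
by apply: contp_M; [exact: contp_sqrt|exact: hasD_contp Dw].
Qed.

Lemma sol_weakA w p k : hasD w (fun x => p x / x) -> contp p -> loc_integ k ->
  weakA (fun x => sq x * w x) k ->
  ae_eq mu (halfline R) k (fun x => sq x * x^-1 * p x).
Proof.
move=> Dw cp lk wA.
have csi : contp (fun x => sq x * x^-1) by apply: contp_M; [exact: contp_sqrt|exact: contp_inv].
have lsp : loc_integ (fun x => sq x * x^-1 * p x) by apply: loc_integ_contp; exact: contp_M.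
apply: aeeq_sub0; apply: (fund_lemma eta_cut); first exact: loc_integ_B.
move=> phi tp.
have := wA _ tp; rewrite (weakA_prim Dw cp tp) => /oppr_inj/esym/eqP.
have i1 : integ (fun x => k x * phi x).
  apply: (@eq_integ _ (fun x => phi x * k x)); first by move=> x _; rewrite mulrC.
  exact: rtest_integM.
have i2 : integ (fun x => sq x * x^-1 * p x * phi x).
  apply: (@eq_integ _ (fun x => phi x * (sq x * x^-1 * p x))).
    by move=> x _; rewrite mulrC.
  exact: rtest_integM.
rewrite -subr_eq0 -I_B// => /eqP <-; apply: eq_I => x _; ring.
Qed.

End WeakSolutions.

(** * Boundary values at 0 and Green's formula *)

Section BoundaryValues.
Context {R : realType}.
Local Notation mu := (@lebesgue_measure R).
Local Notation sq := (@Num.sqrt R).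
Implicit Types (f g h k w p v q : R -> R) (x a b c d e l C K M N : R).

(** The numbers c1 and c2 are the coefficients of sqrt x and sqrt x * ln x in
    f = sqrt x * w at 0. The bounds hold on the whole of (0, oo), so that the
    one on p also controls the growth of p at infinity. *)
Definition BV w p c1 c2 := exists C, forall x, 0 < x ->
  `|p x - c2| <= C * x /\ `|w x - c1 - c2 * ln x| <= C * x.

Lemma limit0 h C : (forall a b, 0 < a -> a <= b -> `|h b - h a| <= C * b) ->
  exists c, forall x, 0 < x -> `|h x - c| <= C * x.
Proof.
move=> H.
have C0 : 0 <= C.
  by have := H 1 1 ltr01 (lexx _); rewrite subrr normr0 mulr1.
have H2 a b : 0 < a -> 0 < b -> h a - C * a <= h b + C * b.
  move=> a0 b0; have [ab|/ltW ba] := leP a b.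
    have := H a b a0 ab; rewrite ler_norml => /andP[h1 h2].
    by have := mulr_ge0 C0 (ltW a0); lra.
  have := H b a b0 ba; rewrite ler_norml => /andP[h1 h2].
  by have := mulr_ge0 C0 (ltW b0); lra.
pose S := [set h x - C * x | x in [set x | 0 < x]].
have S0 : S !=set0 by exists (h 1 - C * 1), 1 => //=; exact: ltr01.
have Sub b : 0 < b -> ubound S (h b + C * b).
  by move=> b0 y [a /= a0 <-]; exact: H2.
exists (sup S) => x x0; rewrite ler_norml; apply/andP; split.
  have : sup S <= h x + C * x by apply: ge_sup => //; exact: Sub.
  by lra.
have : h x - C * x <= sup S.
  apply: ub_le_sup; last by exists x.
  by exists (h 1 + C * 1); apply: Sub; exact: ltr01.
by lra.
Qed.

(** The integral of |sqrt s * g s| over [a, b] is O(b) because g is square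
    integrable. Hence p has a limit c2 at 0 which it approaches at rate O(x),
    then (w - c2 ln x)' = (p - c2) / x is bounded. *)
Lemma sol_BV w p g : sol w p g -> exists c1 c2, BV w p c1 c2.
Proof.
move=> [_ gL Dw Pp]; have cp := prim_contp Pp.
have [lp PpE] := Pp.
pose G := I (fun x => g x ^+ 2).
pose C := (1 + G) / 2.
have Hp a b : 0 < a -> a <= b -> `|p b - p a| <= C * b.
  move=> a0 ab; have b0 := lt_le_trans a0 ab.
  rewrite PpE//; apply: (le_trans (norm_IntI _ _ _)) => //.
  have lg2 : loc_integ (fun x => g x ^+ 2) by apply: loc_integ_integ; case: gL.
  have c1 : loc_integ (fun=> 2^-1 : R) by apply: loc_integ_contp; exact: contp_cst.
  (* sqrt b * |g| <= (1 + b g ^ 2) / 2 *)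
  apply: (@le_trans _ _ (IntI a b (fun x => 2^-1 + (b / 2) * g x ^+ 2))).
    apply: le_IntI => //.
    - exact: loc_integ_norm.
    - by apply: loc_integ_D => //; exact: loc_integ_Z.
    - move=> x /andP[ax xb]; have x0 : 0 < x by exact: lt_le_trans ax.
      rewrite normrN normrM (ger0_norm (sqrtr_ge0 _)).
      have sb : sq x <= sq b by rewrite ler_wsqrtr.
      apply: (@le_trans _ _ (sq b * `|g x|)); first by rewrite ler_wpM2r.
      rewrite -(real_normK (num_real (g x))).
      by have := sqr_sq b0; have := sqr_ge0 (1 - sq b * `|g x|); nra.
  rewrite IntI_D//; last exact: loc_integ_Z.
  rewrite IntI_Z// IntI_cst//.
  have : IntI a b (fun x => g x ^+ 2) <= G.
    by apply: IntI_le_I => //; [case: gL|move=> x _; exact: sqr_ge0].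
  rewrite /C => GI.
  have : b / 2 * IntI a b (fun x => g x ^+ 2) <= b / 2 * G.
    by rewrite ler_wpM2l// divr_ge0// ltW.
  by lra.
have [c2 Hc2] := limit0 Hp.
have C0 : 0 <= C.
  by have := Hp 1 1 ltr01 (lexx _); rewrite subrr normr0 mulr1.
pose h x := w x - c2 * ln x.
have Dh : hasD h (fun x => (p x - c2) / x).
  apply: hasD_eq (hasD_B Dw (hasD_Z c2 hasD_ln)) => x x0.
  by rewrite mulrBl.
have ch : contp (fun x => (p x - c2) / x).
  by apply: contp_divx; apply: contp_D => //; exact: contp_cst.
have [lh hE] := hasD_prim Dh ch.
have Hh a b : 0 < a -> a <= b -> `|h b - h a| <= C * b.
  move=> a0 ab; rewrite hE//; apply: (le_trans (norm_IntI _ _ _)) => //.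
  apply: (@le_trans _ _ (IntI a b (fun=> C))).
    apply: le_IntI => //; [exact: loc_integ_norm|by apply: loc_integ_contp; exact: contp_cst|].
    move=> x /andP[ax xb]; have x0 : 0 < x by exact: lt_le_trans ax.
    by rewrite normrM normfV (gtr0_norm x0) ler_pdivrMr//; exact: Hc2.
  by rewrite IntI_cst// ler_wpM2l// gerBl ltW.
have [c1 Hc1] := limit0 Hh.
exists c1, c2, C => x x0; split; first exact: Hc2.
by have := Hc1 x x0; rewrite /h addrAC.
Qed.

Lemma BV_D w p c1 c2 v q d1 d2 : BV w p c1 c2 -> BV v q d1 d2 ->
  BV (fun x => w x + v x) (fun x => p x + q x) (c1 + d1) (c2 + d2).
Proof.
move=> [C HC] [D HD]; exists (C + D) => x x0.
have [h1 h2] := HC x x0; have [h3 h4] := HD x x0; split.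
  have -> : p x + q x - (c2 + d2) = (p x - c2) + (q x - d2) by ring.
  by apply: (le_trans (ler_normD _ _)); rewrite mulrDl lerD.
have -> : w x + v x - (c1 + d1) - (c2 + d2) * ln x =
  (w x - c1 - c2 * ln x) + (v x - d1 - d2 * ln x) by ring.
by apply: (le_trans (ler_normD _ _)); rewrite mulrDl lerD.
Qed.

Lemma BV_Z c w p c1 c2 : BV w p c1 c2 ->
  BV (fun x => c * w x) (fun x => c * p x) (c * c1) (c * c2).
Proof.
move=> [C HC]; exists (`|c| * C) => x x0; have [h1 h2] := HC x x0; split.
  by rewrite -mulrBr normrM -mulrA ler_wpM2l.
have -> : c * w x - c * c1 - c * c2 * ln x = c * (w x - c1 - c2 * ln x) by ring.
by rewrite normrM -mulrA ler_wpM2l.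
Qed.

Lemma ln_sqrt_le x : 0 < x -> x <= 1 -> x * `|ln x| <= 2 * sq x.
Proof.
move=> x0 x1; have s0 : 0 < sq x by rewrite sqrtr_gt0.
have l0 : ln x <= 0 by rewrite ln_le0.
rewrite ler0_norm//.
have e : ln x = - (2 * ln ((sq x)^-1)).
  rewrite lnV ?posrE// -{1}(sqr_sq x0) lnM ?posrE//; ring.
have li : ln ((sq x)^-1) <= (sq x)^-1.
  rewrite -[X in ln X](subrK 1) [X in ln X]addrC.
  apply: le_trans (le_ln1Dx _) _; last by rewrite gerBl.
  by rewrite ltrBrDr addNr invr_gt0.
rewrite e opprK.
apply: (@le_trans _ _ (x * (2 * (sq x)^-1))).
  by rewrite ler_pM2l// ler_pM2l.
by rewrite -{1}(sqr_sq x0) le_eqVlt; apply/orP; left; apply/eqP; field; rewrite gt_eqF.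
Qed.

(** The terms c2 d2 ln x cancel, and the others are O(x |ln x|), hence O(sqrt
    x). *)
Lemma wronskian0 w p c1 c2 v q d1 d2 : BV w p c1 c2 -> BV v q d1 d2 ->
  exists K, forall x, 0 < x -> x <= 1 ->
    `|w x * q x - p x * v x - (c1 * d2 - c2 * d1)| <= K * sq x.
Proof.
move=> [C HC] [D HD].
have C0 : 0 <= C by have [+ _] := HC 1 ltr01; rewrite mulr1; exact: le_trans.
have D0 : 0 <= D by have [+ _] := HD 1 ltr01; rewrite mulr1; exact: le_trans.
exists (D * (`|c1| + C) + 2 * (`|c2| * D) + (`|d1| * C + C * D) + 2 * (`|d2| * C)
        + (`|c2| * D + `|d2| * C)).
move=> x x0 x1; have [hp hw] := HC x x0; have [hq hv] := HD x x0.
have xs : x <= sq x.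
  have s1 : sq x <= 1 by rewrite -sqrtr1 ler_wsqrtr.
  by rewrite -{1}(sqr_sq x0) ler_piMr// sqrtr_ge0.
have lx := ln_sqrt_le x0 x1.
set l := ln x in lx hw hv *.
pose a := p x - c2; pose b := q x - d2.
pose r := w x - c1 - c2 * l; pose s := v x - d1 - d2 * l.
have -> : w x * q x - p x * v x - (c1 * d2 - c2 * d1) =
  c1 * b + r * b + c2 * (l * b) + r * d2 - (a * d1 + a * s + d2 * (l * a) + c2 * s).
  by rewrite /a /b /r /s; ring.
rewrite -/a in hp; rewrite -/b in hq; rewrite -/r in hw; rewrite -/s in hv.
have sx0 : 0 <= sq x := sqrtr_ge0 x.
have ha : `|a| <= C * sq x by apply: (le_trans hp); rewrite ler_wpM2l.
have hb : `|b| <= D * sq x by apply: (le_trans hq); rewrite ler_wpM2l.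
have hr : `|r| <= C * sq x by apply: (le_trans hw); rewrite ler_wpM2l.
have hs : `|s| <= D * sq x by apply: (le_trans hv); rewrite ler_wpM2l.
have hr1 : `|r| <= C by apply: (le_trans hw); rewrite ler_piMr.
have ha1 : `|a| <= C by apply: (le_trans hp); rewrite ler_piMr.
have hlb : `|l * b| <= 2 * D * sq x.
  rewrite normrM mulrC; apply: (@le_trans _ _ (D * x * `|l|)).
    by rewrite ler_wpM2r.
  by rewrite -mulrA [2 * D]mulrC -mulrA ler_wpM2l.
have hla : `|l * a| <= 2 * C * sq x.
  rewrite normrM mulrC; apply: (@le_trans _ _ (C * x * `|l|)).
    by rewrite ler_wpM2r.
  by rewrite -mulrA [2 * C]mulrC -mulrA ler_wpM2l.
have B1 : `|c1 * b| <= `|c1| * (D * sq x) by rewrite normrM ler_wpM2l.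
have B2 : `|r * b| <= C * (D * sq x) by rewrite normrM ler_pM.
have B3 : `|c2 * (l * b)| <= `|c2| * (2 * D * sq x) by rewrite normrM ler_wpM2l.
have B4 : `|r * d2| <= `|d2| * (C * sq x) by rewrite mulrC normrM ler_wpM2l.
have B5 : `|a * d1| <= `|d1| * (C * sq x) by rewrite mulrC normrM ler_wpM2l.
have B6 : `|a * s| <= C * (D * sq x) by rewrite normrM ler_pM.
have B7 : `|d2 * (l * a)| <= `|d2| * (2 * C * sq x) by rewrite normrM ler_wpM2l.
have B8 : `|c2 * s| <= `|c2| * (D * sq x) by rewrite normrM ler_wpM2l.
apply: (le_trans (ler_normB _ _)).
apply: (@le_trans _ _ ((`|c1 * b| + `|r * b| + `|c2 * (l * b)| + `|r * d2|) +
   (`|a * d1| + `|a * s| + `|d2 * (l * a)| + `|c2 * s|))).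
  apply: lerD.
    apply: (le_trans (ler_normD _ _)); rewrite lerD2r.
    by apply: (le_trans (ler_normD _ _)); rewrite lerD2r; exact: ler_normD.
  apply: (le_trans (ler_normD _ _)); rewrite lerD2r.
  by apply: (le_trans (ler_normD _ _)); rewrite lerD2r; exact: ler_normD.
by lra.
Qed.

Lemma form_term0 w p c1 : BV w p c1 0 ->
  exists K, forall x, 0 < x -> x <= 1 -> `|w x * p x| <= K * x.
Proof.
move=> [C HC]; exists ((`|c1| + C) * C) => x x0 x1.
have [hp hw] := HC x x0; rewrite subr0 in hp; rewrite mul0r subr0 in hw.
have C0 : 0 <= C by have [+ _] := HC 1 ltr01; rewrite mulr1; exact: le_trans.
rewrite normrM -mulrA; apply: ler_pM => //.
have -> : w x = c1 + (w x - c1) by ring.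
apply: (le_trans (ler_normD _ _)); rewrite lerD2l; apply: (le_trans hw).
by rewrite ler_piMr.
Qed.

Lemma BV_pbound w p c1 c2 : BV w p c1 c2 ->
  exists2 K, 0 < K & forall x, 1 <= x -> `|p x| <= K * x.
Proof.
move=> [C HC]; exists (`|c2| + `|C| + 1); first by rewrite ltr_wpDl// addr_ge0.
move=> x x1; have x0 : 0 < x by lra.
have [hp _] := HC x x0.
have -> : p x = c2 + (p x - c2) by ring.
apply: (le_trans (ler_normD _ _)).
have h1 : `|c2| <= `|c2| * x by rewrite ler_peMr.
have h2 : C * x <= `|C| * x by rewrite ler_wpM2r ?ler_norm// ltW.
by have := ltW x0; lra.
Qed.

Lemma IntI_inv a b : 0 < a -> a <= b -> IntI a b (fun x => x^-1) = ln b - ln a.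
Proof.
by move=> a0 ab; rewrite (hasD_prim hasD_ln contp_inv).2.
Qed.

Lemma inv_not_integ_oo h c N : 0 < c -> integ h -> (forall x, 0 < x -> 0 <= h x) ->
  ~ (forall x, N < x -> c * x^-1 <= h x).
Proof.
move=> c0 hi h0 H.
pose a := Num.max N 1 + 1; have a0 : 0 < a by rewrite ltr_wpDl// le_max ler01 orbT.
have Na : N < a.
  by have : N <= Num.max N 1; [rewrite le_max lexx|rewrite /a; lra].
pose b := expR (ln a + (I h + 1) / c).
have ab : a <= b.
  rewrite -[leLHS](lnK (_ : a \is Num.pos)) ?posrE// ler_expR lerDl divr_ge0 ?ltW//.
  by rewrite ltr_wpDl// I_ge0.
have : c * IntI a b (fun x => x^-1) <= I h.
  have li : loc_integ (fun x : R => x^-1) by apply: loc_integ_contp; exact: contp_inv.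
  rewrite -IntI_Z//; apply: le_trans (IntI_le_I b a0 hi h0).
  apply: le_IntI => //; [exact: loc_integ_Z|exact: loc_integ_integ|].
  by move=> x /andP[ax _]; apply: H; exact: lt_le_trans ax.
rewrite IntI_inv// /b expRK addrC addKr mulrCA mulfV ?gt_eqF// mulr1.
by lra.
Qed.

Lemma inv_not_integ_0 h c d : 0 < c -> 0 < d -> integ h ->
  (forall x, 0 < x -> 0 <= h x) ->
  ~ (forall x, 0 < x -> x < d -> c * x^-1 <= h x).
Proof.
move=> c0 d0 hi h0 H.
pose b := d / 2; have b0 : 0 < b by rewrite divr_gt0.
have bd : b < d by rewrite /b; lra.
pose a := expR (ln b - (I h + 1) / c).
have a0 : 0 < a by exact: expR_gt0.
have ab : a <= b.
  rewrite -[leRHS](lnK (_ : b \is Num.pos)) ?posrE// ler_expR gerBl divr_ge0 ?ltW//.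
  by rewrite ltr_wpDl// I_ge0.
have : c * IntI a b (fun x => x^-1) <= I h.
  have li : loc_integ (fun x : R => x^-1) by apply: loc_integ_contp; exact: contp_inv.
  rewrite -IntI_Z//; apply: le_trans (IntI_le_I b a0 hi h0).
  apply: le_IntI => //; [exact: loc_integ_Z|exact: loc_integ_integ|].
  move=> x /andP[ax xb]; apply: H; [exact: lt_le_trans ax|].
  exact: le_lt_trans bd.
rewrite IntI_inv// /a expRK opprB addrC subrK mulrCA mulfV ?gt_eqF// mulr1.
by lra.
Qed.

(** Since p and q are O(x) at infinity, an inequality e <= |w q| + |p v| would
    give c / x <= x (w ^ 2 + v ^ 2), whose right-hand side is integrable. *)
Lemma far_point w v p q c1 c2 d1 d2 e N :
  rL2 (fun x => sq x * w x) -> rL2 (fun x => sq x * v x) ->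
  BV w p c1 c2 -> BV v q d1 d2 -> 0 < e ->
  exists2 x, N < x & `|w x * q x| + `|p x * v x| < e.
Proof.
move=> fL gL /BV_pbound[K K0 HK] /BV_pbound[M M0 HM] e0.
apply: contrapT => H.
pose L := K + M; have L0 : 0 < L by rewrite addr_gt0.
have HL x : Num.max N 1 < x -> e <= L * (x * (`|w x| + `|v x|)).
  rewrite gt_max => /andP[Nx x1]; rewrite leNgt; apply/negP => h.
  apply: H; exists x => //; apply: le_lt_trans h.
  rewrite !normrM.
  have h1 := HK x (ltW x1); have h2 := HM x (ltW x1).
  have x0 : 0 <= x by lra.
  have := ler_wpM2l (normr_ge0 (w x)) h2; have := ler_wpM2r (normr_ge0 (v x)) h1.
  have := mulr_ge0 (ltW K0) (mulr_ge0 x0 (normr_ge0 (w x))).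
  have := mulr_ge0 (ltW M0) (mulr_ge0 x0 (normr_ge0 (v x))).
  by rewrite /L; lra.
pose h x := (sq x * w x) ^+ 2 + (sq x * v x) ^+ 2.
have hi : integ h by apply: integD; [case: fL|case: gL].
have h0 x : 0 < x -> 0 <= h x by move=> _; rewrite addr_ge0// sqr_ge0.
have c0 : 0 < e ^+ 2 / (2 * L ^+ 2).
  by rewrite divr_gt0 ?mulr_gt0 ?exprn_gt0.
apply: (inv_not_integ_oo (N := Num.max N 1) c0 hi h0) => x xN.
have x0 : 0 < x by apply: lt_trans xN; rewrite lt_max ltr01 orbT.
rewrite /h !exprMn (sqr_sqrtr (ltW x0)) -mulrDr ler_pdivrMr//.
rewrite ler_pdivrMr ?mulr_gt0 ?exprn_gt0//.
have := HL x xN.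
set W := `|w x| + `|v x| => hW.
have W0 : 0 <= W by rewrite addr_ge0.
have : e ^+ 2 <= (L * (x * W)) ^+ 2.
  have eL : 0 <= L * (x * W).
    by apply: mulr_ge0; [exact: ltW|apply: mulr_ge0 => //; exact: ltW].
  by have e0' := ltW e0; rewrite ler_sqr ?nnegrE.
move/le_trans; apply.
have : W ^+ 2 <= 2 * (w x ^+ 2 + v x ^+ 2).
  rewrite -(real_normK (num_real (w x))) -(real_normK (num_real (v x))) /W.
  by have := sqr_ge0 (`|w x| - `|v x|); lra.
move=> hh.
have : (L * x) ^+ 2 * W ^+ 2 <= (L * x) ^+ 2 * (2 * (w x ^+ 2 + v x ^+ 2)).
  by rewrite ler_wpM2l// sqr_ge0.
by lra.
Qed.

Lemma cvg_harm (u : nat -> R) l K : (forall n, `|u n - l| <= K * n.+1%:R^-1) ->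
  u n @[n --> \oo] --> l.
Proof.
move=> ub; apply/cvgrPdist_le => e e0.
have H0 : (K * (n.+1%:R^-1 : R)) @[n --> \oo] --> K * 0.
  by apply: cvgMr; exact: cvg_harmonic.
rewrite mulr0 in H0.
near=> n; rewrite distrC; apply: (le_trans (ub n)).
by near: n; exact: (cvgr_le _ H0).
Unshelve. all: by end_near. Qed.

Definition far_seq (b_ : nat -> R) := forall n, n.+1%:R < b_ n.

Lemma far_seq_cvg (b_ : nat -> R) : far_seq b_ -> b_ n @[n --> \oo] --> +oo.
Proof.
move=> H; apply/cvgryPge => A; near=> n.
apply: ltW; apply: le_lt_trans (H n).
apply: (@le_trans _ _ n%:R); last by rewrite ler_nat.
by near: n; exact: nbhs_infty_ger.
Unshelve. all: by end_near. Qed.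

(** The square matches the error terms O(sqrt x) at 0 with the rate 1 / (n +
    1) which [choose_far] provides at infinity. *)
Definition near0 (n : nat) : R := n.+1%:R ^- 2.

Lemma near0_gt0 n : 0 < near0 n.
Proof. by rewrite invr_gt0 exprn_gt0// ltr0n. Qed.

Lemma near0_le1 n : near0 n <= 1.
Proof. by rewrite invf_le1 ?exprn_gt0 ?ltr0n// exprn_ege1// ler1n. Qed.

Lemma sq_near0 n : sq (near0 n) = n.+1%:R^-1.
Proof. by rewrite /near0 -exprVn sqrtr_sqr ger0_norm// invr_ge0 ler0n. Qed.

Lemma near0_le n : near0 n <= n.+1%:R^-1.
Proof.
rewrite /near0 lef_pV2 ?posrE ?exprn_gt0 ?ltr0n//.
by rewrite -[leLHS]expr1 ler_weXn2l// ler1n.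
Qed.

Lemma near0_cvg : near0 n @[n --> \oo] --> 0.
Proof.
apply: (@cvg_harm _ _ 1) => n; rewrite subr0 mul1r ger0_norm ?near0_le//.
exact/ltW/near0_gt0.
Qed.

Lemma integ_limit h (b_ : nat -> R) l K : integ h -> far_seq b_ ->
  (forall n, `|IntI (near0 n) (b_ n) h - l| <= K * n.+1%:R^-1) -> I h = l.
Proof.
move=> hi fb H.
have h1 := cvg_IntI hi near0_gt0 near0_cvg (far_seq_cvg fb).
have h2 := cvg_harm H.
by apply: (cvg_unique _ h1 h2).
Qed.

Lemma choose_far w v p q c1 c2 d1 d2 :
  rL2 (fun x => sq x * w x) -> rL2 (fun x => sq x * v x) ->
  BV w p c1 c2 -> BV v q d1 d2 -> exists2 b_, far_seq b_ &
  forall n, `|w (b_ n) * q (b_ n)| + `|p (b_ n) * v (b_ n)| <= n.+1%:R^-1.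
Proof.
move=> fL gL Bw Bv.
have H n : exists x, n.+1%:R < x /\ `|w x * q x| + `|p x * v x| < n.+1%:R^-1.
  have n0 : 0 < (n.+1%:R : R)^-1 by rewrite invr_gt0 ltr0n.
  by have [x h1 h2] := far_point n.+1%:R fL gL Bw Bv n0; exists x.
exists (fun n => projT1 (cid (H n))) => n.
  by case: (cid (H n)) => x /= [].
by case: (cid (H n)) => x /= [_ /ltW].
Qed.

(** Up to sign, w q - p v is a primitive of the integrand. It tends to c1 d2 -
    c2 d1 at 0, and to 0 along a sequence which goes to infinity. *)
Lemma green w p f' v q g' c1 c2 d1 d2 : sol w p f' -> sol v q g' ->
  BV w p c1 c2 -> BV v q d1 d2 ->
  dotp (fun x => sq x * w x) g' - dotp f' (fun x => sq x * v x) =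
  c1 * d2 - c2 * d1.
Proof.
move=> sw sv Bw Bv.
have [fL fL' Dw Pp] := sw; have [gL gL' Dv Pq] := sv.
have cp := prim_contp Pp; have cq := prim_contp Pq.
rewrite /dotp -I_B; [|exact: rL2_mul..].
set h := (X in I X).
have hi : integ h by apply: integB; exact: rL2_mul.
pose Q x := w x * q x - p x * v x.
have PQ : is_prim (fun x => - Q x) h.
  have := prim_B (prim_M Dv (contp_divx cq) Pp) (prim_M Dw (contp_divx cp) Pq).
  apply: eq_prim => x x0; first by rewrite /Q; ring.
  by rewrite /h; field; rewrite gt_eqF.
have [K HK] := wronskian0 Bw Bv.
have [b_ fb Hb] := choose_far fL gL Bw Bv.
apply: (integ_limit hi fb (K := K + 1)) => n.
have nb : near0 n <= b_ n.
  apply: (le_trans (near0_le1 n)); apply: ltW; apply: le_lt_trans (fb n).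
  by rewrite ler1n.
rewrite -PQ.2 ?near0_gt0//.
have -> : - Q (b_ n) - - Q (near0 n) - (c1 * d2 - c2 * d1) =
  (Q (near0 n) - (c1 * d2 - c2 * d1)) - Q (b_ n) by ring.
apply: (le_trans (ler_normB _ _)); rewrite mulrDl mul1r; apply: lerD.
  rewrite -sq_near0; apply: HK; [exact: near0_gt0|exact: near0_le1].
by apply: le_trans (Hb n); exact: ler_normB.
Qed.

Lemma bounded_integ h M : loc_integ h -> (forall x, 0 < x -> 0 <= h x) ->
  (forall a b, 0 < a -> a <= b -> IntI a b h <= M) -> integ h.
Proof.
move=> lh h0 HM.
pose F n : set R := `[n.+1%:R^-1, n.+1%:R]%classic.
have F0 n : 0 < (n.+1%:R^-1 : R) by rewrite invr_gt0 ltr0n.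
have FU : \bigcup_i F i = halfline R.
  apply/seteqP; split => x /=.
    move=> [n _]; rewrite /F /= in_itv /= halflineE => /andP[+ _].
    exact: lt_le_trans.
  rewrite halflineE => x0.
  have [n1 Hn1] : exists n, n.+1%:R^-1 <= x.
    by have /ltr_add_invr[k] := x0; rewrite add0r => kx; exists k; exact: ltW.
  pose m := maxn n1 (Num.truncn x).+1.
  exists m => //; rewrite /F /= in_itv /=; apply/andP; split.
    apply: le_trans Hn1; rewrite lef_pV2 ?posrE ?ltr0n// ler_nat ltnS.
    exact: leq_maxl.
  apply: (le_trans (ltW (truncnS_gt x))).
  by rewrite ler_nat; apply: (leq_trans (leq_maxr n1 _)).
have mF i : measurable (F i : set (measurableTypeR R)) by exact: measurable_itv.
have nd : {homo F : n m / (n <= m)%N >-> (n <= m)%O}.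
  move=> n m nm; rewrite subsetEset => x; rewrite /F /= !in_itv /= => /andP[h1 h2].
  apply/andP; split.
    by apply: le_trans h1; rewrite lef_pV2 ?posrE ?ltr0n// ler_nat ltnS.
  by apply: (le_trans h2); rewrite ler_nat ltnS.
have mhF i : measurable_fun (F i : set (measurableTypeR R)) (EFin \o h).
  by have /integrableP[] := lh _ i.+1%:R (F0 i).
have h0F i x : F i x -> (0 <= (EFin \o h) x)%E.
  rewrite /F /= in_itv /= => /andP[ix _]; rewrite lee_fin; apply: h0.
  exact: lt_le_trans ix.
have := @ge0_nondecreasing_set_cvg_integral _ (measurableTypeR R) R F (EFin \o h) mu nd mF mhF h0F.
rewrite FU => Hlim.
have hM : (\int[mu]_(x in halfline R) (EFin \o h) x <= M%:E)%E.
  rewrite -(cvg_lim _ Hlim)//; apply: lime_le; first by apply/cvg_ex; eexists; exact: Hlim.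
  near=> n.
  have n1 : (n.+1%:R^-1 : R) <= n.+1%:R.
    by apply: (@le_trans _ _ 1); rewrite ?invf_le1 ?ler1n ?ltr0n.
  have := HM _ _ (F0 n) n1; rewrite -lee_fin /IntI /Rintegral fineK//.
  by apply: integrable_fin_num => //; exact: lh.
apply/integrableP; split; first by apply/measurable_EFinP; exact: loc_integ_meas_hl.
apply: le_lt_trans (ltry M); apply: le_trans hM.
rewrite le_eqVlt; apply/orP; left; apply/eqP; apply: eq_integral => x.
by rewrite inE halflineE => x0 /=; rewrite ger0_norm// h0.
Unshelve. all: by end_near. Qed.

(** The function p w is a primitive of p ^ 2 / x - f g. It tends to 0 at 0,
    because p = O(x) there, and along a sequence which goes to infinity; since
    p ^ 2 / x is nonnegative, the bound on its integrals over this sequence of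
    intervals makes it integrable. *)
Lemma form_sol w p g c1 : sol w p g -> BV w p c1 0 ->
  rL2 (fun x => sq x * x^-1 * p x) /\
  dotp (fun x => sq x * x^-1 * p x) (fun x => sq x * x^-1 * p x) =
  dotp (fun x => sq x * w x) g.
Proof.
move=> sw Bw; have [fL gL Dw Pp] := sw; have cp := prim_contp Pp.
have cw := hasD_contp Dw.
pose h x := x^-1 * p x ^+ 2.
pose f x := sq x * w x * g x.
have fi : integ f by exact: rL2_mul.
have ch : contp h.
  apply: contp_M; first exact: contp_inv.
  by apply: (eq_contp (f := fun x => p x * p x)) => [x _|];
    [rewrite expr2|exact: contp_M].
have h0 x : 0 < x -> 0 <= h x.
  by move=> x0; rewrite mulr_ge0 ?sqr_ge0// invr_ge0 ltW.
have PQ : is_prim (fun x => w x * p x) (fun x => h x - f x).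
  apply: eq_prim (prim_M Dw (contp_divx cp) Pp) => // x x0.
  by rewrite /h /f; ring.
have lh := loc_integ_contp ch; have lf := loc_integ_integ fi.
have [K HK] := form_term0 Bw.
have [b_ fb Hb] := choose_far fL fL Bw Bw.
have E n : IntI (near0 n) (b_ n) h = w (b_ n) * p (b_ n) - w (near0 n) * p (near0 n)
     + IntI (near0 n) (b_ n) f.
  have nb : near0 n <= b_ n.
    apply: (le_trans (near0_le1 n)); apply: ltW; apply: le_lt_trans (fb n).
    by rewrite ler1n.
  by rewrite (PQ.2 _ _ (near0_gt0 n) nb) IntI_B ?near0_gt0// subrK.
have K0 : 0 <= K by have := HK 1 ltr01 (lexx _); rewrite mulr1; exact: le_trans.
have W n : `|IntI (near0 n) (b_ n) h - IntI (near0 n) (b_ n) f| <= (K + 1) * n.+1%:R^-1.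
  rewrite E addrK; apply: (le_trans (ler_normB _ _)).
  rewrite mulrDl mul1r addrC; apply: lerD.
    apply: (le_trans (HK _ (near0_gt0 n) (near0_le1 n))).
    by rewrite ler_wpM2l// near0_le.
  by apply: le_trans (Hb n); rewrite lerDl.
have cf := cvg_IntI fi near0_gt0 near0_cvg (far_seq_cvg fb).
have chh : IntI (near0 n) (b_ n) h @[n --> \oo] --> I f.
  have -> : (fun n => IntI (near0 n) (b_ n) h) = (fun n =>
      (IntI (near0 n) (b_ n) h - IntI (near0 n) (b_ n) f) + IntI (near0 n) (b_ n) f).
    by apply/funext => n; rewrite subrK.
  rewrite -[I f]add0r.
  apply: cvgD => //; apply: (@cvg_harm _ _ (K + 1)) => n; rewrite subr0; exact: W.
have hi : integ h.
  apply: (@bounded_integ h (I f + 1)) => // a b a0 ab.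
  have H1 : \forall n \near \oo, IntI (near0 n) (b_ n) h <= I f + 1.
    by apply: (cvgr_le _ chh); rewrite ltrDl.
  have H2 : \forall n \near \oo, near0 n < a by exact: (cvgr_lt _ near0_cvg).
  have H3 : \forall n \near \oo, b <= b_ n.
    by move/cvgryPge: (far_seq_cvg fb); exact.
  near \oo => n.
  have na : near0 n <= a by apply: ltW; near: n.
  have bn : b <= b_ n by near: n.
  apply: (@le_trans _ _ (IntI (near0 n) (b_ n) h)); last by near: n.
  have pos (s t : R) : 0 < s -> 0 <= IntI s t h.
    by move=> s0; apply: IntI_ge0 => x /andP[sx _]; apply: h0; exact: lt_le_trans sx.
  rewrite (@IntI_cat _ (near0 n) a (b_ n)) ?near0_gt0// ?(le_trans ab)//.
  rewrite (@IntI_cat _ a b (b_ n))//.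
  have := pos _ a (near0_gt0 n); have := pos b (b_ n) (lt_le_trans a0 ab).
  by lra.
have hE x : 0 < x -> h x = (sq x * x^-1 * p x) * (sq x * x^-1 * p x).
  move=> x0; rewrite /h.
  transitivity ((sq x * x^-1 * sq x) * x^-1 * p x ^+ 2); last by ring.
  by rewrite sq_inv// mul1r.
have kL : rL2 (fun x => sq x * x^-1 * p x).
  split.
    apply: contp_meas; apply: contp_M => //.
    by apply: contp_M; [exact: contp_sqrt|exact: contp_inv].
  by apply: eq_integ hi => x x0; rewrite hE// expr2.
split => //.
transitivity (I h); first by apply: eq_I => x x0; rewrite hE.
have ci := cvg_IntI hi near0_gt0 near0_cvg (far_seq_cvg fb).
by apply: (cvg_unique _ ci chh).
Unshelve. all: by end_near. Qed.

(** If p tended to a nonzero limit at 0, then p ^ 2 / x would dominate a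
    multiple of 1 / x, which is not integrable at 0. *)
Lemma sol_c2_eq0 w p c1 c2 : contp p -> BV w p c1 c2 ->
  rL2 (fun x => sq x * x^-1 * p x) -> c2 = 0.
Proof.
move=> cp [C HC] [_ ki]; apply/eqP; apply: contrapT => /negP c20.
have C0 : 0 <= C by have [+ _] := HC 1 ltr01; rewrite mulr1; exact: le_trans.
have n0 : 0 < `|c2| by rewrite normr_gt0.
pose d := `|c2| / (2 * (C + 1)).
have d0 : 0 < d by rewrite divr_gt0// mulr_gt0// ltr_wpDl.
have c0 : 0 < `|c2| ^+ 2 / 4 by rewrite divr_gt0 ?exprn_gt0.
apply: (inv_not_integ_0 c0 d0 ki); first by move=> x _; exact: sqr_ge0.
move=> x x0 xd.
have -> : (sq x * x^-1 * p x) ^+ 2 = (sq x * x^-1 * sq x) * (x^-1 * p x ^+ 2).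
  by ring.
rewrite sq_inv// mul1r mulrC ler_wpM2l ?invr_ge0 ?(ltW x0)//.
have [hp _] := HC x x0.
have : C * x <= `|c2| / 2.
  move: xd; rewrite /d ltr_pdivlMr; last by rewrite mulr_gt0// ltr_wpDl.
  by move=> xd; have := ltW x0; lra.
move=> Cx; have hh : `|c2| / 2 <= `|p x|.
  have : `|c2| <= `|p x| + `|p x - c2|.
    have {1}-> : c2 = p x - (p x - c2) by ring.
    exact: ler_normB.
  by lra.
rewrite -(real_normK (num_real (p x))).
have : (`|c2| / 2) ^+ 2 <= `|p x| ^+ 2.
  by rewrite ler_sqr ?nnegrE// divr_ge0.
by lra.
Qed.

End BoundaryValues.

(** * Orthogonal projection *)

Section Projection.
Context {R : realType} (E : lmodType R).
Variables (D : E -> Prop) (ip : E -> E -> R).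
Hypothesis DD : forall x y, D x -> D y -> D (x + y).
Hypothesis DZ : forall c x, D x -> D (c *: x).
Hypothesis ipC : forall x y, D x -> D y -> ip x y = ip y x.
Hypothesis ipD : forall x y z, D x -> D y -> D z -> ip (x + y) z = ip x z + ip y z.
Hypothesis ipZ : forall c x y, D x -> D y -> ip (c *: x) y = c * ip x y.
Hypothesis ip_ge0 : forall x, D x -> 0 <= ip x x.
Hypothesis complete : forall u : nat -> E, (forall n, D (u n)) ->
  (forall e : R, 0 < e -> exists N, forall m n, (N <= m)%N -> (N <= n)%N ->
     ip (u m - u n) (u m - u n) < e) ->
  exists l, D l /\ forall e : R, 0 < e -> exists N, forall n, (N <= n)%N ->
     ip (u n - l) (u n - l) < e.

Local Notation N x := (ip x x).
Arguments DD {x y}.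
Arguments DZ c {x}.
Arguments ipC {x y}.
Arguments ip_ge0 {x}.
Arguments complete {u}.

Let DN x : D x -> D (- x).
Proof. by move=> Dx; rewrite -scaleN1r; exact: DZ. Qed.

Let DB x y : D x -> D y -> D (x - y).
Proof. by move=> Dx Dy; apply: DD => //; exact: DN. Qed.

Let ipDr x y z : D x -> D y -> D z -> ip z (x + y) = ip z x + ip z y.
Proof. by move=> Dx Dy Dz; rewrite (ipC Dz (DD Dx Dy)) ipD// (ipC Dz Dx) (ipC Dz Dy). Qed.

Let ipZr c x y : D x -> D y -> ip y (c *: x) = c * ip y x.
Proof. by move=> Dx Dy; rewrite (ipC Dy (DZ c Dx)) ipZ// (ipC Dy Dx). Qed.

Let ND x y : D x -> D y -> N (x + y) = N x + 2 * ip x y + N y.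
Proof.
move=> Dx Dy; rewrite ipD ?ipDr//; last exact: DD.
by rewrite (ipC Dy Dx); ring.
Qed.

Let NZ c x : D x -> N (c *: x) = c ^+ 2 * N x.
Proof. by move=> Dx; rewrite ipZ ?ipZr ?mulrA ?expr2//; exact: DZ. Qed.

Let NN x : D x -> N (- x) = N x.
Proof. by move=> Dx; rewrite -scaleN1r NZ// sqrrN expr1n mul1r. Qed.

Let young s x y : 0 < s -> D x -> D y ->
  N (x + y) <= (1 + s) * N x + (1 + s^-1) * N y.
Proof.
move=> s0 Dx Dy; rewrite ND//.
have := ip_ge0 (DD (DZ (- s) Dx) Dy).
rewrite ND ?NZ ?ipZ//; last exact: DZ.
move=> h; have : 2 * ip x y <= s * N x + s^-1 * N y; last by lra.
rewrite -(ler_pM2l s0) mulrDr !mulrA mulfV ?gt_eqF// mul1r.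
by move: h; rewrite sqrrN; lra.
Qed.

Variable V : E -> Prop.
Hypothesis VsubD : forall x, V x -> D x.
Hypothesis V0 : V 0.
Hypothesis VD : forall x y, V x -> V y -> V (x + y).
Hypothesis VZ : forall c x, V x -> V (c *: x).

Arguments VsubD {x}.
Arguments VD {x y}.
Arguments VZ c {x}.

(** A sequence in V which minimises the distance to x is a Cauchy sequence by
    the parallelogram identity; what remains of x in the limit is orthogonal
    to V, since it minimises the norm on its coset. The space E consists of
    functions instead of classes: D selects the square-integrable ones, on
    which [ip] is a semi-definite product, and the component of x in the
    closure of V is described by approximation. *)
Lemma projection x : D x -> exists o, [/\ D o, forall v, V v -> ip o v = 0 &
  forall e : R, 0 < e -> exists2 v, V v & N (x - o - v) < e].
Proof.
move=> Dx; pose S := [set N (x - v) | v in V].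
have S0 : S !=set0 by exists (N (x - 0)), 0.
have Slb : lbound S 0.
  by move=> y [v Vv <-]; apply: ip_ge0; apply: DB => //; exact: VsubD.
pose d := inf S.
have dS v : V v -> d <= N (x - v) by move=> Vv; apply: ge_inf; [exists 0|exists v].
pose hr (n : nat) : R := n.+1%:R^-1.
have Hv n : exists v, V v /\ N (x - v) < d + hr n.
  have n0 : 0 < hr n by rewrite invr_gt0 ltr0n.
  have hi : has_inf S by split => //; exists 0.
  by have [y [v Vv <-] h] := inf_adherent n0 hi; exists v.
pose v_ n := projT1 (cid (Hv n)).
have Vv n : V (v_ n) by rewrite /v_; case: (cid _) => v [].
have Nv n : N (x - v_ n) < d + hr n by rewrite /v_; case: (cid _) => v [].
have Dv n := VsubD (Vv n).
pose u n := x - v_ n.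
have Du n : D (u n) by exact: DB.
have cauchy m n : N (u m - u n) <= 2 * hr m + 2 * hr n.
  have h1 := Nv m; have h2 := Nv n.
  have VM : V (2^-1 *: (v_ m + v_ n)) by apply: VZ; exact: VD.
  have h3 := dS _ VM.
  have e3 : N (u m + u n) = 4 * N (x - 2^-1 *: (v_ m + v_ n)).
    have -> : u m + u n = 2 *: (x - 2^-1 *: (v_ m + v_ n)).
      rewrite scalerBr scalerA mulfV// scale1r scaler_nat mulr2n /u.
      by rewrite addrACA opprD.
    by rewrite NZ; [congr (_ * _); ring|apply: DB => //; exact: VsubD].
  have e1 := ND (Du m) (Du n); have e2 := ND (Du m) (DN (Du n)).
  have e4 : ip (u m) (- u n) = - ip (u m) (u n).
    by rewrite -scaleN1r ipZr// mulN1r.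
  rewrite NN// in e2; rewrite -/(u m) in h1; rewrite -/(u n) in h2.
  by lra.
have small (e : R) : 0 < e -> exists M : nat, forall n, (M <= n)%N -> hr n < e.
  move=> e0; have : \forall n \near \oo, hr n < e.
    by apply: (cvgr_lt (0 : R)) => //; exact: cvg_harmonic.
  by case=> M _ HM; exists M => n; exact: HM.
have [e e0|o [Do uo]] := complete Du.
  have e4 : 0 < e / 4 by rewrite divr_gt0.
  have [M HM] := small _ e4; exists M => m n /HM hm /HM hn.
  by apply: (le_lt_trans (cauchy m n)); lra.
have No : N o <= d.
  rewrite leNgt; apply/negP => dNo.
  have Noge0 := ip_ge0 Do.
  have d0 : 0 <= d by apply: lb_le_inf.
  pose s := (N o - d) / (3 * (d + 1)).
  have s0 : 0 < s by rewrite divr_gt0 ?subr_gt0// mulr_gt0// ltr_wpDl.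
  have sd : s * (d + 1) = (N o - d) / 3.
    by rewrite /s; field; rewrite gt_eqF// ltr_wpDl.
  have t0 : 0 < s / (1 + s) by rewrite divr_gt0// addr_gt0.
  pose r := (N o - d) / (3 * (1 + s^-1)).
  have si0 : 0 < 1 + s^-1 by rewrite addr_gt0// invr_gt0.
  have r0 : 0 < r by rewrite divr_gt0 ?subr_gt0// mulr_gt0.
  have rs : (1 + s^-1) * r = (N o - d) / 3 by rewrite /r; move: si0; set t := 1 + s^-1 => t0'; field; rewrite gt_eqF.
  have s1 : 0 < 1 + s by rewrite addr_gt0.
  pose q := (N o - d) / (4 * (1 + s)).
  have q0 : 0 < q by rewrite divr_gt0 ?subr_gt0// mulr_gt0.
  have qs : (1 + s) * q = (N o - d) / 4 by rewrite /q; field; rewrite gt_eqF.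
  have [M HM] := uo _ r0; have [M' HM'] := small _ q0.
  pose n := maxn M M'.
  have h1 := HM n (leq_maxl _ _); have h2 := HM' n (leq_maxr _ _).
  have := young s0 (Du n) (DN (DB (Du n) Do)).
  rewrite (NN (DB (Du n) Do)).
  have h3 := ltW (Nv n); rewrite -/(u n) in h3.
  have h4 : (1 + s) * N (u n) <= (1 + s) * (d + hr n) by rewrite ler_pM2l.
  have h5 : (1 + s) * hr n <= (1 + s) * q by rewrite ler_pM2l// ltW.
  have h6 : (1 + s^-1) * N (u n - o) <= (1 + s^-1) * r by rewrite ler_pM2l// ltW.
  rewrite [X in N X](_ : _ = o); last by rewrite opprB addrC subrK.
  by lra.
have dN v : V v -> d <= N (o - v).
  move=> Vv'; have Dv' := VsubD Vv'.
  rewrite leNgt; apply/negP => Nod.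
  have n0 := ip_ge0 (DB Do Dv').
  pose m := N (o - v); rewrite -/m in n0 Nod.
  pose s := (d - m) / (3 * (m + 1)).
  have s0 : 0 < s by rewrite divr_gt0 ?subr_gt0// mulr_gt0// ltr_wpDl.
  have sm : s * (m + 1) = (d - m) / 3.
    by rewrite /s; field; rewrite gt_eqF// ltr_wpDl.
  have si0 : 0 < 1 + s^-1 by rewrite addr_gt0// invr_gt0.
  pose r := (d - m) / (3 * (1 + s^-1)).
  have r0 : 0 < r by rewrite divr_gt0 ?subr_gt0// mulr_gt0.
  have rs : (1 + s^-1) * r = (d - m) / 3 by rewrite /r; move: si0; set t := 1 + s^-1 => t0'; field; rewrite gt_eqF.
  have [M HM] := uo _ r0; have h1 := HM M (leqnn _).
  have := young s0 (DB Do Dv') (DB (Du M) Do).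
  rewrite [X in N X <= _](_ : _ = x - (v_ M + v)); last first.
    by rewrite addrC addrA subrK /u opprD addrA.
  have h2 := dS _ (VD (Vv M) Vv').
  have h6 : (1 + s^-1) * N (u M - o) <= (1 + s^-1) * r by rewrite ler_pM2l// ltW.
  by rewrite -/m; lra.
exists o; split => //.
  move=> v Vv'; have Dv' := VsubD Vv'.
  have key t : 0 <= t ^+ 2 * N v - 2 * t * ip o v.
    have := dN _ (VZ t Vv'); rewrite -scaleNr ND//; last exact: DZ.
    rewrite NZ// ipZr// sqrrN; lra.
  apply/eqP; apply: contrapT => /negP ov.
  have nv := ip_ge0 Dv'.
  have ov2 : 0 < ip o v ^+ 2 by rewrite exprn_even_gt0.
  have := key (ip o v / (N v + 1)).
  have -> : (ip o v / (N v + 1)) ^+ 2 * N v - 2 * (ip o v / (N v + 1)) * ip o v =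
    - (ip o v ^+ 2 * (N v + 2) / (N v + 1) ^+ 2).
    by field; rewrite gt_eqF// ltr_wpDl.
  have N1 : 0 < N v + 1 by lra.
  have N2 : 0 < N v + 2 by lra.
  rewrite oppr_ge0 leNgt => /negP; apply.
  by apply: divr_gt0; [exact: mulr_gt0|exact: exprn_gt0].
move=> e e0; have [M HM] := uo e e0; exists (v_ M) => //.
have := HM M (leqnn _); rewrite /u.
by rewrite [x - v_ M - o]addrAC.
Qed.

End Projection.

(** * Completeness of L^2 *)

Section Completeness.
Context {R : realType}.
Local Notation mu := (@lebesgue_measure R).
Implicit Types (f g : R -> R) (x e : R).

Lemma squeeze_point (y b : nat -> R) : (forall k, 0 <= b k) ->
  (forall k m, (k <= m)%N -> `|y m - y k| <= b k) ->
  exists l, forall k, `|y k - l| <= b k.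
Proof.
move=> b0 H.
have H2 k m : y k - b k <= y m + b m.
  have [km|/ltnW mk] := leqP k m.
    by have := H k m km; rewrite ler_norml => /andP[h1 h2]; have := b0 m; lra.
  by have := H m k mk; rewrite ler_norml => /andP[h1 h2]; have := b0 k; lra.
pose S := range (fun k => y k - b k).
have S0 : S !=set0 by exists (y 0%N - b 0%N), 0%N.
have Sub m : ubound S (y m + b m) by move=> _ [k _ <-].
exists (sup S) => k; rewrite ler_norml; apply/andP; split.
  have : sup S <= y k + b k by apply: ge_sup => //; exact: Sub.
  by lra.
have : y k - b k <= sup S.
  by apply: ub_le_sup; [exists (y 0%N + b 0%N); exact: Sub|exists k].
by lra.
Qed.

(** The Cauchy-Schwarz inequality with the weights 2 ^ j. *)
Lemma weighted_sum (a : nat -> R) k m : (k <= m)%N ->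
  (\sum_(k <= j < m) a j) ^+ 2 <=
  2 * (2 ^+ k)^-1 * \sum_(k <= j < m) 2 ^+ j * a j ^+ 2.
Proof.
move=> km; have [n ->] : exists n, m = (k + n)%N by exists (m - k)%N; rewrite subnKC.
elim: n k {m km} => [|n IH] k.
  by rewrite addn0 !big_geq// expr0n mulr0.
have kn : (k < k + n.+1)%N by rewrite addnS ltnS leq_addr.
rewrite (big_ltn kn) (big_ltn kn).
rewrite addnS -addSn; have := IH k.+1.
set T := \sum_(_ <= _ < _) _; set Q := \sum_(_ <= _ < _) _.
rewrite [2 ^+ k.+1]exprS invfM mulrA mulfV// mul1r => h.
have k0 : 0 < (2 ^+ k : R) by rewrite exprn_gt0.
have -> : 2 * (2 ^+ k)^-1 * (2 ^+ k * a k ^+ 2 + Q) =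
  2 * a k ^+ 2 + 2 * ((2 ^+ k)^-1 * Q) by field; rewrite gt_eqF.
by have := sqr_ge0 (a k - T); lra.
Qed.

Lemma halves_sum m : \sum_(0 <= k < m) (2 ^+ k : R)^-1 <= 2.
Proof.
suff -> : \sum_(0 <= k < m) (2 ^+ k : R)^-1 = 2 - 2 * (2 ^+ m)^-1.
  by rewrite gerBl mulr_ge0// invr_ge0 exprn_ge0.
elim: m => [|m IH]; first by rewrite big_geq// expr0 invr1 mulr1 subrr.
rewrite big_nat_recr//= IH exprS.
by field; rewrite expf_neq0.
Qed.

(** Take a subsequence f with |f_(k+1) - f_k| <= 2 ^ (- k). The sum S of the
    functions 2 ^ k (f_(k+1) - f_k) ^ 2 is integrable, and (f_m - f_k) ^ 2 <=
    2 ^ (1 - k) S pointwise for k <= m. This gives the limit almost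
    everywhere, and by integration the convergence in L^2. *)
Lemma rL2_complete (u : nat -> R -> R) : (forall n, rL2 (u n)) ->
  (forall e : R, 0 < e -> exists N, forall m n, (N <= m)%N -> (N <= n)%N ->
     dotp (fun x => u m x - u n x) (fun x => u m x - u n x) < e) ->
  exists l, rL2 l /\ forall e : R, 0 < e -> exists N, forall n, (N <= n)%N ->
     dotp (fun x => u n x - l x) (fun x => u n x - l x) < e.
Proof.
move=> uL Cu.
have Ck (k : nat) : exists N, forall m n, (N <= m)%N -> (N <= n)%N ->
     dotp (fun x => u m x - u n x) (fun x => u m x - u n x) < (2 ^+ k * 2 ^+ k)^-1.
  by apply: Cu; rewrite invr_gt0 mulr_gt0// exprn_gt0.
pose N_ k := projT1 (cid (Ck k)).
have N_P k m n : (N_ k <= m)%N -> (N_ k <= n)%N ->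
  dotp (fun x => u m x - u n x) (fun x => u m x - u n x) < (2 ^+ k * 2 ^+ k)^-1.
  by rewrite /N_; case: (cid _) => N /= H; exact: H.
pose nn := fix nn k := if k is k'.+1 then maxn (nn k') (N_ k) else N_ 0%N.
have nnS k : (nn k <= nn k.+1)%N by exact: leq_maxl.
have nnN k : (N_ k <= nn k)%N by case: k => // k; exact: leq_maxr.
pose f k := u (nn k).
have fL k : rL2 (f k) by exact: uL.
pose d k x := f k.+1 x - f k x.
have dL k : rL2 (d k) by exact: rL2B.
have dd k : dotp (d k) (d k) <= (2 ^+ k * 2 ^+ k)^-1.
  by apply/ltW/N_P => //; exact: leq_trans (nnS k).
pose g k x := 2 ^+ k * d k x ^+ 2.
have gi k : integ (g k) by apply: integZ; case: (dL k).
have g0 k x : 0 <= g k x by rewrite mulr_ge0 ?sqr_ge0// exprn_ge0.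
have mg k : measurable_fun (halfline R) (EFin \o g k).
  by apply/measurable_EFinP; exact: integ_meas (gi k).
pose Se x : \bar R := (\sum_(0 <= k <oo) (g k x)%:E)%E.
have Se0 x : (0 <= Se x)%E by apply: nneseries_ge0 => k _ _; rewrite lee_fin.
have mSe : measurable_fun (halfline R) Se.
  have := @ge0_emeasurable_sum _ _ R (halfline R) (fun k => EFin \o g k) xpredT.
  by apply => // k x _ _ /=; rewrite lee_fin.
have ISe : (\int[mu]_(x in halfline R) Se x < +oo)%E.
  rewrite /Se (@integral_nneseries _ _ R mu (halfline R) _ (fun k => EFin \o g k))//;
    last by move=> k x _ /=; rewrite lee_fin.
  apply: (@le_lt_trans _ _ 2%:E); last exact: ltry.
  apply: lime_le.
    apply: is_cvg_nneseries => k _ _; apply: integral_ge0 => x _.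
    by rewrite lee_fin.
  near=> m.
  have E k : (\int[mu]_(x in halfline R) (EFin \o g k) x)%E = (I (g k))%:E.
    by rewrite /I /Rintegral fineK//; apply: integrable_fin_num => //; exact: gi.
  under eq_bigr do rewrite E.
  rewrite sumEFin lee_fin; apply: le_trans (halves_sum m).
  apply: ler_sum => k _; rewrite /g I_Z; last by case: (dL k).
  rewrite (_ : I _ = dotp (d k) (d k)); last by apply: eq_I => x _; rewrite expr2.
  have k0 : 0 < (2 ^+ k : R) by rewrite exprn_gt0.
  apply: (@le_trans _ _ (2 ^+ k * (2 ^+ k * 2 ^+ k)^-1)); first by rewrite ler_pM2l.
  by rewrite invfM mulrA mulfV ?gt_eqF// mul1r.
(* A is the set where S is finite; off A the sequence is replaced by 0, so
   that the pointwise bound, and hence the limit, exists everywhere. *)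
pose A := halfline R `&` [set x | (Se x < +oo)%E].
have mA : measurable (A : set (measurableTypeR R)).
  exact: (emeasurable_fun_infty_o measurable_halfline mSe).
pose S x := fine (Se x).
have S0 x : 0 <= S x by apply: fine_ge0.
have Sfin x : A x -> Se x = (S x)%:E.
  by move=> [_ h]; rewrite /S fineK// ge0_fin_numE.
have bound x k m : A x -> (k <= m)%N ->
    (f m x - f k x) ^+ 2 <= 2 * (2 ^+ k)^-1 * S x.
  move=> Ax km; rewrite -(telescope_sumr (fun j => f j x) km).
  apply: (le_trans (weighted_sum (fun j => d j x) km)).
  rewrite ler_wpM2l ?mulr_ge0 ?invr_ge0 ?exprn_ge0//.
  rewrite -lee_fin -Sfin//.
  apply: le_trans (@nneseries_lim_ge R (fun k => (g k x)%:E) xpredT 0 m _).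
    rewrite sumEFin lee_fin (@big_cat_nat _ _ _ k 0%N m)//= lerDr.
    by apply: sumr_ge0 => j _.
  by move=> j _ _; rewrite lee_fin.
pose b x k := Num.sqrt (2 * (2 ^+ k)^-1 * S x).
have b0 x k : 0 <= b x k by exact: sqrtr_ge0.
have bb x k : b x k ^+ 2 = 2 * (2 ^+ k)^-1 * S x.
  by rewrite sqr_sqrtr// mulr_ge0// mulr_ge0// invr_ge0 exprn_ge0.
pose h k x := (f k \_ A) x.
have hf k x : A x -> h k x = f k x by move=> Ax; rewrite /h patchE mem_set.
have h0 k x : ~ A x -> h k x = 0 by move=> nAx; rewrite /h patchE memNset.
have hb x k m : (k <= m)%N -> `|h m x - h k x| <= b x k.
  move=> km; have [Ax|nAx] := pselect (A x); last first.
    by rewrite !h0// subrr normr0.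
  rewrite !hf// -(@ler_pXn2r _ 2)// ?nnegrE// real_normK ?num_real// bb.
  exact: bound.
have lim x := squeeze_point (b0 x) (hb x).
pose l x := projT1 (cid (lim x)).
have lP x k : (h k x - l x) ^+ 2 <= 2 * (2 ^+ k)^-1 * S x.
  rewrite /l; case: (cid _) => y /= /(_ k) hy.
  by rewrite -bb -(real_normK (num_real (h k x - y))) ler_pXn2r ?nnegrE.
have p2 : (2 ^+ k : R)^-1 @[k --> \oo] --> (0 : R).
  have : (2^-1 ^+ k : R) @[k --> \oo] --> (0 : R).
    by apply: cvg_expr; rewrite ger0_norm; lra.
  by under eq_fun do rewrite exprVn.
have small (c e : R) : 0 <= c -> 0 < e -> \forall k \near \oo, 2 * (2 ^+ k)^-1 * c < e.
  move=> c0 e0; have : (2 * (2 ^+ k)^-1 * c) @[k --> \oo] --> 2 * 0 * c.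
    by apply: cvgMl; apply: cvgMr.
  by rewrite mulr0 mul0r => /(cvgr_lt _); apply.
have mAR : measurable A by exact: mA.
have mh k : measurable_fun (halfline R) (h k).
  apply: measurable_funTS; apply: (measurable_restrictT (f k) mAR).1.
  apply: (@measurable_funS _ _ _ _ (halfline R) A (f k)).
  - exact: measurable_halfline.
  - exact: subIsetl.
  - exact: (fL k).1.
have ml : measurable_fun (halfline R) l.
  apply: (measurable_fun_cvg mh) => x _.
  apply/cvgrPdist_lt => e e0.
  have e20 : 0 < e ^+ 2 by rewrite exprn_gt0.
  near=> k; rewrite distrC -(@ltr_pXn2r _ 2)// ?nnegrE ?(ltW e0)//.
  rewrite real_normK ?num_real//.
  by apply: (le_lt_trans (lP x k)); near: k; exact: small.
have Sei : mu.-integrable (halfline R) Se.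
  apply/integrableP; split => //; apply: le_lt_trans ISe.
  rewrite le_eqVlt; apply/orP; left; apply/eqP; apply: eq_integral => x _.
  by rewrite gee0_abs.
have Si : integ S.
  apply: (le_integrable _ _ _ Sei) => //.
    by apply/measurable_EFinP; apply: measurableT_comp mSe => //; exact: measurable_fine.
  move=> x _ /=; rewrite ger0_norm// [leRHS]gee0_abs//.
  rewrite /S; case: (Se x) (Se0 x) => //= _; exact: leey.
have hfae k : ae_eq mu (halfline R) (f k) (h k).
  have := integrable_ae measurable_halfline Sei.
  apply: filterS => x Hx xhl; rewrite hf//; split => //=.
  by rewrite -ge0_fin_numE//; exact: Hx.
have hL k : rL2 (h k) by apply: ae_rL2 (fL k).
have hlL k : rL2 (fun x => h k x - l x).
  split; first exact: measurable_funB.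
  apply: (@le_integ _ _ (fun x => 2 * (2 ^+ k)^-1 * S x)); last exact: integZ.
    by apply: measurable_funX; exact: measurable_funB.
  by move=> x _; rewrite ger0_norm ?sqr_ge0.
have lL : rL2 l.
  apply: (@eq_rL2 _ (fun x => h 0%N x - (h 0%N x - l x))); first by move=> x _; ring.
  exact: rL2B.
exists l; split => // e e0.
have IS0 : 0 <= I S by apply: I_ge0.
have c0 : 0 <= 1 + 2 * I S by lra.
near \oo => k; exists (nn k) => n kn.
have h1 : dotp (fun x => u n x - f k x) (fun x => u n x - f k x) <= (2 ^+ k)^-1.
  apply: (le_trans (ltW (N_P k _ _ (leq_trans (nnN k) kn) (nnN k)))).
  by rewrite lef_pV2 ?posrE ?mulr_gt0 ?exprn_gt0// ler_peMr ?exprn_ge0// exprn_ege1// ler1n.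
have h2 : dotp (fun x => f k x - l x) (fun x => f k x - l x) <= 2 * (2 ^+ k)^-1 * I S.
  rewrite (@ae_dotp _ _ (fun x => h k x - l x) _ (fun x => h k x - l x)).
  - rewrite /dotp -I_Z//; apply: le_I.
    + exact: rL2_mul.
    + exact: integZ.
    + by move=> x _; rewrite -expr2.
  - exact: rL2B.
  - exact: hlL.
  - exact: rL2B.
  - exact: hlL.
  - by apply: filterS (hfae k) => x Hx xhl; rewrite Hx.
  - by apply: filterS (hfae k) => x Hx xhl; rewrite Hx.
have uf : rL2 (fun x => u n x - f k x) by exact: rL2B.
have fl : rL2 (fun x => f k x - l x) by exact: rL2B.
have ul : rL2 (fun x => u n x - l x) by exact: rL2B.
have h3 : dotp (fun x => u n x - l x) (fun x => u n x - l x) <=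
   2 * dotp (fun x => u n x - f k x) (fun x => u n x - f k x) +
   2 * dotp (fun x => f k x - l x) (fun x => f k x - l x).
  rewrite /dotp -!I_Z; [|exact: rL2_mul..].
  rewrite -I_D; [|by apply: integZ; exact: rL2_mul..].
  apply: le_I; [exact: rL2_mul|by apply: integD; apply: integZ; exact: rL2_mul|].
  move=> x _; have := sqr_ge0 ((u n x - f k x) - (f k x - l x)); lra.
apply: (le_lt_trans h3).
apply: (@le_lt_trans _ _ (2 * (2 ^+ k)^-1 * (1 + 2 * I S))).
  by rewrite mulrDr mulr1; lra.
by near: k; exact: small.
Unshelve. all: by end_near. Qed.

End Completeness.

(** * Graph closures and the core of A *)

Section PairProjection.
Context {R : realType}.
Implicit Types (f g h phi psi : R -> R) (e : R).
Local Notation mu := (@lebesgue_measure R).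

Definition subspace2 (V : (R -> R) -> (R -> R) -> Prop) :=
  [/\ forall f g, V f g -> rL2 f /\ rL2 g, V (fun=> 0) (fun=> 0) &
      forall c f g f' g', V f g -> V f' g' ->
        V (fun x => c * f x + f' x) (fun x => c * g x + g' x)].

(** Membership in the closure of V in L^2 + L^2, phrased for representatives. *)
Definition approx2 (V : (R -> R) -> (R -> R) -> Prop) f g :=
  forall e, 0 < e -> exists phi psi, V phi psi /\
    dotp (fun x => f x - phi x) (fun x => f x - phi x) +
    dotp (fun x => g x - psi x) (fun x => g x - psi x) < e.

Lemma pair_projection V f g : subspace2 V -> rL2 f -> rL2 g ->
  exists f' g', [/\ rL2 f', rL2 g',
    forall phi psi, V phi psi -> dotp f' phi + dotp g' psi = 0 &
    approx2 V (fun x => f x - f' x) (fun x => g x - g' x)].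
Proof.
move=> [VL V0 Vlin] fL gL.
pose E := ((R -> R) * (R -> R))%type : lmodType R.
pose D (x : E) := rL2 x.1 /\ rL2 x.2.
pose ip (x y : E) := dotp x.1 y.1 + dotp x.2 y.2.
have DD x y : D x -> D y -> D (x + y).
  by move=> [h1 h2] [h3 h4]; split; exact: rL2D.
have DZ c x : D x -> D (c *: x) by move=> [h1 h2]; split; exact: rL2Z.
have ipC x y : D x -> D y -> ip x y = ip y x.
  by move=> _ _; rewrite /ip dotpC [dotp x.2 _]dotpC.
have ipD x y z : D x -> D y -> D z -> ip (x + y) z = ip x z + ip y z.
  move=> [h1 h2] [h3 h4] [h5 h6]; rewrite /ip.
  by rewrite [dotp (x + y).1 _]dotpDl// [dotp (x + y).2 _]dotpDl// addrACA.
have ipZ c x y : D x -> D y -> ip (c *: x) y = c * ip x y.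
  move=> [h1 h2] [h3 h4]; rewrite /ip.
  by rewrite [dotp (c *: x).1 _]dotpZl// [dotp (c *: x).2 _]dotpZl// mulrDr.
have ip0 x : D x -> 0 <= ip x x by move=> _; rewrite addr_ge0// dotp_ge0.
have Dcomplete (u : nat -> E) : (forall n, D (u n)) ->
  (forall e : R, 0 < e -> exists N, forall m n, (N <= m)%N -> (N <= n)%N ->
     ip (u m - u n) (u m - u n) < e) ->
  exists l, D l /\ forall e : R, 0 < e -> exists N, forall n, (N <= n)%N ->
     ip (u n - l) (u n - l) < e.
  move=> Du Cu.
  have [||l1 [l1L Hl1]] := @rL2_complete R (fun n => (u n).1).
  - by move=> n; case: (Du n).
  - move=> e e0; have [N HN] := Cu e e0; exists N => m n Nm Nn.
    by apply: le_lt_trans (HN m n Nm Nn); rewrite /ip lerDl dotp_ge0.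
  have [||l2 [l2L Hl2]] := @rL2_complete R (fun n => (u n).2).
  - by move=> n; case: (Du n).
  - move=> e e0; have [N HN] := Cu e e0; exists N => m n Nm Nn.
    by apply: le_lt_trans (HN m n Nm Nn); rewrite /ip lerDr dotp_ge0.
  exists (l1, l2); split => // e e0.
  have e20 : 0 < e / 2 by rewrite divr_gt0.
  have [N1 HN1] := Hl1 _ e20; have [N2 HN2] := Hl2 _ e20.
  exists (maxn N1 N2) => n; rewrite geq_max => /andP[/HN1 h1 /HN2 h2].
  rewrite /ip [ltRHS](splitr e); exact: ltrD.
pose W (x : E) := V x.1 x.2.
have WD x : W x -> D x by move=> /VL[].
have WDD x y : W x -> W y -> W (x + y).
  move=> Wx Wy; have := Vlin 1 _ _ _ _ Wx Wy.
  by congr V; apply/funext => z; rewrite mul1r.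
have WZ c x : W x -> W (c *: x).
  move=> Wx; have := Vlin c _ _ _ _ Wx V0.
  by congr V; apply/funext => z; rewrite addr0.
have Dx : D ((f, g) : E) by split.
have [pr []] := @projection R E D ip DD DZ ipC ipD ipZ ip0
  Dcomplete W WD V0 WDD WZ _ Dx.
case: pr => p1 p2 [p1L p2L] pV Hap.
exists p1, p2; split => //.
- by move=> phi psi Vpp; exact: (pV (phi, psi)).
- by move=> e /Hap[y Vy h]; exists y.1, y.2.
Qed.

Lemma approx2_dotp V f g a b : subspace2 V -> rL2 f -> rL2 g -> rL2 a -> rL2 b ->
  approx2 V f g -> (forall phi psi, V phi psi -> dotp a phi + dotp b psi = 0) ->
  dotp a f + dotp b g = 0.
Proof.
move=> [VL _ _] fL gL aL bL fg ab; apply/eqP; apply: contrapT => /negP n0.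
set r := dotp a f + dotp b g in n0.
have r0 : 0 < r ^+ 2 by rewrite exprn_even_gt0.
have Na := dotp_ge0 a; have Nb := dotp_ge0 b.
pose M := dotp a a + dotp b b + 1; have M0 : 0 < M by rewrite /M; lra.
have e0 : 0 < r ^+ 2 / (2 * M) by rewrite divr_gt0// mulr_gt0.
have [phi [psi [Vpp]]] := fg _ e0.
have [phiL psiL] := VL _ _ Vpp.
have f1 : rL2 (fun x => f x - phi x) by exact: rL2B.
have g1 : rL2 (fun x => g x - psi x) by exact: rL2B.
have h1 := dotp_CS aL f1; have h2 := dotp_CS bL g1.
have : r = dotp a (fun x => f x - phi x) + dotp b (fun x => g x - psi x).
  rewrite ![dotp _ (fun x => _ - _)]dotpC !dotpBl// ![dotp _ a]dotpC ![dotp _ b]dotpC.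
  by have := ab _ _ Vpp; rewrite /r; lra.
move: h1 h2.
set p := dotp a (fun x => f x - phi x); set q := dotp b (fun x => g x - psi x).
have := dotp_ge0 (fun x => f x - phi x); have := dotp_ge0 (fun x => g x - psi x).
set X := dotp _ _; set Y := dotp _ _ => X0 Y0 h1 h2 rE.
rewrite ltr_pdivlMr; last by rewrite mulr_gt0.
apply/negP; rewrite -leNgt.
have : r ^+ 2 <= 2 * (p ^+ 2 + q ^+ 2) by rewrite rE; have := sqr_ge0 (p - q); lra.
move/le_trans; apply.
have : dotp a a * Y <= M * Y by rewrite ler_wpM2r// /M; lra.
have : dotp b b * X <= M * X by rewrite ler_wpM2r// /M; lra.
by lra.
Qed.

Lemma dotp_sub_ae f f' phi : rL2 f -> rL2 f' -> rL2 phi ->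
  ae_eq mu (halfline R) f f' ->
  dotp (fun x => f x - phi x) (fun x => f x - phi x) =
  dotp (fun x => f' x - phi x) (fun x => f' x - phi x).
Proof.
move=> fL fL' pL ff'; apply: ae_dotp; try exact: rL2B.
- by apply: filterS ff' => x Hx xhl; rewrite Hx.
- by apply: filterS ff' => x Hx xhl; rewrite Hx.
Qed.

Lemma approx2_ae V f g f' g' : subspace2 V -> rL2 f -> rL2 g -> rL2 f' -> rL2 g' ->
  ae_eq mu (halfline R) f f' -> ae_eq mu (halfline R) g g' ->
  approx2 V f g -> approx2 V f' g'.
Proof.
move=> [VL _ _] fL gL fL' gL' ff' gg' H e /H[phi [psi [Vpp h]]].
have [phiL psiL] := VL _ _ Vpp.
exists phi, psi; split => //.
by rewrite -(dotp_sub_ae fL fL' phiL ff') -(dotp_sub_ae gL gL' psiL gg').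
Qed.

End PairProjection.

Section Cores.
Context {R : realType}.
Local Notation mu := (@lebesgue_measure R).
Local Notation sq := (@Num.sqrt R).
Implicit Types (f g h k w p v q phi psi : R -> R) (x e c : R).
Variable eta : R -> R.
Hypothesis eta_cut : cutoff eta.

Lemma ae_sub0 f g : ae_eq mu (halfline R) g (fun=> 0) ->
  ae_eq mu (halfline R) (fun x => f x - g x) f.
Proof. by apply: filterS => x H /H ->; rewrite subr0. Qed.

(** The component of f which is orthogonal to all test functions vanishes by
    [fund_lemma]. *)
Lemma test_dense f e : rL2 f -> 0 < e ->
  exists2 phi, rtest phi & dotp (fun x => f x - phi x) (fun x => f x - phi x) < e.
Proof.
move=> fL e0.
pose V (phi psi : R -> R) := rtest phi /\ psi = (fun=> 0).
have VS : subspace2 V.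
  split.
  - by move=> phi psi [tp ->]; split; [exact: rtest_rL2|exact: rL2_0].
  - by split => //; exact: rtest0.
  - move=> c a b a' b' [ta ->] [tb ->]; split.
      by apply: rtest_D => //; exact: rtest_Z.
    by apply/funext => x; rewrite mulr0 addr0.
have [f' [g' [fL' gL' orth app]]] := pair_projection VS fL rL2_0.
have f'0 : ae_eq mu (halfline R) f' (fun=> 0).
  apply: (fund_lemma eta_cut); first exact: loc_integ_rL2.
  move=> phi tp; have := orth phi (fun=> 0) (conj tp erefl).
  rewrite [dotp g' _](_ : _ = 0) ?addr0; first by rewrite dotpC.
  by rewrite /dotp -[RHS](@I0 R); apply: eq_I => x _; rewrite mulr0.
have [phi [psi [[tp _] h]]] := app e e0.
exists phi => //; apply: le_lt_trans h.
rewrite (@dotp_sub_ae _ f (fun x => f x - f' x)).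
- by rewrite lerDl dotp_ge0.
- by [].
- exact: rL2B.
- exact: rtest_rL2.
- by apply: filterS f'0 => x H /H ->; rewrite subr0.
Qed.

Lemma rtest_Aop phi : rtest phi -> rtest (Aop phi).
Proof.
move=> tp; apply: rtest_D; first exact: rtest_derive.
rewrite (_ : (fun x => _) = (fun x => (- 2^-1 * x^-1) * phi x)).
  by apply: rtest_M => //; apply: smooth_Z; exact: smooth_inv.
by apply/funext => x; rewrite invfM mulNr mulNr.
Qed.

Lemma rtest_Lop phi : rtest phi -> rtest (Lop phi).
Proof.
move=> tp; apply: rtest_D.
  by apply: rtest_N; do 2 apply: rtest_derive.
rewrite (_ : (fun x => _) = (fun x => (- 4^-1 * (x^-1 * x^-1)) * phi x)).
  apply: rtest_M => //; apply: smooth_Z; apply: smooth_M; exact: smooth_inv.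
by apply/funext => x; rewrite expr2 invfM !mulNr.
Qed.

Lemma Aop_lin c phi psi x : rtest phi -> rtest psi -> 0 < x ->
  Aop (fun x => c * phi x + psi x) x = c * Aop phi x + Aop psi x.
Proof.
move=> tp ts x0; rewrite /Aop.
rewrite (hasD_derive1 (hasD_D (hasD_Z c (rtest_hasD tp)) (rtest_hasD ts)) x0).
by ring.
Qed.

Lemma Lop_lin c phi psi x : rtest phi -> rtest psi -> 0 < x ->
  Lop (fun x => c * phi x + psi x) x = c * Lop phi x + Lop psi x.
Proof.
move=> tp ts x0; rewrite /Lop.
have D1 := hasD_D (hasD_Z c (rtest_hasD tp)) (rtest_hasD ts).
have D2 : hasD ((fun x => c * phi x + psi x)^`()%classic)
    (fun x => c * (phi^`()^`())%classic x + (psi^`()^`())%classic x).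
  apply: (eq_hasD _ _ (hasD_D (hasD_Z c (rtest_hasD (rtest_derive tp)))
    (rtest_hasD (rtest_derive ts)))) => // y y0.
  by rewrite (hasD_derive1 D1).
rewrite (hasD_derive1 D2 x0).
by move: (_^`()%classic x) (_^`()%classic x) => u v; ring.
Qed.

Definition VA phi psi := rtest phi /\ rL2 psi /\ forall x, 0 < x -> psi x = Aop phi x.
Definition VL phi psi := rtest phi /\ rL2 psi /\ forall x, 0 < x -> psi x = Lop phi x.

Lemma VA_test phi : rtest phi -> VA phi (Aop phi).
Proof. by move=> tp; split => //; split => //; apply: rtest_rL2; exact: rtest_Aop. Qed.

Lemma VL_test phi : rtest phi -> VL phi (Lop phi).
Proof. by move=> tp; split => //; split => //; apply: rtest_rL2; exact: rtest_Lop. Qed.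

Lemma VA_subspace : subspace2 VA.
Proof.
split.
- by move=> phi psi [tp [psiL _]]; split => //; exact: rtest_rL2.
- split; first exact: rtest0; split; first exact: rL2_0.
  move=> x x0; rewrite /Aop mulr0 subr0 (hasD_derive1 (hasD_cst 0))//.
- move=> c a b a' b' [ta [bL bE]] [ta' [bL' bE']].
  split; first by apply: rtest_D => //; exact: rtest_Z.
  split; first by apply: rL2D => //; exact: rL2Z.
  by move=> x x0; rewrite Aop_lin// bE// bE'.
Qed.

Lemma VL_subspace : subspace2 VL.
Proof.
split.
- by move=> phi psi [tp [psiL _]]; split => //; exact: rtest_rL2.
- split; first exact: rtest0; split; first exact: rL2_0.
  move=> x x0.
  have D1 : hasD ((fun=> 0 : R)^`()%classic) (fun=> 0).
    apply: (eq_hasD _ _ (@hasD_cst R 0)) => // y y0.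
    by rewrite (hasD_derive1 (hasD_cst 0)).
  by rewrite /Lop (hasD_derive1 D1)// mulr0 subr0 oppr0.
- move=> c a b a' b' [ta [bL bE]] [ta' [bL' bE']].
  split; first by apply: rtest_D => //; exact: rtest_Z.
  split; first by apply: rL2D => //; exact: rL2Z.
  by move=> x x0; rewrite Lop_lin// bE// bE'.
Qed.

(** The factorisation L = A^* A on smooth functions. *)
Lemma Lop_factor phi x : rtest phi -> 0 < x ->
  Lop phi x = - ((Aop phi)^`()%classic x + (2 * x)^-1 * Aop phi x).
Proof.
move=> tp x0.
have D1 : hasD (Aop phi) (fun x => (phi^`()^`())%classic x -
   (2^-1 * (x^-1 * phi^`()%classic x) - 2^-1 * (x^-1 * x^-1 * phi x))).
  apply: (eq_hasD _ _ (hasD_B (rtest_hasD (rtest_derive tp))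
    (hasD_Z 2^-1 (hasD_M hasD_inv (rtest_hasD tp))))) => y y0.
    by rewrite /Aop invfM; ring.
  by ring.
rewrite (hasD_derive1 D1 x0) /Lop /Aop.
by field; rewrite gt_eqF.
Qed.

Lemma rtest_Aadj phi : rtest phi -> rtest (fun x => phi^`()%classic x + (2 * x)^-1 * phi x).
Proof.
move=> tp; apply: rtest_D; first exact: rtest_derive.
rewrite (_ : (fun x => _) = (fun x => (2^-1 * x^-1) * phi x)).
  by apply: rtest_M => //; apply: smooth_Z; exact: smooth_inv.
by apply/funext => x; rewrite invfM.
Qed.

Lemma weakA_closed f k : rL2 f -> rL2 k -> approx2 VA f k -> weakA f k.
Proof.
move=> fL kL fk phi tp.
have tA := rtest_Aadj tp.
have := approx2_dotp VA_subspace fL kL (rtest_rL2 tA) (rtest_rL2 tp) fk.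
rewrite /dotp => H; apply/eqP; rewrite -addr_eq0 -[X in _ == X](H _).
  by apply/eqP; congr (_ + _); apply: eq_I => x _; rewrite mulrC.
move=> f1 k1 [tf1 [_ kE]].
apply/eqP; rewrite addr_eq0; apply/eqP.
have P1 := hasD_prim (rtest_hasD tp) (contp_rtest_derive tp).
have := I_parts (rtest_hasD tf1) (contp_rtest_derive tf1) tf1.2
  (rtest_derive tf1).2 P1.
move=> E1.
have i1 : integ (fun x => f1 x * phi^`()%classic x).
  by apply: rtest_integM => //; apply: loc_integ_contp; exact: contp_rtest_derive.
have i2 : integ (fun x => (2 * x)^-1 * (phi x * f1 x)).
  apply: (@eq_integ _ (fun x => (2^-1 * x^-1 * f1 x) * phi x)).
    by move=> x _; rewrite invfM; ring.
  apply: csupp_integM; first by apply: loc_integ_contp; exact: rtest_contp.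
    apply: contp_M; last exact: rtest_contp.
    by apply: contp_M; [exact: contp_cst|exact: contp_inv].
  by apply: csupp_M; exact: tf1.2.
have i3 : integ (fun x => phi x * (f1^`()%classic) x).
  apply: rtest_integM => //; apply: loc_integ_contp; exact: contp_rtest_derive.
transitivity (I (fun x => f1 x * phi^`()%classic x) +
   I (fun x => (2 * x)^-1 * (phi x * f1 x))).
  by rewrite -I_D//; apply: eq_I => x _; ring.
have -> : I (fun x => phi x * k1 x) = I (fun x => phi x * (f1^`()%classic) x) -
   I (fun x => (2 * x)^-1 * (phi x * f1 x)).
  by rewrite -I_B//; apply: eq_I => x x0; rewrite kE// /Aop; ring.
by rewrite E1; ring.
Qed.

(** The component (f', k') of (f, k) which is orthogonal to the graph of A on
    test functions still satisfies A f' = k', and the orthogonality says that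
    A^* A f' = - f', that is, L f' = - f'. As k' is square integrable, f' has
    no logarithmic part, and [form_sol] gives |k'| ^ 2 = - |f'| ^ 2. *)
Lemma A_core f k : rL2 f -> rL2 k -> weakA f k -> approx2 VA f k.
Proof.
move=> fL kL fk.
have [f' [k' [fL' kL' orth app]]] := pair_projection VA_subspace fL kL.
have fk' : weakA f' k'.
  have h := weakA_closed (rL2B fL fL') (rL2B kL kL') app.
  move=> phi tp; have h1 := fk _ tp; have h2 := h _ tp.
  have tA := rtest_rL2 (rtest_Aadj tp).
  have pL := rtest_rL2 tp.
  move: h1 h2; rewrite -!/(dotp _ _) !dotpBl//; lra.
have fL'' : weakL f' (fun x => - f' x).
  move=> phi tp; have tA := rtest_Aop tp.
  have := orth _ _ (VA_test tp); rewrite /dotp.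
  have := fk' _ tA.
  have E : I (fun x => f' x * Lop phi x) =
      - I (fun x => f' x * ((Aop phi)^`()%classic x + (2 * x)^-1 * Aop phi x)).
    rewrite -I_N; first by apply: eq_I => x x0; rewrite Lop_factor//; ring.
    apply: (@eq_integ _ (fun x => - (f' x * Lop phi x))).
      by move=> x x0; rewrite Lop_factor//; ring.
    by apply: integN; apply: rL2_mul => //; apply: rtest_rL2; exact: rtest_Lop.
  rewrite E => ->; rewrite opprK => /eqP; rewrite addrC addr_eq0 => /eqP ->.
  rewrite -I_N; first by apply: eq_I => x _; ring.
  by apply: rL2_mul => //; exact: rtest_rL2.
have [w [p [sw fw]]] := weakL_sol eta_cut fL' (rL2N fL') fL''.
have [wL _ Dw Pp] := sw; have cp := prim_contp Pp.
have kp : ae_eq mu (halfline R) k' (fun x => sq x * x^-1 * p x).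
  apply: (sol_weakA eta_cut Dw cp); first exact: loc_integ_rL2.
  move=> phi tp; rewrite -(fk' _ tp).
  apply/esym; apply: ae_I.
  - apply: measurable_funM; first exact: fL'.1.
    have tA := rtest_Aadj tp.
    by apply: contp_meas; exact: rtest_contp.
  - apply: measurable_funM; first exact: wL.1.
    have tA := rtest_Aadj tp.
    by apply: contp_meas; exact: rtest_contp.
  - by apply: filterS fw => x H /H ->.
have mkp : measurable_fun (halfline R) (fun x => sq x * x^-1 * p x).
  apply: contp_meas; apply: contp_M => //.
  by apply: contp_M; [exact: contp_sqrt|exact: contp_inv].
have kpL : rL2 (fun x => sq x * x^-1 * p x) by exact: ae_rL2 mkp kp kL'.
have [c1 [c2 Bw]] := sol_BV sw.
have c20 := sol_c2_eq0 cp Bw kpL; rewrite c20 in Bw.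
have [_ form] := form_sol sw Bw.
have Nk := dotp_ge0 (fun x => sq x * x^-1 * p x).
have E : dotp (fun x => sq x * w x) (fun x => - f' x) = - dotp f' f'.
  rewrite dotpC dotpNl//; congr (- _); apply: ae_dotp => //.
    exact: ae_eq_refl.
  by apply: filterS fw => x H /H ->.
have Nf := dotp_ge0 f'.
rewrite E in form.
have f0 : ae_eq mu (halfline R) f' (fun=> 0) by apply: dotp0 => //; lra.
have k0 : ae_eq mu (halfline R) k' (fun=> 0).
  apply: dotp0 => //; rewrite (ae_dotp _ kpL _ kpL kp kp)//; lra.
apply: (@approx2_ae _ VA (fun x => f x - f' x) (fun x => k x - k' x) f k
  VA_subspace) => //; try exact: rL2B.
- exact: ae_sub0 f0.
- exact: ae_sub0 k0.
Qed.

End Cores.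

(** * The maximal and the minimal domain of L *)

Section References.
Context {R : realType}.
Local Notation mu := (@lebesgue_measure R).
Local Notation sq := (@Num.sqrt R).
Implicit Types (f g h k w p v q phi psi : R -> R) (x e c : R).
Variable eta : R -> R.
Hypothesis eta_cut : cutoff eta.

Local Notation eta' := (eta^`()%classic).
Local Notation eta'' := ((eta^`()^`())%classic).

Lemma rL2_bounded f M b : measurable_fun (halfline R) f ->
  (forall x, 0 < x -> x <= b -> `|f x| <= M) -> (forall x, b < x -> f x = 0) ->
  rL2 f.
Proof.
move=> mf fM f0; split => //.
have ii : integ (fun x => M ^+ 2 * \1_(`[0, b]%classic) x).
  apply: integZ; apply: integrableS (integrable_indic_itv 0 b true false) => //.
apply: le_integ ii; first exact: measurable_funX.
move=> x x0; rewrite ger0_norm ?sqr_ge0// indicE.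
have [xb|bx] := leP x b; last first.
  by rewrite f0// expr0n mulr_ge0// sqr_ge0.
rewrite mem_set/= ?in_itv/= ?(ltW x0)// mulr1 -(real_normK (num_real (f x))).
have fMx := fM x x0 xb.
by rewrite lerXn2r ?nnegrE// (le_trans _ fMx).
Qed.

Lemma eta_flat1 x : 0 < x -> (x < 1) || (2 < x) -> eta' x = 0.
Proof.
have [_ e1 e0] := eta_cut; move=> x0 /orP[x1|x2].
  suff H : \forall y \near x, eta y = cst 1 y.
    by rewrite derive1E (near_eq_derive _ H) derive_cst.
  near=> y; apply: e1; first by near: y; exact: near_pos.
  by apply: ltW; near: y; exact: lt_nbhsl.
suff H : \forall y \near x, eta y = cst 0 y.
  by rewrite derive1E (near_eq_derive _ H) derive_cst.
by near=> y; apply: e0; apply: ltW; near: y; exact: lt_nbhsr.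
Unshelve. all: by end_near. Qed.

Lemma eta_flat2 x : 0 < x -> (x < 1) || (2 < x) -> eta'' x = 0.
Proof.
move=> x0 hx; suff H : \forall y \near x, eta' y = cst 0 y.
  by rewrite derive1E (near_eq_derive _ H) derive_cst.
case/orP: hx => [x1|x2]; near=> y; apply: eta_flat1; try by near: y; exact: near_pos.
- by apply/orP; left; near: y; exact: lt_nbhsl.
- by apply/orP; right; near: y; exact: lt_nbhsr.
Unshelve. all: by end_near. Qed.

Let se : smooth eta. Proof. by case: eta_cut. Qed.
Let ce : contp eta := smooth_contp se.
Let ce' : contp eta' := smooth_contp (smooth_derive se).
Let ce'' : contp eta'' := smooth_contp (smooth_derive (smooth_derive se)).
Let De : hasD eta eta' := smooth_hasD se.
Let De' : hasD eta' eta'' := smooth_hasD (smooth_derive se).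

Let c_ln : contp (@ln R).
Proof. exact: hasD_contp hasD_ln. Qed.

Let c_sqi : contp (fun x => sq x * x^-1).
Proof. by apply: contp_M; [exact: contp_sqrt|exact: contp_inv]. Qed.

Lemma mid_rL2 g : contp g -> (forall x, 0 < x -> (x < 1) || (2 < x) -> g x = 0) ->
  rL2 g.
Proof.
move=> cg g0.
have [M M0 HM] := contp_bounded 2 ltr01 cg.
apply: (@rL2_bounded _ M 2); first exact: contp_meas.
- move=> x x0 x2; have [x1|x1] := ltP x 1; last by apply: HM; rewrite x1.
  by rewrite g0 ?x1// normr0.
- move=> x x2; apply: g0; last by rewrite x2 orbT.
  by lra.
Qed.

(** The functions sqrt x * eta and sqrt x * eta * ln x coincide near 0 with
    the solutions sqrt x and sqrt x * ln x of L u = 0, and realise the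
    boundary values (1, 0) and (0, 1). The functions [ref1] and [ref2] are
    their components p, and [ref1L] and [ref2L] their images under L. *)
Definition ref1 x : R := x * eta' x.
Definition ref1L x : R := - (sq x * x^-1 * (eta' x + x * eta'' x)).
Definition ref2 x : R := x * eta' x * ln x + eta x.
Definition ref2L x : R := - (sq x * x^-1 * ((eta' x + x * eta'' x) * ln x + 2 * eta' x)).

Lemma ref1_sol : sol eta ref1 ref1L.
Proof.
have [M M0 HM] := eta_bounded eta_cut.
have c1 : contp (fun x => eta' x + x * eta'' x).
  by apply: contp_D => //; apply: contp_M => //; exact: contp_id.
have Dp : hasD ref1 (fun x => eta' x + x * eta'' x).
  by apply: hasD_eq (hasD_M hasD_id De') => x _; ring.
split.
- apply: (@rL2_bounded _ (sq 2 * M) 2).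
  + by apply: contp_meas; apply: contp_M => //; exact: contp_sqrt.
  + move=> x x0 x2; rewrite normrM ler_pM// ?HM//.
    by rewrite ger0_norm ?sqrtr_ge0// ler_wsqrtr.
  + by move=> x x2; have [_ _ e0] := eta_cut; rewrite e0 ?mulr0// ltW.
- apply: mid_rL2; first by apply: contp_N; exact: contp_M.
  by move=> x x0 hx; rewrite /ref1L eta_flat1// eta_flat2// mulr0 addr0 mulr0 oppr0.
- apply: hasD_eq De => x x0; rewrite /ref1; field; rewrite gt_eqF//.
- apply: eq_prim (hasD_prim Dp c1) => // x x0; rewrite /ref1L.
  transitivity ((sq x * x^-1 * sq x) * (eta' x + x * eta'' x)); last by ring.
  by rewrite sq_inv// mul1r.
Qed.

Lemma ref1_BV : BV eta ref1 1 0.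
Proof.
have [_ e1 e0] := eta_cut.
have [M M0 HM] := eta_bounded eta_cut.
have [M' M'0 HM'] := contp_bounded 2 ltr01 ce'.
exists (M + M' + 1) => x x0; rewrite subr0 mul0r subr0; split.
  rewrite /ref1 normrM (gtr0_norm x0) mulrC ler_wpM2r ?(ltW x0)//.
  have [hx|] := boolP ((x < 1) || (2 < x)).
    by rewrite eta_flat1// normr0; lra.
  rewrite negb_or -!leNgt => /andP[x1 x2].
  by have := HM' x; rewrite x1 x2 => /(_ isT); lra.
have [x1|/ltW x1] := leP x 1.
  by rewrite e1// subrr normr0 mulr_ge0 ?(ltW x0)//; lra.
apply: (le_trans (ler_normB _ _)); rewrite normr1.
have := HM x x0; have : 0 <= (M + M' + 1) * (x - 1).
  by rewrite mulr_ge0 ?subr_ge0//; lra.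
by lra.
Qed.

Lemma ln_bound x : 1 <= x -> `|ln x| <= x.
Proof.
move=> x1; have x0 : 0 < x by lra.
rewrite ger0_norm ?ln_ge0//.
have := le_ln1Dx (_ : -1 < x - 1); rewrite (addrC 1) subrK => /(_ _) h.
by apply: (le_trans (h _)); lra.
Qed.

Lemma ref2_sol : sol (fun x => eta x * ln x) ref2 ref2L.
Proof.
have [M M0 HM] := eta_bounded eta_cut.
have c1 : contp (fun x => (eta' x + x * eta'' x) * ln x + 2 * eta' x).
  apply: contp_D; last by apply: contp_M => //; exact: contp_cst.
  apply: contp_M => //; apply: contp_D => //; apply: contp_M => //.
  exact: contp_id.
have Dp : hasD ref2 (fun x => (eta' x + x * eta'' x) * ln x + 2 * eta' x).
  apply: hasD_eq (hasD_D (hasD_M (hasD_M hasD_id De') hasD_ln) De) => x x0.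
  by field; rewrite gt_eqF.
split.
- apply: (@rL2_bounded _ (M * (2 + 2 * sq 2)) 2).
  + apply: contp_meas; apply: contp_M; first exact: contp_sqrt.
    exact: contp_M.
  + move=> x x0 x2; rewrite mulrCA normrM ler_pM// ?HM//.
    have s2 : 0 <= sq 2 := sqrtr_ge0 2.
    have sx : 0 < sq x by rewrite sqrtr_gt0.
    rewrite normrM (gtr0_norm sx).
    have [x1|/ltW x1] := leP x 1.
      have := ln_sqrt_le x0 x1; rewrite -{1}(sqr_sq x0) -mulrA mulrC [2 * _]mulrC.
      by rewrite mulrC ler_pM2l//; lra.
    have := ln_bound x1 => hl.
    have : sq x <= sq 2 by rewrite ler_wsqrtr.
    move=> hs; apply: (@le_trans _ _ (sq 2 * 2)); last by lra.
    by rewrite ler_pM// ?(ltW sx)// (le_trans hl).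
  + by move=> x x2; have [_ _ e0] := eta_cut; rewrite e0 ?mul0r ?mulr0// ltW.
- apply: mid_rL2; first by apply: contp_N; exact: contp_M.
  move=> x x0 hx.
  by rewrite /ref2L eta_flat1// eta_flat2//; ring.
- apply: hasD_eq (hasD_M De hasD_ln) => x x0; rewrite /ref2; field; rewrite gt_eqF//.
- apply: eq_prim (hasD_prim Dp c1) => // x x0; rewrite /ref2L.
  set r := (X in X = _).
  transitivity ((sq x * x^-1 * sq x) * r); last by rewrite /r; ring.
  by rewrite sq_inv// mul1r.
Qed.

Lemma ref2_BV : BV (fun x => eta x * ln x) ref2 0 1.
Proof.
have [_ e1 e0] := eta_cut.
have [M M0 HM] := eta_bounded eta_cut.
have [M' M'0 HM'] := contp_bounded 2 ltr01 ce'.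
exists (M + 2 * M' + 1) => x x0; rewrite subr0 mul1r.
have C0 : 0 <= M + 2 * M' + 1 by lra.
have [x1|/ltW x1] := leP x 1.
  rewrite e1// mul1r subrr normr0 mulr_ge0 ?(ltW x0)//; split => //.
  rewrite /ref2 e1// addrK normrM normrM (gtr0_norm x0).
  have [xl|xg] := ltP x 1.
    by rewrite eta_flat1 ?xl// normr0 mulr0 mul0r mulr_ge0 ?(ltW x0).
  have -> : x = 1 by apply/le_anti; rewrite x1.
  by rewrite ln1 normr0 mulr0 mulr1.
have hl := ln_bound x1.
have hM := HM x x0.
split.
  rewrite /ref2 -addrA; apply: (le_trans (ler_normD _ _)).
  have h1 : `|eta x - 1| <= (M + 1) * x.
    apply: (le_trans (ler_normB _ _)); rewrite normr1.
    by have : 0 <= (M + 1) * (x - 1); [rewrite mulr_ge0 ?subr_ge0//|]; lra.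
  have h2 : `|x * eta' x * ln x| <= 2 * M' * x.
    rewrite !normrM (gtr0_norm x0).
    have [hx|] := boolP ((x < 1) || (2 < x)).
      by rewrite eta_flat1// normr0 mulr0 mul0r !mulr_ge0 ?(ltW x0).
    rewrite negb_or -!leNgt => /andP[_ x2].
    have hM' : `|eta' x| <= M' by apply: HM'; rewrite x1 x2.
    have hl2 : `|ln x| <= 2 by rewrite (le_trans hl).
    rewrite -mulrA mulrC ler_wpM2r ?(ltW x0)// [2 * _]mulrC.
    by apply: ler_pM.
  by lra.
have -> : eta x * ln x - ln x = (eta x - 1) * ln x by ring.
rewrite normrM ler_pM//.
apply: (le_trans (ler_normB _ _)); rewrite normr1; lra.
Qed.

Lemma csupp_BV w p : contp w -> contp p -> csupp w -> csupp p -> BV w p 0 0.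
Proof.
have aux f : contp f -> csupp f -> exists2 C, 0 <= C & forall x, 0 < x -> `|f x| <= C * x.
  move=> cf [a [b [a0 f0]]].
  have [M M0 HM] := contp_bounded b a0 cf.
  exists (M / a); first by rewrite divr_ge0// ltW.
  move=> x x0; have [/andP[ax xb]|/negP h] := boolP (a <= x <= b); last first.
    rewrite f0// normr0; apply: mulr_ge0; last exact: ltW.
    by apply: divr_ge0 => //; exact: ltW.
  apply: (@le_trans _ _ M); first by apply: HM; rewrite ax.
  by rewrite mulrAC ler_pdivlMr// ler_wpM2l.
move=> cw cp /(aux _ cw)[C C0 HC] /(aux _ cp)[D D0 HD].
exists (C + D) => x x0; rewrite mul0r !subr0 !mulrDl; split.
  by rewrite ler_wpDl ?HD// mulr_ge0 ?(ltW x0).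
by rewrite ler_wpDr ?HC// mulr_ge0 ?(ltW x0).
Qed.

Lemma test_sol phi : rtest phi -> exists w p,
  [/\ sol w p (Lop phi), BV w p 0 0 & forall x, 0 < x -> phi x = sq x * w x].
Proof.
move=> tp; have t1 := rtest_derive tp; have t2 := rtest_derive t1.
pose w x := (sq x * x^-1) * phi x.
pose p x := sq x * phi^`()%classic x - 2^-1 * (sq x * x^-1) * phi x.
have E x : 0 < x -> phi x = sq x * w x.
  by move=> x0; rewrite /w !mulrA sqr_sq// mulfV ?gt_eqF// mul1r.
have Dw : hasD w (fun x => p x / x).
  apply: hasD_eq (hasD_M hasD_sqinv (rtest_hasD tp)) => x x0.
  by rewrite /p; field; rewrite gt_eqF.
have Dp : hasD p (fun x => - (sq x * Lop phi x)).
  apply: hasD_eq (hasD_B (hasD_M hasD_sqrt (rtest_hasD t1))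
     (hasD_M (hasD_Z 2^-1 hasD_sqinv) (rtest_hasD tp))) => x x0.
  by rewrite /Lop; field; rewrite gt_eqF.
have cL : contp (Lop phi) by exact: rtest_contp (rtest_Lop tp).
exists w, p; split => //.
- split => //.
  + exact: eq_rL2 E (rtest_rL2 tp).
  + by apply: rtest_rL2; exact: rtest_Lop.
  + by apply: hasD_prim => //; apply: contp_N; apply: contp_M => //; exact: contp_sqrt.
- apply: csupp_BV.
  + exact: hasD_contp Dw.
  + exact: hasD_contp Dp.
  + by apply: csupp_M; exact: tp.2.
  + apply: (@csupp_ext _ (fun x => sq x * phi^`()%classic x +
     (- (2^-1 * (sq x * x^-1))) * phi x)); first by move=> x; rewrite /p mulNr.
    by apply: csupp_D; apply: csupp_M; [exact: t1.2|exact: tp.2].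
Qed.

Lemma sol_rep_ae f w p g g' : sol w p g -> rL2 g' -> ae_eq mu (halfline R) g g' ->
  sol w p g'.
Proof.
move=> [wL gL Dw Pp] gL' gg'; split => //.
apply: prim_ae Pp; last by apply: filterS gg' => x H /H ->.
by apply: loc_integ_N; apply: loc_integ_M; [exact: contp_sqrt|exact: loc_integ_rL2].
Qed.

(** f belongs to the maximal domain, L f = g, and f = sqrt x (c1 + c2 ln x) +
    ... at 0. *)
Definition rbv f g c1 c2 := rL2 f /\ exists w p,
  [/\ sol w p g, BV w p c1 c2 & ae_eq mu (halfline R) f (fun x => sq x * w x)].

Lemma rbv_L2 f g c1 c2 : rbv f g c1 c2 -> rL2 f /\ rL2 g.
Proof. by move=> [fL [w [p [[_ gL _ _] _ _]]]]. Qed.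

Lemma weakL_rbv f g : rL2 f -> rL2 g -> weakL f g -> exists c1 c2, rbv f g c1 c2.
Proof.
move=> fL gL /(weakL_sol eta_cut fL gL)[w [p [sw fw]]].
have [c1 [c2 Bw]] := sol_BV sw; exists c1, c2; split => //; exists w, p; split => //.
Qed.

Lemma rbv_weakL f g c1 c2 : rbv f g c1 c2 -> weakL f g.
Proof.
move=> [fL [w [p [sw _ fw]]]] phi tp; rewrite -(sol_weakL sw tp).
have [wL _ _ _] := sw.
have LL := rtest_rL2 (rtest_Lop tp).
by apply: (@ae_dotp _ f _ (Lop phi) (Lop phi)) => //; exact: ae_eq_refl.
Qed.

Lemma rbv_ae f g f' g' c1 c2 : rbv f g c1 c2 -> rL2 f' -> rL2 g' ->
  ae_eq mu (halfline R) f f' -> ae_eq mu (halfline R) g g' -> rbv f' g' c1 c2.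
Proof.
move=> [fL [w [p [sw Bw fw]]]] fL' gL' ff' gg'; split => //; exists w, p; split => //.
  exact: sol_rep_ae sw gL' gg'.
by apply: filterS2 ff' fw => x h1 h2 xhl; rewrite -h1// h2.
Qed.

Lemma rbv_D f g c1 c2 f' g' d1 d2 : rbv f g c1 c2 -> rbv f' g' d1 d2 ->
  rbv (fun x => f x + f' x) (fun x => g x + g' x) (c1 + d1) (c2 + d2).
Proof.
move=> [fL [w [p [[wL gL Dw Pp] Bw fw]]]] [fL' [v [q [[vL gL' Dv Pq] Bv fv]]]].
split; first exact: rL2D.
exists (fun x => w x + v x), (fun x => p x + q x); split.
- split.
  + by apply: eq_rL2 (rL2D wL vL) => x _; rewrite mulrDr.
  + exact: rL2D.
  + by apply: hasD_eq (hasD_D Dw Dv) => x _; rewrite mulrDl.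
  + by apply: eq_prim (prim_D Pp Pq) => // x _; ring.
- exact: BV_D.
- by apply: filterS2 fw fv => x h1 h2 xhl; rewrite h1// h2// mulrDr.
Qed.

Lemma rbv_Z c f g c1 c2 : rbv f g c1 c2 ->
  rbv (fun x => c * f x) (fun x => c * g x) (c * c1) (c * c2).
Proof.
move=> [fL [w [p [[wL gL Dw Pp] Bw fw]]]]; split; first exact: rL2Z.
exists (fun x => c * w x), (fun x => c * p x); split.
- split.
  + by apply: eq_rL2 (rL2Z c wL) => x _; rewrite mulrCA.
  + exact: rL2Z.
  + by apply: hasD_eq (hasD_Z c Dw) => x _; rewrite mulrA.
  + by apply: eq_prim (prim_Z c Pp) => // x _; ring.
- exact: BV_Z.
- by apply: filterS fw => x h1 xhl; rewrite h1// mulrCA.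
Qed.

Lemma rbv_B f g c1 c2 f' g' d1 d2 : rbv f g c1 c2 -> rbv f' g' d1 d2 ->
  rbv (fun x => f x - f' x) (fun x => g x - g' x) (c1 - d1) (c2 - d2).
Proof.
move=> h1 /(rbv_Z (-1)) h2; have := rbv_D h1 h2.
by rewrite !mulN1r; congr rbv; apply/funext => x; rewrite mulN1r.
Qed.

Lemma rbv_green f f' g g' c1 c2 d1 d2 : rbv f f' c1 c2 -> rbv g g' d1 d2 ->
  dotp f g' - dotp f' g = c1 * d2 - c2 * d1.
Proof.
move=> [fL [w [p [sw Bw fw]]]] [gL [v [q [sv Bv gv]]]].
rewrite -(green sw sv Bw Bv).
have [wL fL' _ _] := sw; have [vL gL' _ _] := sv.
by congr (_ - _); apply: ae_dotp => //; exact: ae_eq_refl.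
Qed.

Lemma rbv_ref1 : rbv (fun x => sq x * eta x) ref1L 1 0.
Proof.
have s1 := ref1_sol; have B1 := ref1_BV; have [wL _ _ _] := s1.
split => //; exists eta, ref1; split => //; exact: ae_eq_refl.
Qed.

Lemma rbv_ref2 : rbv (fun x => sq x * (eta x * ln x)) ref2L 0 1.
Proof.
have s1 := ref2_sol; have B1 := ref2_BV; have [wL _ _ _] := s1.
split => //; exists (fun x => eta x * ln x), ref2; split => //; exact: ae_eq_refl.
Qed.

Lemma rbv_test phi : rtest phi -> rbv phi (Lop phi) 0 0.
Proof.
move=> tp; have [w [p [sw Bw E]]] := test_sol tp.
split; first exact: rtest_rL2.
by exists w, p; split => //; apply: aeW => x; rewrite halflineE; exact: E.
Qed.

(** By Green's formula c1 and c2 are pairings with the two reference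
    functions. *)
Lemma rbv_uniq f g c1 c2 f' g' d1 d2 : rbv f g c1 c2 -> rbv f' g' d1 d2 ->
  ae_eq mu (halfline R) f f' -> ae_eq mu (halfline R) g g' -> c1 = d1 /\ c2 = d2.
Proof.
move=> h1 h2 ff' gg'.
have [fL gL] := rbv_L2 h1; have [fL' gL'] := rbv_L2 h2.
have [L1 L1'] := rbv_L2 rbv_ref1; have [L2 L2'] := rbv_L2 rbv_ref2.
have e1 : c1 * 0 - c2 * 1 = d1 * 0 - d2 * 1.
  rewrite -(rbv_green h1 rbv_ref1) -(rbv_green h2 rbv_ref1).
  rewrite (ae_dotp fL fL' L1' L1' ff' (ae_eq_refl _ _ _)).
  by rewrite (ae_dotp gL gL' L1 L1 gg' (ae_eq_refl _ _ _)).
have e2 : c1 * 1 - c2 * 0 = d1 * 1 - d2 * 0.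
  rewrite -(rbv_green h1 rbv_ref2) -(rbv_green h2 rbv_ref2).
  rewrite (ae_dotp fL fL' L2' L2' ff' (ae_eq_refl _ _ _)).
  by rewrite (ae_dotp gL gL' L2 L2 gg' (ae_eq_refl _ _ _)).
by split; lra.
Qed.

(** A pair (f', g') orthogonal to the graph of L on test functions satisfies L
    g' = - f' weakly. Green's formula for f, which has no boundary values,
    then makes (f', g') orthogonal to (f, g) itself. *)
Lemma L_core f g : rbv f g 0 0 -> approx2 (@VL R) f g.
Proof.
move=> h; have [fL gL] := rbv_L2 h.
have [f' [g' [fL' gL' orth app]]] := pair_projection (@VL_subspace R) fL gL.
have wk : weakL g' (fun x => - f' x).
  move=> phi tp; have := orth _ _ (VL_test tp).
  rewrite addrC => /eqP; rewrite addr_eq0 => /eqP; rewrite /dotp => ->.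
  rewrite -I_N; first by apply: eq_I => x _; ring.
  by apply: rL2_mul => //; exact: rtest_rL2.
have [d1 [d2 h']] := weakL_rbv gL' (rL2N fL') wk.
have G := rbv_green h h'; rewrite !mul0r subrr in G.
have fN : dotp f (fun x => - f' x) = - dotp f' f by rewrite dotpC dotpNl.
rewrite fN in G.
have O : dotp f' (fun x => f x - f' x) + dotp g' (fun x => g x - g' x) = 0.
  exact: (approx2_dotp (@VL_subspace R) (rL2B fL fL') (rL2B gL gL') fL' gL' app orth).
rewrite ![dotp _ (fun x => _ - _)]dotpC !dotpBl// in O.
rewrite [dotp f f']dotpC in O.
have N1 := dotp_ge0 f'; have N2 := dotp_ge0 g'.
have f0 : ae_eq mu (halfline R) f' (fun=> 0) by apply: dotp0 => //; lra.
have g0 : ae_eq mu (halfline R) g' (fun=> 0) by apply: dotp0 => //; lra.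
apply: (@approx2_ae _ (@VL R) (fun x => f x - f' x) (fun x => g x - g' x) f g
  (@VL_subspace R)) => //; try exact: rL2B.
- exact: ae_sub0 f0.
- exact: ae_sub0 g0.
Qed.

(** Boundary values are pairings by [rbv_green], hence pass to limits. *)
Lemma L_core_conv f g : rL2 f -> rL2 g -> approx2 (@VL R) f g -> rbv f g 0 0.
Proof.
move=> fL gL app.
have pair h h' d1 d2 : rbv h h' d1 d2 -> dotp h' f - dotp h g = 0.
  move=> hh; have [hL hL'] := rbv_L2 hh.
  rewrite -dotpNl//.
  apply: approx2_dotp (@VL_subspace R) fL gL hL' (rL2N hL) app _.
  move=> phi psi [tp [psiL psiE]].
  have := rbv_green hh (rbv_test tp); rewrite !mulr0 subrr dotpNl//.
  rewrite [dotp h psi](_ : _ = dotp h (Lop phi)); first by lra.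
  by apply: eq_I => x x0; rewrite psiE.
have wk : weakL f g.
  move=> phi tp; have := pair _ _ _ _ (rbv_test tp).
  by rewrite dotpC [dotp phi g]dotpC => /eqP; rewrite subr_eq0 => /eqP.
have [c1 [c2 h]] := weakL_rbv fL gL wk.
have e1 : 1 * c2 - 0 * c1 = 0.
  by rewrite -(rbv_green rbv_ref1 h) -opprB (pair _ _ _ _ rbv_ref1) oppr0.
have e2 : 0 * c2 - 1 * c1 = 0.
  by rewrite -(rbv_green rbv_ref2 h) -opprB (pair _ _ _ _ rbv_ref2) oppr0.
have c20 : c2 = 0 by lra.
have c10 : c1 = 0 by lra.
by move: h; rewrite c10 c20.
Qed.

End References.

(** * Positivity, self-adjointness and range of H0 *)

Section Resolvent.
Context {R : realType}.
Local Notation mu := (@lebesgue_measure R).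
Local Notation sq := (@Num.sqrt R).
Implicit Types (f g h k w p v q phi psi : R -> R) (x e c t : R).
Variable eta : R -> R.
Hypothesis eta_cut : cutoff eta.

Definition H0r f g := exists c, rbv f g c 0.

Lemma H0r_L2 f g : H0r f g -> rL2 f /\ rL2 g.
Proof. by move=> [c h]; exact: rbv_L2 h. Qed.

Lemma weakA_ae f k f' k' : rL2 f -> rL2 f' -> rL2 k -> rL2 k' ->
  ae_eq mu (halfline R) f f' -> ae_eq mu (halfline R) k k' ->
  weakA f k -> weakA f' k'.
Proof.
move=> fL fL' kL kL' ff' kk' H phi tp.
have tL := rtest_rL2 tp; have AL := rtest_rL2 (rtest_Aadj tp).
have := H _ tp.
rewrite -!/(dotp _ _) (ae_dotp fL fL' AL AL ff' (ae_eq_refl _ _ _)).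
by rewrite (ae_dotp kL kL' tL tL kk' (ae_eq_refl _ _ _)).
Qed.

Lemma H0r_form f g : H0r f g -> exists2 k, rL2 k & weakA f k /\ dotp k k = dotp f g.
Proof.
move=> [c [fL [w [p [sw Bw fw]]]]].
have [kL kk] := form_sol sw Bw; have [wL gL Dw Pp] := sw.
exists (fun x => sq x * x^-1 * p x) => //; split.
  apply: (@weakA_ae (fun x => sq x * w x) (fun x => sq x * x^-1 * p x)) => //.
  - exact: ae_eq_sym.
  - exact: ae_eq_refl.
  - by move=> phi tp; exact: (weakA_prim Dw (prim_contp Pp)).
by rewrite kk; apply: ae_dotp => //; [exact: ae_eq_sym|exact: ae_eq_refl].
Qed.

Lemma H0r_pos f g : H0r f g -> 0 <= dotp f g.
Proof. by move=> /H0r_form[k kL [_ <-]]; exact: dotp_ge0. Qed.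

Lemma H0r_sym f g f' g' : H0r f g -> H0r f' g' -> dotp f g' = dotp g f'.
Proof.
move=> [c h] [d h']; have := rbv_green h h'.
by rewrite mulr0 mul0r subrr => /eqP; rewrite subr_eq0 => /eqP.
Qed.

Lemma rbv_weakA f g k c1 c2 : rbv f g c1 c2 -> rL2 k -> weakA f k -> c2 = 0.
Proof.
move=> [fL [w [p [sw Bw fw]]]] kL wA; have [wL gL Dw Pp] := sw.
have cp := prim_contp Pp.
have kp : ae_eq mu (halfline R) k (fun x => sq x * x^-1 * p x).
  apply: (sol_weakA eta_cut Dw cp (loc_integ_rL2 kL)).
  by apply: (@weakA_ae f k) => //; exact: ae_eq_refl.
apply: (sol_c2_eq0 cp Bw); apply: ae_rL2 kp kL.
apply: contp_meas; apply: contp_M => //.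
by apply: contp_M; [exact: contp_sqrt|exact: contp_inv].
Qed.

Lemma H0r_subspace : subspace2 H0r.
Proof.
split.
- exact: H0r_L2.
- exists 0; have := rbv_Z 0 (rbv_ref1 eta_cut).
  by rewrite !mul0r; congr rbv; apply/funext => x; rewrite mul0r.
- move=> c f g f' g' [d h] [d' h']; exists (c * d + d').
  by have := rbv_D (rbv_Z c h) h'; rewrite mulr0 addr0.
Qed.

Lemma H0r_ref1 : H0r (fun x => sq x * eta x) (ref1L eta).
Proof. by exists 1; exact: rbv_ref1. Qed.

Lemma H0r_test phi : rtest phi -> H0r phi (Lop phi).
Proof. by move=> tp; exists 0; exact: rbv_test. Qed.

(** The pairing with the reference function sqrt x * eta of D(H0) detects c2. *)
Lemma H0r_selfadj f g : rL2 f -> rL2 g ->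
  (forall u v, H0r u v -> dotp f v = dotp g u) -> H0r f g.
Proof.
move=> fL gL H.
have wk : weakL f g by move=> phi tp; exact: (H _ _ (H0r_test tp)).
have [c1 [c2 h]] := weakL_rbv eta_cut fL gL wk.
have := rbv_green h (rbv_ref1 eta_cut); rewrite (H _ _ H0r_ref1) subrr.
by rewrite mulr0 mulr1 sub0r => /esym/eqP; rewrite oppr_eq0 => /eqP c20;
  exists c1; rewrite -c20.
Qed.

Lemma H0r_closed f g : rL2 f -> rL2 g -> approx2 H0r f g -> H0r f g.
Proof.
move=> fL gL app; apply: H0r_selfadj => // u v uv.
have [uL vL] := H0r_L2 uv.
have := approx2_dotp H0r_subspace fL gL vL (rL2N uL) app.
rewrite dotpNl// [dotp f v]dotpC [dotp g u]dotpC => H.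
apply/eqP; rewrite -subr_eq0; apply/eqP; apply: H => phi psi pp.
have [pL _] := H0r_L2 pp; have [_ psL] := H0r_L2 pp.
by rewrite dotpNl// (H0r_sym uv pp) subrr.
Qed.

Lemma dotp_lin3 (a b : R) f g h : rL2 f -> rL2 g -> rL2 h ->
  dotp (fun x => f x - a * g x + b * h x) (fun x => f x - a * g x + b * h x) =
  dotp f f + a ^+ 2 * dotp g g + b ^+ 2 * dotp h h
  - 2 * a * dotp f g + 2 * b * dotp f h - 2 * a * b * dotp g h.
Proof.
move=> fL gL hL.
have M u v : rL2 u -> rL2 v -> integ (fun x => u x * v x) by exact: rL2_mul.
rewrite /dotp -!I_Z; [|exact: M..].
have Z c u v : rL2 u -> rL2 v -> integ (fun x => c * (u x * v x)).
  by move=> uL vL; apply: integZ; exact: M.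
rewrite -I_D; [|exact: M|exact: Z].
have i1 := integD (M _ _ fL fL) (Z (a ^+ 2) _ _ gL gL).
rewrite -I_D; [|by []|exact: Z].
have i2 := integD i1 (Z (b ^+ 2) _ _ hL hL).
rewrite -I_B; [|by []|exact: Z].
have i3 := integB i2 (Z (2 * a) _ _ fL gL).
rewrite -I_D; [|by []|exact: Z].
have i4 := integD i3 (Z (2 * b) _ _ fL hL).
rewrite -I_B; [|by []|exact: Z].
by apply: eq_I => x _; ring.
Qed.

Section Onto.
Variables a b : R.
Hypotheses (a_le0 : a <= 0) (ab1 : a ^+ 2 + b ^+ 2 = 1).

(** The real and imaginary parts of (H0 - (a + i b)) (f1 + i f2). *)
Definition ran g1 g2 := exists f1 h1 f2 h2, [/\ H0r f1 h1, H0r f2 h2,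
  g1 = (fun x => h1 x - a * f1 x + b * f2 x) &
  g2 = (fun x => h2 x - a * f2 x + (- b) * f1 x)].

(** Let z = a + i b. Because H0 is symmetric and nonnegative and Re z <= 0,
    |(H0 - z) f| ^ 2 is at least |z| ^ 2 |f| ^ 2. *)
Lemma ran_lower f1 h1 f2 h2 : H0r f1 h1 -> H0r f2 h2 ->
  dotp f1 f1 + dotp f2 f2 <=
  dotp (fun x => h1 x - a * f1 x + b * f2 x) (fun x => h1 x - a * f1 x + b * f2 x) +
  dotp (fun x => h2 x - a * f2 x + (- b) * f1 x) (fun x => h2 x - a * f2 x + (- b) * f1 x).
Proof.
move=> H1 H2.
have [f1L h1L] := H0r_L2 H1; have [f2L h2L] := H0r_L2 H2.
rewrite !dotp_lin3// sqrrN.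
have p1 := H0r_pos H1; have p2 := H0r_pos H2; have s := H0r_sym H2 H1.
rewrite dotpC in p1; rewrite dotpC in p2; rewrite [dotp f2 h1]dotpC in s.
rewrite s [dotp f2 f1]dotpC.
have n1 := dotp_ge0 h1; have n2 := dotp_ge0 h2.
have q1 : a * dotp h1 f1 <= 0 by rewrite mulr_le0_ge0.
have q2 : a * dotp h2 f2 <= 0 by rewrite mulr_le0_ge0.
have : a ^+ 2 * dotp f1 f1 + b ^+ 2 * dotp f1 f1 = dotp f1 f1.
  by rewrite -mulrDl ab1 mul1r.
have : a ^+ 2 * dotp f2 f2 + b ^+ 2 * dotp f2 f2 = dotp f2 f2.
  by rewrite -mulrDl ab1 mul1r.
by move: (dotp f1 f1) (dotp f2 f2) (dotp f1 f2) => X Y Z; lra.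
Qed.

Lemma ran_subspace : subspace2 ran.
Proof.
have [HL H0 Hlin] := H0r_subspace.
split.
- move=> g1 g2 [f1 [h1 [f2 [h2 [H1 H2 -> ->]]]]].
  have [f1L h1L] := HL _ _ H1; have [f2L h2L] := HL _ _ H2.
  by split; apply: rL2D; try exact: rL2Z; apply: rL2B => //; exact: rL2Z.
- exists (fun=> 0), (fun=> 0), (fun=> 0), (fun=> 0); split => //;
    by apply/funext => x; ring.
- move=> c g1 g2 g1' g2' [f1 [h1 [f2 [h2 [H1 H2 -> ->]]]]].
  move=> [f1' [h1' [f2' [h2' [H1' H2' -> ->]]]]].
  exists (fun x => c * f1 x + f1' x), (fun x => c * h1 x + h1' x),
    (fun x => c * f2 x + f2' x), (fun x => c * h2 x + h2' x).
  split; [exact: Hlin|exact: Hlin|apply/funext => x; ring|apply/funext => x; ring].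
Qed.

(** A vector orthogonal to the range is an eigenvector of the self-adjoint
    operator H0, for the conjugate of z; but z is not in [0, oo). *)
Lemma ran_dense g1 g2 : rL2 g1 -> rL2 g2 -> approx2 ran g1 g2.
Proof.
move=> g1L g2L.
have [y1 [y2 [y1L y2L orth app]]] := pair_projection ran_subspace g1L g2L.
have [HL H0 Hlin] := H0r_subspace.
have dot0 u : dotp u (fun=> 0) = 0.
  by rewrite /dotp (@eq_I _ _ (fun=> 0)) ?I0// => x _; rewrite mulr0.
have A1 : H0r y1 (fun x => a * y1 x + b * y2 x).
  apply: H0r_selfadj => //; first by apply: rL2D; exact: rL2Z.
  move=> u v uv; have [uL vL] := HL _ _ uv.
  have : ran (fun x => v x - a * u x + b * 0) (fun x => 0 - a * 0 + (- b) * u x).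
    by exists u, v, (fun=> 0), (fun=> 0).
  move/orth.
  rewrite [dotp y1 _]dotpC [dotp y2 _]dotpC.
  rewrite (_ : (fun x => _ + b * 0) = (fun x => v x - a * u x)); last first.
    by apply/funext => x; ring.
  rewrite (_ : (fun x => 0 - _ + _) = (fun x => (- b) * u x)); last first.
    by apply/funext => x; ring.
  rewrite dotpBl ?dotpZl ?dotpDl ?dotpZl//; try exact: rL2Z.
  by rewrite ![dotp _ u]dotpC [dotp y1 v]dotpC; lra.
have A2 : H0r y2 (fun x => a * y2 x + (- b) * y1 x).
  apply: H0r_selfadj => //; first by apply: rL2D; exact: rL2Z.
  move=> u v uv; have [uL vL] := HL _ _ uv.
  have : ran (fun x => 0 - a * 0 + b * u x) (fun x => v x - a * u x + (- b) * 0).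
    by exists (fun=> 0), (fun=> 0), u, v.
  move/orth.
  rewrite [dotp y1 _]dotpC [dotp y2 _]dotpC.
  rewrite (_ : (fun x => _ + (- b) * 0) = (fun x => v x - a * u x)); last first.
    by apply/funext => x; ring.
  rewrite (_ : (fun x => 0 - _ + _) = (fun x => b * u x)); last first.
    by apply/funext => x; ring.
  rewrite dotpBl ?dotpZl ?dotpDl ?dotpZl//; try exact: rL2Z.
  by rewrite ![dotp _ u]dotpC [dotp y2 v]dotpC; lra.
have p1 := H0r_pos A1; have p2 := H0r_pos A2; have s := H0r_sym A1 A2.
move: p1 p2 s; rewrite ![dotp _ (fun x => _ + _)]dotpC.
rewrite !dotpDl ?dotpZl//; try exact: rL2Z.
rewrite [dotp y2 y1]dotpC.
have N1 := dotp_ge0 y1; have N2 := dotp_ge0 y2.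
move=> p1 p2 s.
have e1 : dotp y1 y1 + dotp y2 y2 = 0.
  move: N1 N2 p1 p2 s; move: (dotp y1 y1) (dotp y2 y2) (dotp y1 y2) => X Y Z.
  move=> X0 Y0 p1 p2 s.
  have bs : b * (X + Y) = 0 by lra.
  have as_ : 0 <= a * (X + Y) by lra.
  have : (a ^+ 2 + b ^+ 2) * (X + Y) = a * (a * (X + Y)) + b * (b * (X + Y)) by ring.
  rewrite ab1 bs mulr0 addr0 mul1r => e.
  have : a * (a * (X + Y)) <= 0 by rewrite mulr_le0_ge0.
  by lra.
have z1 : ae_eq mu (halfline R) y1 (fun=> 0) by apply: dotp0 => //; lra.
have z2 : ae_eq mu (halfline R) y2 (fun=> 0) by apply: dotp0 => //; lra.
apply: (@approx2_ae _ ran (fun x => g1 x - y1 x) (fun x => g2 x - y2 x) g1 g2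
  ran_subspace) => //; try exact: rL2B.
- exact: ae_sub0 z1.
- exact: ae_sub0 z2.
Qed.

End Onto.
End Resolvent.

(** * Solutions of L k = z k with a logarithmic part *)

Section ResolventOnto.
Context {R : realType}.
Local Notation mu := (@lebesgue_measure R).
Local Notation sq := (@Num.sqrt R).
Implicit Types (f g h k w p v q phi psi : R -> R) (x e c t : R).
Variable eta : R -> R.
Hypothesis eta_cut : cutoff eta.

Lemma dotp_add_le f g : rL2 f -> rL2 g ->
  dotp (fun x => f x + g x) (fun x => f x + g x) <= 2 * dotp f f + 2 * dotp g g.
Proof.
move=> fL gL; have sL := rL2D fL gL.
rewrite /dotp -!I_Z; [|exact: rL2_mul..].
rewrite -I_D; [|by apply: integZ; exact: rL2_mul..].
apply: le_I; [exact: rL2_mul|by apply: integD; apply: integZ; exact: rL2_mul|].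
by move=> x _; have := sqr_ge0 (f x - g x); lra.
Qed.

Lemma eq_dotp f f' g g' : (forall x, 0 < x -> f x = f' x) ->
  (forall x, 0 < x -> g x = g' x) -> dotp f g = dotp f' g'.
Proof. by move=> ff' gg'; apply: eq_I => x x0; rewrite ff'// gg'. Qed.

Lemma dotp_flip f h : rL2 f -> rL2 h ->
  dotp (fun x => f x - h x) (fun x => f x - h x) =
  dotp (fun x => h x - f x) (fun x => h x - f x).
Proof. by move=> fL hL; apply: eq_I => x _; ring. Qed.

Lemma dotp_scale_le (s : R) f : rL2 f -> s ^+ 2 <= 1 ->
  dotp (fun x => s * f x) (fun x => s * f x) <= dotp f f.
Proof.
move=> fL s1; rewrite (_ : dotp _ _ = s ^+ 2 * dotp f f).
  by rewrite ler_piMl// dotp_ge0.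
by rewrite /dotp -I_Z; [apply: eq_I => x _; ring|exact: rL2_mul].
Qed.

Lemma residual_le c d f F h G g v K : c ^+ 2 <= 1 -> d ^+ 2 <= 1 ->
  rL2 f -> rL2 F -> rL2 h -> rL2 G -> rL2 g -> rL2 v ->
  (forall x, 0 < x -> K x = v x + c * F x - d * G x) ->
  dotp (fun x => g x + c * f x - d * h x - K x)
       (fun x => g x + c * f x - d * h x - K x) <=
  2 * dotp (fun x => g x - v x) (fun x => g x - v x) +
  4 * dotp (fun x => F x - f x) (fun x => F x - f x) +
  4 * dotp (fun x => G x - h x) (fun x => G x - h x).
Proof.
move=> c1 d1 fL FL hL GL gL vL KE.
have E x : 0 < x -> g x + c * f x - d * h x - K x =
    (g x - v x) + (c * (f x - F x) + (- d) * (h x - G x)).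
  by move=> x0; rewrite KE//; ring.
rewrite (eq_dotp E E).
have L1 := rL2Z c (rL2B fL FL); have L2 := rL2Z (- d) (rL2B hL GL).
apply: (le_trans (dotp_add_le (rL2B gL vL) (rL2D L1 L2))).
have h1 := dotp_add_le L1 L2.
have h2 := dotp_scale_le (rL2B fL FL) c1.
have dN : (- d) ^+ 2 <= 1 by rewrite sqrrN.
have h3 := dotp_scale_le (rL2B hL GL) dN.
rewrite (dotp_flip FL fL) (dotp_flip GL hL).
by lra.
Qed.

Let lt_quarters (X Y e : R) : X < e / 4 -> Y < e / 4 -> 2 * X + 2 * Y < e.
Proof. lra. Qed.

Section Onto.
Variables a b : R.
Hypotheses (a_le0 : a <= 0) (ab1 : a ^+ 2 + b ^+ 2 = 1).

(** By [ran_lower] the preimages of a convergent sequence of the range form a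
    Cauchy sequence, and H0 is closed; hence the range is closed as well as
    dense. *)
Lemma ran_onto g1 g2 : rL2 g1 -> rL2 g2 -> exists f1 f2,
  H0r f1 (fun x => g1 x + a * f1 x - b * f2 x) /\
  H0r f2 (fun x => g2 x + a * f2 x + b * f1 x).
Proof.
move=> g1L g2L.
have den := ran_dense eta_cut a_le0 ab1 g1L g2L.
have Hn (n : nat) : exists f1 h1 f2 h2, [/\ H0r f1 h1, H0r f2 h2 &
   dotp (fun x => g1 x - (h1 x - a * f1 x + b * f2 x))
        (fun x => g1 x - (h1 x - a * f1 x + b * f2 x)) +
   dotp (fun x => g2 x - (h2 x - a * f2 x + (- b) * f1 x))
        (fun x => g2 x - (h2 x - a * f2 x + (- b) * f1 x)) < n.+1%:R^-1].
  have n0 : 0 < (n.+1%:R : R)^-1 by rewrite invr_gt0 ltr0n.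
  have [phi [psi [[f1 [h1 [f2 [h2 [H1 H2 -> ->]]]]] h]]] := den _ n0.
  by exists f1, h1, f2, h2.
have /choice[F1 H] := Hn; have /choice[K1 {}H] := H.
have /choice[F2 {}H] := H; have /choice[K2 {}H] := H.
pose v1 n x := K1 n x - a * F1 n x + b * F2 n x.
pose v2 n x := K2 n x - a * F2 n x + (- b) * F1 n x.
have HF1 n : H0r (F1 n) (K1 n) by case: (H n).
have HF2 n : H0r (F2 n) (K2 n) by case: (H n).
have F1L n : rL2 (F1 n) by have [] := H0r_L2 (HF1 n).
have F2L n : rL2 (F2 n) by have [] := H0r_L2 (HF2 n).
have K1L n : rL2 (K1 n) by have [] := H0r_L2 (HF1 n).
have K2L n : rL2 (K2 n) by have [] := H0r_L2 (HF2 n).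
have v1L n : rL2 (v1 n) by apply: rL2D; [apply: rL2B => //|]; exact: rL2Z.
have v2L n : rL2 (v2 n) by apply: rL2D; [apply: rL2B => //|]; exact: rL2Z.
pose er n := dotp (fun x => g1 x - v1 n x) (fun x => g1 x - v1 n x) +
  dotp (fun x => g2 x - v2 n x) (fun x => g2 x - v2 n x).
have erE n : er n < n.+1%:R^-1 by case: (H n).
have er0 n : 0 <= er n by rewrite addr_ge0// dotp_ge0.
have small e : 0 < e -> exists M : nat, forall n, (M <= n)%N -> er n < e.
  move=> e0; have : \forall n \near \oo, (n.+1%:R^-1 : R) < e.
    by apply: (cvgr_lt (0 : R)) => //; exact: cvg_harmonic.
  by case=> M _ HM; exists M => n Mn; apply: lt_trans (erE n) (HM n Mn).
have cau m n : dotp (fun x => F1 m x - F1 n x) (fun x => F1 m x - F1 n x) +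
    dotp (fun x => F2 m x - F2 n x) (fun x => F2 m x - F2 n x) <= 2 * er m + 2 * er n.
  have [_ _ Hlin] := H0r_subspace eta_cut.
  have sub f h f' h' : H0r f h -> H0r f' h' ->
      H0r (fun x => f x - f' x) (fun x => h x - h' x).
    move=> h1 h2; have := Hlin (-1) _ _ _ _ h2 h1.
    by congr H0r; apply/funext => x; ring.
  have := ran_lower a_le0 ab1 (sub _ _ _ _ (HF1 m) (HF1 n))
    (sub _ _ _ _ (HF2 m) (HF2 n)).
  move/le_trans; apply.
  have d1 := dotp_add_le (rL2B g1L (v1L n)) (rL2N (rL2B g1L (v1L m))).
  have d2 := dotp_add_le (rL2B g2L (v2L n)) (rL2N (rL2B g2L (v2L m))).
  have NN f : rL2 f -> dotp (fun x => - f x) (fun x => - f x) = dotp f f.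
    by move=> fL; apply: eq_I => x _; rewrite mulrNN.
  rewrite NN in d1; last exact: rL2B.
  rewrite NN in d2; last exact: rL2B.
  rewrite [X in X + _ <= _](@eq_dotp _ (fun x => g1 x - v1 n x + - (g1 x - v1 m x))
    _ (fun x => g1 x - v1 n x + - (g1 x - v1 m x))); last 2 first.
  - by move=> x _; rewrite /v1; ring.
  - by move=> x _; rewrite /v1; ring.
  rewrite [X in _ + X <= _](@eq_dotp _ (fun x => g2 x - v2 n x + - (g2 x - v2 m x))
    _ (fun x => g2 x - v2 n x + - (g2 x - v2 m x))); last 2 first.
  - by move=> x _; rewrite /v2; ring.
  - by move=> x _; rewrite /v2; ring.
  by apply: (le_trans (lerD d1 d2)); rewrite /er; lra.
have cauchy e : 0 < e -> exists N : nat, forall m n, (N <= m)%N -> (N <= n)%N ->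
    2 * er m + 2 * er n < e.
  move=> e0; have e4 : 0 < e / 4 by rewrite divr_gt0.
  have [N HN] := small _ e4; by exists N => m n /HN h1 /HN h2; exact: lt_quarters.
have [|f1 [f1L c1]] := rL2_complete F1L.
  move=> e e0; have [N HN] := cauchy e e0; exists N => m n Nm Nn.
  apply: le_lt_trans (HN m n Nm Nn); apply: le_trans (cau m n).
  by rewrite lerDl dotp_ge0.
have [|f2 [f2L c2]] := rL2_complete F2L.
  move=> e e0; have [N HN] := cauchy e e0; exists N => m n Nm Nn.
  apply: le_lt_trans (HN m n Nm Nn); apply: le_trans (cau m n).
  by rewrite lerDr dotp_ge0.
have a1 : a ^+ 2 <= 1 by rewrite -ab1 lerDl sqr_ge0.
have b1 : b ^+ 2 <= 1 by rewrite -ab1 lerDr sqr_ge0.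
have KE1 n x : 0 < x -> K1 n x = v1 n x + a * F1 n x - b * F2 n x.
  by move=> _; rewrite /v1; ring.
have KE2 n x : 0 < x -> K2 n x = v2 n x + a * F2 n x - (- b) * F1 n x.
  by move=> _; rewrite /v2; ring.
have bN : (- b) ^+ 2 <= 1 by rewrite sqrrN.
have good e : 0 < e -> exists n, [/\
    dotp (fun x => F1 n x - f1 x) (fun x => F1 n x - f1 x) < e,
    dotp (fun x => F2 n x - f2 x) (fun x => F2 n x - f2 x) < e & er n < e].
  move=> e0; have [N1 h1] := c1 _ e0; have [N2 h2] := c2 _ e0.
  have [N3 h3] := small _ e0; exists (maxn N1 (maxn N2 N3)); split.
  - exact: h1 (leq_maxl _ _).
  - exact: h2 (leq_trans (leq_maxl _ _) (leq_maxr _ _)).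
  - exact: h3 (leq_trans (leq_maxr _ _) (leq_maxr _ _)).
exists f1, f2; split; apply: (H0r_closed eta_cut) => //.
- by apply: rL2B; [apply: rL2D => //|]; exact: rL2Z.
- move=> e e0; have e10 : 0 < e / 12 by rewrite divr_gt0.
  have [n [h1 h2 h3]] := good _ e10.
  exists (F1 n), (K1 n); split; first exact: HF1.
  have := residual_le a1 b1 f1L (F1L n) f2L (F2L n) g1L (v1L n) (KE1 n).
  rewrite (dotp_flip f1L (F1L n)).
  have := dotp_ge0 (fun x => g2 x - v2 n x); rewrite /er in h3.
  by lra.
- by apply: rL2D; [apply: rL2D => //|]; exact: rL2Z.
- move=> e e0; have e10 : 0 < e / 12 by rewrite divr_gt0.
  have [n [h1 h2 h3]] := good _ e10.
  exists (F2 n), (K2 n); split; first exact: HF2.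
  have := residual_le a1 bN f2L (F2L n) f1L (F1L n) g2L (v2L n) (KE2 n).
  rewrite (dotp_flip f2L (F2L n)).
  have E x : 0 < x -> g2 x + a * f2 x + b * f1 x - K2 n x =
     g2 x + a * f2 x - - b * f1 x - K2 n x by move=> _; ring.
  rewrite (eq_dotp E E).
  have := dotp_ge0 (fun x => g1 x - v1 n x); rewrite /er in h3.
  by lra.
Qed.

(** The reference function u with boundary values (0, 1) is corrected by an
    element of D(H0): k = u - (H0 - z)^-1 (L - z) u. *)
Lemma kernel_exists : exists k1 k2 c1 c2,
  rbv k1 (fun x => a * k1 x - b * k2 x) c1 1 /\
  rbv k2 (fun x => a * k2 x + b * k1 x) c2 0.
Proof.
pose u x := sq x * (eta x * ln x).
have hu : rbv u (ref2L eta) 0 1 := rbv_ref2 eta_cut.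
have [uL uL'] := rbv_L2 hu.
have [f1 [f2 [[c1 H1] [c2 H2]]]] := ran_onto (rL2B uL' (rL2Z a uL)) (rL2Z (- b) uL).
exists (fun x => u x - f1 x), (fun x => -1 * f2 x), (0 - c1), (-1 * c2); split.
  have := rbv_B hu H1; rewrite subr0; congr rbv; apply/funext => x; ring.
have := rbv_Z (-1) H2; rewrite mulr0; congr rbv; apply/funext => x; ring.
Qed.

End Onto.

(** If L f = - f, then x |-> f (kappa x) solves L h = - kappa ^ 2 h, and ln
    (kappa x) = ln kappa + ln x moves the ratio c1 / c2 by ln kappa, so that
    every real ratio is attained. *)
Lemma eigen_dilation t : exists (kappa : R) f,
  0 < kappa /\ rbv f (fun x => - (kappa ^+ 2) * f x) t 1.
Proof.
have m1 : (-1 : R) <= 0 by lra.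
have mm : (-1 : R) ^+ 2 + 0 ^+ 2 = 1 by rewrite sqrrN expr1n expr0n addr0.
have [k1 [k2 [t0 [c2 [[kL [w [p [sw Bw kw]]]] _]]]]] := kernel_exists m1 mm.
have [wL gL Dw Pp] := sw.
have {}Pp : is_prim p (fun x => x * w x).
  have cw := hasD_contp Dw.
  have lxw : loc_integ (fun x => x * w x).
    by apply: loc_integ_contp; apply: contp_M => //; exact: contp_id.
  apply: prim_ae lxw _ Pp; apply: filterS kw => x H xhl.
  have x0 : 0 < x by rewrite -halflineE.
  rewrite H//; transitivity (sq x * sq x * w x); first by ring.
  by rewrite sqr_sq.
have cw := hasD_contp Dw.
have cxw : contp (fun x => x * w x) by apply: contp_M => //; exact: contp_id.
have Dp := prim_hasD Pp cxw.
pose K := expR (t - t0); have K0 : 0 < K := expR_gt0 _.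
have lK : ln K = t - t0 by exact: expRK.
have Kx x : 0 < x -> 0 < K * x by move=> x0; rewrite mulr_gt0.
pose W x := w (K * x); pose P x := p (K * x).
have DK : hasD (fun x => K * x) (fun=> K).
  by apply: hasD_eq (hasD_Z K hasD_id) => x _; rewrite mulr1.
have DW : hasD W (fun x => P x / x).
  apply: hasD_eq (hasD_comp Kx Dw DK) => x x0; rewrite /P.
  by field; rewrite !gt_eqF.
have DP : hasD P (fun x => K ^+ 2 * (x * W x)).
  by apply: hasD_eq (hasD_comp Kx Dp DK) => x x0; rewrite /W; ring.
have cW := hasD_contp DW.
pose h x := x * w x ^+ 2.
have hi : integ h.
  apply: eq_integ wL.2 => x x0.
  by rewrite exprMn sqr_sqrtr ?(ltW x0).
have ch : contp h.
  apply: contp_M; first exact: contp_id.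
  by apply: (eq_contp (f := fun x => w x * w x)) => [x _|];
    [rewrite expr2|exact: contp_M].
have h0 x : 0 < x -> 0 <= h x by move=> x0; rewrite mulr_ge0 ?sqr_ge0 ?(ltW x0).
have [Q HQ] := prim_exists (loc_integ_contp ch).
have DQ := prim_hasD HQ ch.
have chK : contp (fun x => h (K * x)).
  have DhK := hasD_comp Kx; apply: contp_M.
    by apply: contp_M; [exact: contp_cst|exact: contp_id].
  by apply: (eq_contp (f := fun x => W x * W x)) => [x _|];
    [rewrite expr2|exact: contp_M].
have PQ : is_prim (fun x => K^-1 * Q (K * x)) (fun x => h (K * x)).
  apply: hasD_prim => //.
  apply: hasD_eq (hasD_Z K^-1 (hasD_comp Kx DQ DK)) => x x0.
  by field; rewrite gt_eqF.
have hKi : integ (fun x => h (K * x)).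
  apply: (@bounded_integ _ _ (K^-1 * I h)); first exact: loc_integ_contp.
    by move=> x x0; exact: h0 (Kx _ x0).
  move=> a b a0 ab; rewrite -PQ.2// -mulrBr ler_pM2l ?invr_gt0//.
  rewrite HQ.2 ?Kx// ?ler_pM2l//.
  by apply: IntI_le_I => //; exact: Kx.
have WL : rL2 (fun x => sq x * W x).
  split.
    by apply: contp_meas; apply: contp_M => //; exact: contp_sqrt.
  apply: eq_integ (integZ K^-1 hKi) => x x0.
  rewrite exprMn sqr_sqrtr ?(ltW x0)// /h /W.
  by field; rewrite gt_eqF.
exists K, (fun x => sq x * W x); split => //; split => //.
exists W, P; split; last exact: ae_eq_refl.
- split => //; first exact: rL2Z.
  apply: eq_prim (hasD_prim DP _) => // [x x0|].
    transitivity (K ^+ 2 * (sq x * sq x * W x)); last by ring.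
    by rewrite sqr_sq.
  apply: contp_M; first exact: contp_cst.
  by apply: contp_M => //; exact: contp_id.
- have [C HC] := Bw; exists (C * K) => x x0; rewrite -mulrA.
  have [h1 h2] := HC _ (Kx _ x0); split => //.
  rewrite (_ : W x - t - 1 * ln x = w (K * x) - t0 - 1 * ln (K * x))//.
  by rewrite lnM ?posrE// lK /W; ring.
Qed.

End ResolventOnto.

(** * Real and imaginary parts *)

Ltac gen_dotp :=
  repeat match goal with |- context [dotp ?a ?b] => generalize (dotp a b); intro end.

Section ComplexParts.
Local Open Scope complex_scope.
Context {R : realType}.
Local Notation mu := (@lebesgue_measure R).
Local Notation C := R[i].
Local Notation Re := complex.Re.
Local Notation Im := complex.Im.
Implicit Types (f g h k phi psi : R -> C) (c d z : C) (x e : R).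

Lemma complexP (z1 z2 : C) : Re z1 = Re z2 -> Im z1 = Im z2 -> z1 = z2.
Proof. by case: z1 z2 => a b [a' b'] /= -> ->. Qed.

Lemma ReM (z1 z2 : C) : Re (z1 * z2) = Re z1 * Re z2 - Im z1 * Im z2.
Proof. by case: z1 z2 => a b [a' b']. Qed.
Lemma ImM (z1 z2 : C) : Im (z1 * z2) = Re z1 * Im z2 + Im z1 * Re z2.
Proof. by case: z1 z2 => a b [a' b']. Qed.
Lemma ReD (z1 z2 : C) : Re (z1 + z2) = Re z1 + Re z2.
Proof. by case: z1 z2 => a b [a' b']. Qed.
Lemma ImD (z1 z2 : C) : Im (z1 + z2) = Im z1 + Im z2.
Proof. by case: z1 z2 => a b [a' b']. Qed.
Lemma ReN z : Re (- z) = - Re z. Proof. by case: z. Qed.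
Lemma ImN z : Im (- z) = - Im z. Proof. by case: z. Qed.
Lemma ReJ z : Re (z^*) = Re z. Proof. by case: z. Qed.
Lemma ImJ z : Im (z^*) = - Im z. Proof. by case: z. Qed.
Lemma ReC x : Re x%:C = x. Proof. by []. Qed.
Lemma ImC x : Im x%:C = 0. Proof. by []. Qed.
Lemma Re0 : Re (0 : C) = 0. Proof. by []. Qed.
Lemma Im0 : Im (0 : C) = 0. Proof. by []. Qed.
Lemma Re1 : Re (1 : C) = 1. Proof. by []. Qed.
Lemma Im1 : Im (1 : C) = 0. Proof. by []. Qed.
Lemma ReMk (a b : R) : Re (a +i* b) = a. Proof. by []. Qed.
Lemma ImMk (a b : R) : Im (a +i* b) = b. Proof. by []. Qed.
Lemma Rei : Re ('i : C) = 0. Proof. by []. Qed.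
Lemma Imi : Im ('i : C) = 1. Proof. by []. Qed.
Definition cE := (ReMk, ImMk, Rei, Imi, ReM, ImM, ReD, ImD, ReN, ImN, ReJ, ImJ, ReC, ImC, Re0, Im0, Re1, Im1).

Lemma L2P f : L2 f <-> rL2 (Rpart f) /\ rL2 (Ipart f).
Proof.
have nn x : (0 <= (Rpart f x ^+ 2 + Ipart f x ^+ 2)%:E)%E.
  by rewrite lee_fin addr_ge0// sqr_ge0.
split=> [[mr mi fin]|[[mr ir] [mi ii]]].
  have : integ (fun x => Rpart f x ^+ 2 + Ipart f x ^+ 2).
    apply/integrableP; split.
      by apply/measurable_EFinP; apply: measurable_funD; exact: measurable_funX.
    apply: le_lt_trans fin; rewrite le_eqVlt; apply/orP; left; apply/eqP.
    by apply: eq_integral => x _; rewrite /= ger0_norm// addr_ge0// sqr_ge0.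
  move=> isum; split; split => //; apply: le_integ isum.
  - exact: measurable_funX.
  - by move=> x _; rewrite ger0_norm ?sqr_ge0// lerDl sqr_ge0.
  - exact: measurable_funX.
  - by move=> x _; rewrite ger0_norm ?sqr_ge0// lerDr sqr_ge0.
split => //.
have /integrableP[_] : integ (fun x => Rpart f x ^+ 2 + Ipart f x ^+ 2) by exact: integD.
apply: le_lt_trans; rewrite le_eqVlt; apply/orP; left; apply/eqP.
by apply: eq_integral => x _; rewrite /= ger0_norm// addr_ge0// sqr_ge0.
Qed.

Lemma innerE f g : L2 f -> L2 g -> inner f g =
  (dotp (Rpart f) (Rpart g) + dotp (Ipart f) (Ipart g)) +i*
  (dotp (Rpart f) (Ipart g) - dotp (Ipart f) (Rpart g)).
Proof.
move=> /L2P[fr fi] /L2P[gr gi]; apply: complexP => /=.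
  rewrite /dotp -I_D; [|exact: rL2_mul..].
  by apply: eq_I => x _; rewrite /Rpart cE /Ipart !cE; ring.
rewrite /dotp -I_B; [|exact: rL2_mul..].
by apply: eq_I => x _; rewrite /Rpart /Ipart !cE; ring.
Qed.

Definition sqnorm f : R := dotp (Rpart f) (Rpart f) + dotp (Ipart f) (Ipart f).

Lemma sqnorm_ge0 f : 0 <= sqnorm f.
Proof. by rewrite addr_ge0// dotp_ge0. Qed.

Lemma norm2E f : L2 f -> norm2 f = Num.sqrt (sqnorm f).
Proof. by move=> fL; rewrite /norm2 innerE. Qed.

Lemma norm2_lt f e : L2 f -> 0 < e -> (norm2 f < e) = (sqnorm f < e ^+ 2).
Proof.
move=> fL e0; rewrite norm2E// -{1}(gtr0_norm e0) -sqrtr_sqr ltr_sqrt//.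
by rewrite exprn_gt0.
Qed.

Lemma sqr_norm2 f : L2 f -> norm2 f ^+ 2 = sqnorm f.
Proof. by move=> fL; rewrite norm2E// sqr_sqrtr// sqnorm_ge0. Qed.

Lemma eqL2P f g : eqL2 f g <-> ae_eq mu (halfline R) (Rpart f) (Rpart g) /\
  ae_eq mu (halfline R) (Ipart f) (Ipart g).
Proof.
split=> [fg|[h1 h2]].
  by split; apply: filterS fg => x H /H; rewrite /Rpart /Ipart => ->.
by apply: filterS2 h1 h2 => x H1 H2 xhl; apply: complexP; [exact: H1|exact: H2].
Qed.

Lemma inner_eqL2 f f' g g' : L2 f -> L2 f' -> L2 g -> L2 g' ->
  eqL2 f f' -> eqL2 g g' -> inner f g = inner f' g'.
Proof.
move=> fL fL' gL gL' /eqL2P[fr fi] /eqL2P[gr gi]; rewrite !innerE//.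
move/L2P: fL => [? ?]; move/L2P: fL' => [? ?].
move/L2P: gL => [? ?]; move/L2P: gL' => [? ?].
rewrite (ae_dotp _ _ _ _ fr gr)// (ae_dotp _ _ _ _ fi gi)//.
by rewrite (ae_dotp _ _ _ _ fr gi)// (ae_dotp _ _ _ _ fi gr).
Qed.

Lemma sqnorm0 f : L2 f -> sqnorm f = 0 -> eqL2 f (fun=> 0).
Proof.
move=> /L2P[fr fi]; rewrite /sqnorm => f0.
have n1 := dotp_ge0 (Rpart f); have n2 := dotp_ge0 (Ipart f).
by apply/eqL2P; split; apply: dotp0 => //; lra.
Qed.

Lemma L2_lin c f g : L2 f -> L2 g -> L2 (scale c f \+ g).
Proof.
move=> /L2P[fr fi] /L2P[gr gi]; apply/L2P; split.
  apply: (@eq_rL2 _ (fun x => (Re c * Rpart f x - Im c * Ipart f x) + Rpart g x)).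
    by move=> x _; rewrite /Rpart /Ipart /scale /= !cE.
  by apply: rL2D => //; apply: rL2B; exact: rL2Z.
apply: (@eq_rL2 _ (fun x => (Re c * Ipart f x + Im c * Rpart f x) + Ipart g x)).
  by move=> x _; rewrite /Rpart /Ipart /scale /= !cE.
by apply: rL2D => //; apply: rL2D; exact: rL2Z.
Qed.

Lemma L2_B f g : L2 f -> L2 g -> L2 (f \- g).
Proof.
move=> /L2P[fr fi] /L2P[gr gi]; apply/L2P; split.
  by apply: eq_rL2 (rL2B fr gr) => x _; rewrite /Rpart /= !cE.
by apply: eq_rL2 (rL2B fi gi) => x _; rewrite /Ipart /= !cE.
Qed.

Lemma sqnormB f g : sqnorm (f \- g) =
  dotp (fun x => Rpart f x - Rpart g x) (fun x => Rpart f x - Rpart g x) +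
  dotp (fun x => Ipart f x - Ipart g x) (fun x => Ipart f x - Ipart g x).
Proof.
by congr (_ + _); apply: eq_I => x _; rewrite /Rpart /Ipart /= !cE.
Qed.

Lemma L2_0 : L2 (fun=> 0 : C).
Proof. by apply/L2P; split; exact: rL2_0. Qed.

Lemma L2_mk (a b : R -> R) : rL2 a -> rL2 b -> L2 (fun x => a x +i* b x).
Proof. by move=> aL bL; apply/L2P. Qed.

Lemma test_parts phi : test_function phi -> rtest (Rpart phi) /\ rtest (Ipart phi).
Proof.
move=> [s [a [b [a0 p0]]]]; split.
- split; first by move=> n x x0; case: (s n x x0).
  by exists a, b; split => // x /p0; rewrite /Rpart => ->.
- split; first by move=> n x x0; case: (s n x x0).
  by exists a, b; split => // x /p0; rewrite /Ipart => ->.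
Qed.

Lemma test_mk (a b : R -> R) : rtest a -> rtest b -> test_function (fun x => a x +i* b x).
Proof.
move=> [sa [a1 [b1 [a10 H1]]]] [sb [a2 [b2 [a20 H2]]]]; split.
  by move=> n x x0; split; [exact: sa|exact: sb].
exists (Num.min a1 a2), (Num.max b1 b2); split; first by rewrite lt_min a10.
move=> x xab; rewrite H1 ?H2// => /andP[h1 h2]; apply: xab.
- by rewrite ge_min h1 orbT le_max h2 orbT.
- by rewrite ge_min h1 le_max h2.
Qed.

Lemma test_L2 phi : test_function phi -> L2 phi.
Proof. by move=> /test_parts[t1 t2]; apply/L2P; split; exact: rtest_rL2. Qed.

Lemma dist_ofE f (a b : R -> R) phi : L2 f -> rL2 a -> rL2 b ->
  (forall x, 0 < x -> Re (phi x) = a x) -> (forall x, 0 < x -> Im (phi x) = b x) ->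
  dist_of f phi = (dotp (Rpart f) a - dotp (Ipart f) b) +i*
                  (dotp (Rpart f) b + dotp (Ipart f) a).
Proof.
move=> /L2P[fr fi] aL bL pa pb; apply: complexP => /=.
  rewrite /dotp -I_B; [|exact: rL2_mul..].
  by apply: eq_I => x x0; rewrite /Rpart /Ipart !cE pa// pb.
rewrite /dotp -I_D; [|exact: rL2_mul..].
by apply: eq_I => x x0; rewrite /Rpart /Ipart !cE pa// pb.
Qed.

Lemma complex_inv4 : (- 4^-1 : C) = (- 4^-1 : R)%:C.
Proof. by rewrite rmorphN fmorphV /= rmorph_nat. Qed.

Lemma rtest_inv2 (a : R -> R) : rtest a -> rtest (fun x => x ^- 2 * a x).
Proof.
move=> ta; rewrite (_ : (fun x => _) = (fun x => (x^-1 * x^-1) * a x)).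
  by apply: rtest_M => //; apply: smooth_M; exact: smooth_inv.
by apply/funext => x; rewrite expr2 invfM.
Qed.

Lemma dotp_Lop (a phi : R -> R) : rL2 a -> rtest phi ->
  dotp a (Lop phi) = - dotp a ((phi^`()^`())%classic) -
     4^-1 * dotp a (fun x => x ^- 2 * phi x).
Proof.
move=> aL tp.
have t2 := rtest_derive (rtest_derive tp).
have t3 := rtest_inv2 tp.
have i2 := rL2_mul aL (rtest_rL2 t2); have i3 := rL2_mul aL (rtest_rL2 t3).
rewrite /dotp -I_N// -I_Z// -I_B//; first by apply: eq_I => x _; rewrite /Lop; ring.
- exact: integN.
- exact: integZ.
Qed.

Lemma L0_distE f phi : L2 f -> test_function phi ->
  L0_dist (dist_of f) phi =
  (dotp (Rpart f) (Lop (Rpart phi)) - dotp (Ipart f) (Lop (Ipart phi))) +i*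
  (dotp (Rpart f) (Lop (Ipart phi)) + dotp (Ipart f) (Lop (Rpart phi))).
Proof.
move=> fL tp; have [tr ti] := test_parts tp; have [fr fi] := (L2P f).1 fL.
have t2 a : rtest a -> rL2 ((a^`()^`())%classic : R -> R).
  by move=> ta; apply: rtest_rL2; do 2 apply: rtest_derive.
have t3 a : rtest a -> rL2 (fun x : R => x ^- 2 * a x).
  by move=> ta; apply: rtest_rL2; exact: rtest_inv2.
rewrite /L0_dist /dist_add /dist_scale /dist_deriv /dist_mul.
rewrite (@dist_ofE f _ _ (cderiv (cderiv phi)) fL (t2 _ tr) (t2 _ ti))//.
rewrite (@dist_ofE f _ _ (fun x => (x ^- 2)%:C * phi x) fL (t3 _ tr) (t3 _ ti)); last 2 first.
- by move=> x _; rewrite !cE mul0r subr0.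
- by move=> x _; rewrite !cE mul0r addr0.
rewrite complex_inv4 !dotp_Lop//.
by apply: complexP; rewrite !cE; gen_dotp; ring.
Qed.

Lemma eqD_parts (T S : Defs.distribution R) :
  eqD T S <-> forall a b : R -> R, rtest a -> rtest b ->
     T (fun x => a x +i* b x) = S (fun x => a x +i* b x).
Proof.
split=> [H a b ta tb|H phi tp]; first by apply: H; exact: test_mk.
have [tr ti] := test_parts tp.
have -> : phi = (fun x => Rpart phi x +i* Ipart phi x).
  by apply/funext => x; apply: complexP.
exact: H.
Qed.

Lemma dotp_0r (a : R -> R) : dotp a (fun=> 0) = 0.
Proof. by rewrite /dotp (@eq_I _ _ (fun=> 0)) ?I0// => x _; rewrite mulr0. Qed.

Lemma dotp_Lop0 (a : R -> R) : dotp a (Lop (fun=> 0)) = 0.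
Proof.
have D1 : hasD ((fun=> 0 : R)^`()%classic) (fun=> 0).
  apply: (eq_hasD _ _ (@hasD_cst R 0)) => // y y0.
  by rewrite (hasD_derive1 (hasD_cst 0)).
rewrite /dotp (@eq_I _ _ (fun=> 0)) ?I0// => x x0.
by rewrite /Lop (hasD_derive1 D1)// mulr0 subr0 oppr0 mulr0.
Qed.

(** L has real coefficients, hence acts on real and imaginary parts
    separately. *)
Lemma L0maxP f g : L0max R (f, g) <->
  [/\ L2 f, L2 g, weakL (Rpart f) (Rpart g) & weakL (Ipart f) (Ipart g)].
Proof.
split=> [[/= fL gL /eqD_parts H]|[fL gL Hr Hi]].
  have key (a : R -> R) : rtest a ->
      dotp (Rpart f) (Lop a) = dotp (Rpart g) a /\
      dotp (Ipart f) (Lop a) = dotp (Ipart g) a.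
    move=> ta; have t0 : rtest (fun=> 0 : R) := rtest0.
    have := H _ _ ta t0; rewrite L0_distE//; last exact: test_mk.
    rewrite (@dist_ofE g a (fun=> 0) _ gL (rtest_rL2 ta) rL2_0)//.
    by rewrite !dotp_Lop0 !dotp_0r !subr0 !add0r => -[-> ->].
  by split => // a ta; have [] := key a ta.
split => //=; apply/eqD_parts => a b ta tb.
rewrite L0_distE//; last exact: test_mk.
rewrite (@dist_ofE g a b _ gL (rtest_rL2 ta) (rtest_rL2 tb))//.
have E1 : dotp (Rpart f) (Lop a) = dotp (Rpart g) a := Hr _ ta.
have E2 : dotp (Rpart f) (Lop b) = dotp (Rpart g) b := Hr _ tb.
have E3 : dotp (Ipart f) (Lop a) = dotp (Ipart g) a := Hi _ ta.
have E4 : dotp (Ipart f) (Lop b) = dotp (Ipart g) b := Hi _ tb.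
by rewrite (_ : Rpart (fun x => a x +i* b x) = a)// (_ : Ipart (fun x => a x +i* b x) = b)// E1 E2 E3 E4.
Qed.

(** Up to a sign, the transpose of d / dx - 1 / (2 x). *)
Definition Astar (a : R -> R) x := a^`()%classic x + (2 * x)^-1 * a x.

Lemma A_distE f phi : L2 f -> test_function phi ->
  A_half_dist (dist_of f) phi =
  'i * ((dotp (Rpart f) (Astar (Rpart phi)) - dotp (Ipart f) (Astar (Ipart phi))) +i*
        (dotp (Rpart f) (Astar (Ipart phi)) + dotp (Ipart f) (Astar (Rpart phi)))).
Proof.
move=> fL tp; have [tr ti] := test_parts tp; have [fr fi] := (L2P f).1 fL.
have t1 a : rtest a -> rL2 (a^`()%classic : R -> R).
  by move=> ta; apply: rtest_rL2; apply: rtest_derive.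
have t3 a : rtest a -> rL2 (fun x : R => (2 * x)^-1 * a x).
  move=> ta; apply: rtest_rL2.
  rewrite (_ : (fun x => _) = (fun x => (2^-1 * x^-1) * a x)).
    by apply: rtest_M => //; apply: smooth_Z; exact: smooth_inv.
  by apply/funext => x; rewrite invfM.
rewrite /A_half_dist /dist_add /dist_scale /dist_deriv /dist_mul.
rewrite (@dist_ofE f _ _ (cderiv phi) fL (t1 _ tr) (t1 _ ti))//.
rewrite (@dist_ofE f (fun x => - ((2 * x)^-1 * Ipart phi x))
  (fun x => (2 * x)^-1 * Rpart phi x) _ fL (rL2N (t3 _ ti)) (t3 _ tr)); last 2 first.
- by move=> x _; rewrite !cE /=; ring.
- by move=> x _; rewrite !cE /=; ring.
have DA (u a : R -> R) : rL2 u -> rtest a ->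
    dotp u (Astar a) = dotp u (a^`()%classic) + dotp u (fun x => (2 * x)^-1 * a x).
  move=> uL ta; have u1 := rL2_mul uL (t1 _ ta); have u2 := rL2_mul uL (t3 _ ta).
  by rewrite /dotp -I_D//; apply: eq_I => x _; rewrite /Astar mulrDr.
have DN (u v : R -> R) : rL2 u -> rL2 v -> dotp u (fun x => - v x) = - dotp u v.
  by move=> uL vL; rewrite dotpC dotpNl// dotpC.
rewrite !DA// !DN//; try exact: t3.
by apply: complexP; rewrite !cE; gen_dotp; ring.
Qed.

(** A is - i times a real operator, which exchanges real and imaginary parts. *)
Lemma A_halfP f g : A_half R (f, g) <->
  [/\ L2 f, L2 g, weakA (Rpart f) (fun x => - Ipart g x) &
      weakA (Ipart f) (Rpart g)].
Proof.
have DN (u v : R -> R) : rL2 u -> rL2 v -> dotp (fun x => - u x) v = - dotp u v.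
  exact: dotpNl.
split=> [[/= fL gL /eqD_parts H]|[fL gL Hr Hi]].
  have [gr gi] := (L2P g).1 gL.
  have key (a : R -> R) : rtest a ->
      dotp (Rpart f) (fun x => a^`()%classic x + (2 * x)^-1 * a x) = dotp (Ipart g) a /\
      - dotp (Ipart f) (fun x => a^`()%classic x + (2 * x)^-1 * a x) = dotp (Rpart g) a.
    move=> ta; have t0 : rtest (fun=> 0 : R) := rtest0.
    have := H _ _ ta t0; rewrite A_distE//; last exact: test_mk.
    rewrite (@dist_ofE g a (fun=> 0) _ gL (rtest_rL2 ta) rL2_0)// /=.
    have z (u : R -> R) : dotp u (fun x =>
        (Ipart (fun x => a x +i* 0))^`()%classic x + (2 * x)^-1 * Ipart (fun x => a x +i* 0) x) = 0.
      rewrite -[RHS](dotp_0r u); apply: eq_I => x x0.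
      by rewrite (hasD_derive1 (@hasD_cst R 0))// mulr0 addr0.
    rewrite !z !dotp_0r subr0 add0r subr0 add0r => E.
    have := congr1 (@complex.Re R) E; have := congr1 (@complex.Im R) E; rewrite !cE => e1 e2.
    by split; [rewrite -e1|rewrite -e2]; rewrite -/(Astar a) (_ : Rpart (fun x => a x +i* 0) = a)//; gen_dotp; ring.
  split => // a ta; have [k1 k2] := key a ta; rewrite -!/(dotp _ _).
    by rewrite DN ?opprK//; exact: rtest_rL2.
  by rewrite -k2 opprK.
split => //=; apply/eqD_parts => a b ta tb.
rewrite A_distE//; last exact: test_mk.
rewrite (@dist_ofE g a b _ gL (rtest_rL2 ta) (rtest_rL2 tb))//.
have [gr gi] := (L2P g).1 gL.
have E1 t : rtest t ->
    dotp (Rpart f) (fun x => t^`()%classic x + (2 * x)^-1 * t x) = dotp (Ipart g) t.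
  by move=> tt; have := Hr _ tt; rewrite -!/(dotp _ _) DN ?opprK//; exact: rtest_rL2.
have E2 t : rtest t ->
    dotp (Ipart f) (fun x => t^`()%classic x + (2 * x)^-1 * t x) = - dotp (Rpart g) t.
  by move=> tt; exact: Hi _ tt.
rewrite (_ : Rpart (fun x => a x +i* b x) = a)// (_ : Ipart (fun x => a x +i* b x) = b)//=.
rewrite !E1// !E2//.
by apply: complexP; rewrite !cE; gen_dotp; ring.
Qed.

End ComplexParts.

(** * Operators given by boundary conditions *)

Section ComplexBoundaryValues.
Local Open Scope complex_scope.
Context {R : realType}.
Local Notation mu := (@lebesgue_measure R).
Local Notation C := R[i].
Local Notation Re := complex.Re.
Local Notation Im := complex.Im.
Local Notation sq := (@Num.sqrt R).
Implicit Types (f g h k u v phi psi : R -> C) (a c d z : C) (x e : R).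

Variable eta : R -> R.
Hypothesis eta_cut : cutoff eta.

(** f belongs to the maximal domain, L f = g, and f = sqrt x (c + d ln x) +
    ... at 0. *)
Definition cbv f g c d :=
  rbv (Rpart f) (Rpart g) (Re c) (Re d) /\ rbv (Ipart f) (Ipart g) (Im c) (Im d).

Lemma cbv_L2 f g c d : cbv f g c d -> L2 f /\ L2 g.
Proof.
by move=> [/rbv_L2[h1 h2] /rbv_L2[h3 h4]]; split; apply/L2P.
Qed.

Lemma cbv_L0max f g c d : cbv f g c d -> L0max R (f, g).
Proof.
move=> H; have [fL gL] := cbv_L2 H; case: H => hr hi.
by apply/L0maxP; split => //; apply: rbv_weakL; [exact: hr|exact: hi].
Qed.

Lemma L0max_cbv f g : L0max R (f, g) -> exists c d, cbv f g c d.
Proof.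
move=> /L0maxP[/L2P[fr fi] /L2P[gr gi] wr wi].
have [c1 [d1 H1]] := weakL_rbv eta_cut fr gr wr.
have [c2 [d2 H2]] := weakL_rbv eta_cut fi gi wi.
by exists (c1 +i* c2), (d1 +i* d2).
Qed.

Lemma cbv_lin a f g c d f' g' c' d' : cbv f g c d -> cbv f' g' c' d' ->
  cbv (scale a f \+ f') (scale a g \+ g') (a * c + c') (a * d + d').
Proof.
move=> [r1 i1] [r2 i2].
have Rs (p q : R -> C) : Rpart (scale a p \+ q) =
    (fun x => (Re a * Rpart p x - Im a * Ipart p x) + Rpart q x).
  by apply/funext => x; rewrite /Rpart /Ipart /scale /= !cE.
have Is (p q : R -> C) : Ipart (scale a p \+ q) =
    (fun x => (Re a * Ipart p x + Im a * Rpart p x) + Ipart q x).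
  by apply/funext => x; rewrite /Rpart /Ipart /scale /= !cE.
split; rewrite ?Rs ?Is !cE.
  by apply: rbv_D => //; apply: rbv_B; exact: rbv_Z.
by apply: rbv_D => //; apply: rbv_D; exact: rbv_Z.
Qed.

Lemma cbv_eqL2 f g f' g' c d : cbv f g c d -> L2 f' -> L2 g' ->
  eqL2 f f' -> eqL2 g g' -> cbv f' g' c d.
Proof.
move=> [r i] /L2P[fr fi] /L2P[gr gi] /eqL2P[ar ai] /eqL2P[br bi].
by split; [apply: rbv_ae r _ _ ar br|apply: rbv_ae i _ _ ai bi].
Qed.

Lemma cbv_green f f' g g' c d c' d' : cbv f f' c d -> cbv g g' c' d' ->
  inner f g' - inner f' g = c^* * d' - d^* * c'.
Proof.
move=> H H'; have [fL fL'] := cbv_L2 H; have [gL gL'] := cbv_L2 H'.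
rewrite !innerE//; case: H H' => r i [r' i'].
have := rbv_green r r'; have := rbv_green i i'.
have := rbv_green r i'; have := rbv_green i r'.
move: (dotp _ _) (dotp _ _) (dotp _ _) (dotp _ _) => x1 x2 x3 x4.
move: (dotp _ _) (dotp _ _) (dotp _ _) (dotp _ _) => x5 x6 x7 x8.
move=> e1 e2 e3 e4.
apply: complexP; rewrite !cE; move: (Re c) (Im c) (Re d) (Im d) (Re c') (Im c') (Re d') (Im d') e1 e2 e3 e4.
  by move=> *; lra.
by move=> *; lra.
Qed.

Lemma weakL_ae0 (f f' g g' : R -> R) : rL2 f -> rL2 f' -> rL2 g -> rL2 g' ->
  weakL f g -> weakL f' g' -> ae_eq mu (halfline R) f f' ->
  ae_eq mu (halfline R) g g'.
Proof.
move=> fL fL' gL gL' H H' ff'; apply: aeeq_sub0.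
apply: (fund_lemma eta_cut); first by apply: loc_integ_rL2; exact: rL2B.
move=> phi tp; have pL := rtest_rL2 tp; have LpL := rtest_rL2 (rtest_Lop tp).
have E : dotp f (Lop phi) = dotp f' (Lop phi) by exact: (ae_dotp fL fL' LpL LpL ff' (ae_eq_refl _ _ _)).
have : dotp g phi = dotp g' phi.
  by rewrite /dotp -(H _ tp) -(H' _ tp).
move/eqP; rewrite -subr_eq0 /dotp -I_B; [|exact: rL2_mul..].
by move=> /eqP <-; apply: eq_I => x _; ring.
Qed.

Lemma cbv_uniq f g c d f' g' c' d' : cbv f g c d -> cbv f' g' c' d' ->
  eqL2 f f' -> [/\ eqL2 g g', c = c' & d = d'].
Proof.
move=> H H' /eqL2P[er ei]; have [/L2P[fr fi] /L2P[gr gi]] := cbv_L2 H.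
have [/L2P[fr' fi'] /L2P[gr' gi']] := cbv_L2 H'.
case: H H' => r i [r' i'].
have gr2 := weakL_ae0 fr fr' gr gr' (rbv_weakL r) (rbv_weakL r') er.
have gi2 := weakL_ae0 fi fi' gi gi' (rbv_weakL i) (rbv_weakL i') ei.
have [c1 d1] := rbv_uniq eta_cut r r' er gr2.
have [c2 d2] := rbv_uniq eta_cut i i' ei gi2.
by split; [apply/eqL2P|apply: complexP|apply: complexP].
Qed.

Lemma rbv_00 : rbv (fun=> 0 : R) (fun=> 0) 0 0.
Proof.
have := rbv_Z 0 (rbv_ref1 eta_cut); rewrite !mul0r.
by under eq_fun do rewrite mul0r; under [X in rbv _ X]eq_fun do rewrite mul0r.
Qed.

Lemma cbv0 : cbv (fun=> 0) (fun=> 0) 0 0.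
Proof. by split; exact: rbv_00. Qed.

Lemma rbv_ex (c d : R) : exists f g : R -> R, rbv f g c d.
Proof.
have := rbv_D (rbv_Z c (rbv_ref1 eta_cut)) (rbv_Z d (rbv_ref2 eta_cut)).
by rewrite !mulr1 !mulr0 addr0 add0r => H; do 2 eexists; exact: H.
Qed.

Lemma cbv_ex c d : exists f g, cbv f g c d.
Proof.
have [f1 [g1 H1]] := rbv_ex (Re c) (Re d).
have [f2 [g2 H2]] := rbv_ex (Im c) (Im d).
by exists (fun x => f1 x +i* f2 x), (fun x => g1 x +i* g2 x).
Qed.

Definition Ltest phi : R -> C := fun x => Lop (Rpart phi) x +i* Lop (Ipart phi) x.

Lemma cbv_test phi : test_function phi -> cbv phi (Ltest phi) 0 0.
Proof. by move=> /test_parts[tr ti]; split; exact: rbv_test. Qed.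

(** Between L0min, for P = {0}, and L0max, for P = C^2, the operators under
    study are all of this form. *)
Definition bvop (P : C -> C -> Prop) : operator R :=
  [set p | exists c d, cbv p.1 p.2 c d /\ P c d].

Definition lin2 (P : C -> C -> Prop) :=
  P 0 0 /\ forall a c d c' d', P c d -> P c' d' -> P (a * c + c') (a * d + d').

Lemma bvop_operator P : lin2 P -> is_operator (bvop P).
Proof.
move=> [P0 Pl]; split.
- by move=> f g [c [d [H _]]]; exact: cbv_L2 H.
- move=> f g f' g' [c [d [H Pcd]]] fL gL ef eg; exists c, d; split => //.
  exact: cbv_eqL2 H _ _ ef eg.
- by exists 0, 0; split => //; exact: cbv0.
- move=> a f g f' g' [c [d [H Pcd]]] [c' [d' [H' Pcd']]].
  by exists (a * c + c'), (a * d + d'); split; [exact: cbv_lin|exact: Pl].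
- move=> f g g' [c [d [H _]]] [c' [d' [H' _]]].
  by have [] := cbv_uniq H H' (ae_eq_refl _ _ _).
Qed.

Lemma sqnormBmk f (a b : R -> R) : sqnorm (f \- (fun x => a x +i* b x)) =
  dotp (fun x => Rpart f x - a x) (fun x => Rpart f x - a x) +
  dotp (fun x => Ipart f x - b x) (fun x => Ipart f x - b x).
Proof. exact: sqnormB. Qed.

Lemma test_dense_C f e : L2 f -> 0 < e ->
  exists2 phi, test_function phi & norm2 (f \- phi) < e.
Proof.
move=> fL e0; have [fr fi] := (L2P f).1 fL.
have e2 : 0 < e ^+ 2 / 2 by rewrite divr_gt0// exprn_gt0.
have [p1 t1 h1] := test_dense eta_cut fr e2.
have [p2 t2 h2] := test_dense eta_cut fi e2.
have tp := test_mk t1 t2.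
exists (fun x => p1 x +i* p2 x) => //.
rewrite norm2_lt//; last by apply: L2_B => //; exact: test_L2.
by rewrite sqnormBmk; move: h1 h2; gen_dotp => *; lra.
Qed.

Lemma bvop_dense P : P 0 0 -> densely_defined (bvop P).
Proof.
move=> P0 f fL e e0; have [phi tp h] := test_dense_C fL e0.
exists phi; split => //; exists (Ltest phi), 0, 0; split => //.
exact: cbv_test.
Qed.

(** The orthogonal of P for the boundary form in Green's formula. *)
Definition perp (P : C -> C -> Prop) c d :=
  forall c' d', P c' d' -> c^* * d' = d^* * c'.

(** Since test functions are in the domain, the adjoint is contained in L0max;
    then Green's formula applies, and all pairs in P occur as boundary values
    by [cbv_ex]. *)
Lemma bvop_adjoint P : P 0 0 -> adjoint_op (bvop P) = bvop (perp P).
Proof.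
move=> P0; apply/seteqP; split=> [[f g] /= [fL gL H]|[f g] /= [c [d [H Hp]]]].
  have [fr fi] := (L2P f).1 fL; have [gr gi] := (L2P g).1 gL.
  have fg : L0max R (f, g).
    have key (p : R -> R) : rtest p ->
        dotp (Rpart f) (Lop p) = dotp (Rpart g) p /\
        dotp (Ipart f) (Lop p) = dotp (Ipart g) p.
      move=> tp; have b : cbv (fun x => p x +i* 0) (fun x => Lop p x +i* 0) 0 0.
        by split; [exact: rbv_test|exact: rbv_00].
      have [pL LpL] := cbv_L2 b.
      have := H _ _ (ex_intro _ 0 (ex_intro _ 0 (conj b P0))).
      rewrite !innerE// /Rpart /Ipart /= !dotp_0r !addr0 !sub0r => -[-> E].
      by split => //; apply: oppr_inj.
    by apply/L0maxP; split => // p tp; have [] := key p tp.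
  have [c [d cd]] := L0max_cbv fg; exists c, d; split => // c' d' Pcd'.
  have [u [v uv]] := cbv_ex c' d'.
  have := cbv_green cd uv.
  rewrite (H u v); last by exists c', d'.
  by rewrite subrr => /esym/eqP; rewrite subr_eq0 => /eqP.
have [fL gL] := cbv_L2 H; split => // u v [c' [d' [H' Pcd']]].
by apply/eqP; rewrite -subr_eq0 (cbv_green H H') subr_eq0; apply/eqP; exact: Hp.
Qed.

Lemma bvop_eq (P Q : C -> C -> Prop) : (forall c d, P c d <-> Q c d) -> bvop P = bvop Q.
Proof.
move=> PQ; apply/seteqP; split => -[f g] [c [d [H /PQ ?]]]; by exists c, d.
Qed.

Lemma L0maxE : L0max R = bvop (fun _ _ => True).
Proof.
apply/seteqP; split => [[f g] /L0max_cbv[c [d H]]|[f g] [c [d [H _]]]].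
  by exists c, d.
exact: cbv_L0max H.
Qed.

Definition P00 : C -> C -> Prop := fun c d => c = 0 /\ d = 0.

Lemma VL_rbv (p q : R -> R) : VL p q -> rbv p q 0 0.
Proof.
move=> [tp [qL E]]; apply: rbv_ae (rbv_test tp) _ qL (ae_eq_refl _ _ _) _; first exact: rtest_rL2.
by apply: aeW => x /=; rewrite halflineE => x0; rewrite E.
Qed.

(** The real and imaginary parts of [L_core] and [L_core_conv]. The definition
    of L0min leaves the image v of a test function u unspecified up to null
    sets, whereas [approx2] with [VL] takes it pointwise equal to L u. *)
Lemma L0minE : L0min R = bvop P00.
Proof.
apply/seteqP; split=> [[f g] [/= fL gL H]|[f g] [c [d [H [c0 d0]]]]].
  have [fr fi] := (L2P f).1 fL; have [gr gi] := (L2P g).1 gL.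
  have key e : 0 < e -> exists2 u, test_function u &
      sqnorm (f \- u) + sqnorm (g \- Ltest u) < e.
    move=> e0; have e1 : 0 < sq (e / 2) by rewrite sqrtr_gt0 divr_gt0.
    have [u [v [[uv tu] h1 h2]]] := H _ e1; exists u => //.
    have bu := cbv_test tu; have [uL LuL] := cbv_L2 bu.
    have [_ vL _ _] := (L0maxP u v).1 uv.
    have [c [d bv]] := L0max_cbv uv.
    have [ev _ _] := cbv_uniq bv bu (ae_eq_refl _ _ _).
    move: h1 h2; rewrite !norm2_lt//; try exact: L2_B.
    rewrite sqr_sqrtr; last by rewrite ltW// divr_gt0.
    have -> : sqnorm (g \- v) = sqnorm (g \- Ltest u).
      rewrite -!sqr_norm2; try exact: L2_B.
      congr (_ ^+ 2); rewrite /norm2; congr (sq (Re _)).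
      have ee : eqL2 (g \- v) (g \- Ltest u).
        by apply: filterS ev => x E /E /=; rewrite /= => ->.
      by apply: inner_eqL2 => //; exact: L2_B.
    by move=> *; lra.
  exists 0, 0; change (cbv f g 0 0 /\ P00 0 0); split => //; split; apply: (L_core_conv eta_cut) => // e e0.
    have [u tu h] := key _ e0; have [tr ti] := test_parts tu.
    exists (Rpart u), (Lop (Rpart u)); split; first exact: VL_test.
    move: h; rewrite !sqnormB.
    have n1 := dotp_ge0 (fun x => Ipart f x - Ipart u x).
    have n2 := dotp_ge0 (fun x => Ipart g x - Ipart (Ltest u) x).
    by move: n1 n2; rewrite (_ : Rpart (Ltest u) = Lop (Rpart u))//; gen_dotp => *; lra.
  have [u tu h] := key _ e0; have [tr ti] := test_parts tu.
  exists (Ipart u), (Lop (Ipart u)); split; first exact: VL_test.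
  move: h; rewrite !sqnormB.
  have n1 := dotp_ge0 (fun x => Rpart f x - Rpart u x).
  have n2 := dotp_ge0 (fun x => Rpart g x - Rpart (Ltest u) x).
  by move: n1 n2; rewrite (_ : Ipart (Ltest u) = Lop (Ipart u))//; gen_dotp => *; lra.
have [fL gL] := cbv_L2 H; split => // e e0.
case: H; rewrite c0 d0 /= => /(L_core eta_cut) ar /(L_core eta_cut) ai.
have e2 : 0 < e ^+ 2 / 2 by rewrite divr_gt0// exprn_gt0.
have [p1 [q1 [V1 h1]]] := ar _ e2; have [p2 [q2 [V2 h2]]] := ai _ e2.
have b : cbv (fun x => p1 x +i* p2 x) (fun x => q1 x +i* q2 x) 0 0.
  by split; exact: VL_rbv.
have [uL vL] := cbv_L2 b.
exists (fun x => p1 x +i* p2 x), (fun x => q1 x +i* q2 x).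
have m1 := dotp_ge0 (fun x => Rpart f x - p1 x).
have m2 := dotp_ge0 (fun x => Ipart f x - p2 x).
have m3 := dotp_ge0 (fun x => Rpart g x - q1 x).
have m4 := dotp_ge0 (fun x => Ipart g x - q2 x).
split.
- split; first exact: cbv_L0max b.
  by apply: test_mk; [case: V1|case: V2].
- rewrite norm2_lt//; last exact: L2_B.
  by rewrite sqnormBmk; move: m1 m2 m3 m4 h1 h2; gen_dotp => *; lra.
- rewrite norm2_lt//; last exact: L2_B.
  by rewrite sqnormBmk; move: m1 m2 m3 m4 h1 h2; gen_dotp => *; lra.
Qed.

End ComplexBoundaryValues.

(** * The operators H0 and H0^theta *)

Section BoundaryConditions.
Local Open Scope complex_scope.
Context {R : realType}.
Local Notation mu := (@lebesgue_measure R).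
Local Notation C := R[i].
Local Notation Re := complex.Re.
Local Notation Im := complex.Im.
Local Notation sq := (@Num.sqrt R).
Implicit Types (f g h k u v phi psi : R -> C) (a c d z : C) (x e : R).

Lemma contp_ae_eq (f g : R -> R) : contp f -> contp g ->
  ae_eq mu (halfline R) f g -> forall x, 0 < x -> f x = g x.
Proof.
move=> cf cg fg x x0; have [P HP] := prim_exists (loc_integ_contp cf).
rewrite -(hasD_derive1 (prim_hasD HP cf) x0).
by rewrite (hasD_derive1 (prim_hasD (prim_ae (loc_integ_contp cg) fg HP) cg) x0).
Qed.

Section Cutoff.
Variable xi : R -> C.
Hypothesis xi_smooth : smooth_hl xi.
Hypothesis xi_one : forall x : R, 0 < x -> x <= 1 -> xi x = 1.
Hypothesis xi_zero : forall x : R, 2 <= x -> xi x = 0.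

Lemma xi_cut : cutoff (Rpart xi).
Proof.
split.
- by move=> n x x0; have [] := xi_smooth n x0.
- by move=> x x0 x1; rewrite /Rpart xi_one.
- by move=> x x2; rewrite /Rpart xi_zero.
Qed.

(** Nothing is assumed on the values of xi in ]1, 2[, where xi may fail to be
    real; this only contributes a test function. *)
Lemma rtest_xi_im : rtest (fun x => sq x * Ipart xi x).
Proof.
split.
  apply: smooth_M; first exact: smooth_sqrt.
  by move=> n x x0; have [] := xi_smooth n x0.
exists 1, 2; split => // x x12.
have [x0|x0] := leP x 0; first by rewrite ler0_sqrtr// mul0r.
have [x1|x1] := leP x 1; first by rewrite /Ipart xi_one// mulr0.
have [x2|x2] := leP 2 x; first by rewrite /Ipart xi_zero// mulr0.
by case: x12; rewrite !ltW.
Qed.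

Definition xi_sqrt x : C := xi x * (sq x)%:C.

Lemma cbv_xi_sqrt : exists v, cbv xi_sqrt v 1 0.
Proof.
exists (fun x => ref1L (Rpart xi) x +i* Lop (fun x => sq x * Ipart xi x) x); split.
  rewrite (_ : Rpart xi_sqrt = fun x => sq x * Rpart xi x); first exact: rbv_ref1 xi_cut.
  by apply/funext => x; rewrite /xi_sqrt /Rpart !cE mulr0 subr0 mulrC.
rewrite (_ : Ipart xi_sqrt = fun x => sq x * Ipart xi x); first exact: rbv_test rtest_xi_im.
by apply/funext => x; rewrite /xi_sqrt /Ipart !cE mulr0 add0r mulrC.
Qed.

(** The boundary condition of H0: no logarithmic part. *)
Definition Pd0 : C -> C -> Prop := fun c d => d = 0.

Lemma H0E : H0 xi = bvop Pd0.
Proof.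
have [v0 Hv0] := cbv_xi_sqrt.
have [uL v0L] := cbv_L2 Hv0.
apply/seteqP; split => [[f g] [/= fg [f0 [a [[g0 /=]]]]]|[f g] [c [d [/= H d0]]]].
  rewrite (L0minE xi_cut) => -[c [d [/= H [c0 d0]]]] fE.
  have [c' [d' H']] := L0max_cbv xi_cut fg.
  have [_ _ E] : [/\ eqL2 g (scale a v0 \+ g0), c' = a * 1 + c & d' = a * 0 + d].
    apply: (cbv_uniq xi_cut H' (cbv_lin a Hv0 H)).
    rewrite fE; apply: aeW => x _; by rewrite /= addrC.
  by exists c', d'; split => //=; rewrite /Pd0 E mulr0 add0r d0.
split; first exact: cbv_L0max H.
exists (scale (- c) xi_sqrt \+ f), c; split.
  exists (scale (- c) v0 \+ g); rewrite (L0minE xi_cut).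
  exists (- c * 1 + c), (- c * 0 + d); split; first exact: cbv_lin Hv0 H.
  by split; rewrite ?d0 ?mulr0 ?add0r ?addr0// mulr1 addNr.
by apply/funext => x; rewrite /scale /xi_sqrt /=; ring.
Qed.

Definition Ptheta (theta : R) : C -> C -> Prop :=
  fun c d => (sin theta)%:C * d = (cos theta)%:C * c.

Lemma hasD_u_theta (theta : R) : hasD (u_theta theta)
  (fun x => sq x * x^-1 * (2^-1 * (ln x * cos theta + sin theta) + cos theta)).
Proof.
apply: (eq_hasD _ _ (hasD_M (@hasD_sqrt R)
   (hasD_D (hasD_Z (cos theta) (@hasD_ln R)) (@hasD_cst R (sin theta))))).
  by move=> x x0; rewrite /u_theta; ring.
by move=> x x0; ring.
Qed.

Lemma hasD_rep (w p : R -> R) : hasD w (fun x => p x / x) ->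
  hasD (fun x => sq x * w x) (fun x => sq x * x^-1 * (2^-1 * w x + p x)).
Proof.
move=> Dw; apply: (eq_hasD _ _ (hasD_M (@hasD_sqrt R) Dw)) => // x x0; ring.
Qed.

Lemma wronskian_u (theta : R) (w p : R -> R) (c1 c2 : R) : hasD w (fun x => p x / x) -> BV w p c1 c2 ->
  exists K, forall x, 0 < x -> x <= 1 ->
  `|u_theta theta x * (fun x => sq x * w x)^`()%classic x -
    (u_theta theta)^`()%classic x * (sq x * w x) - (sin theta * c2 - cos theta * c1)| <= K * sq x.
Proof.
move=> Dw Bw.
have Bu : BV (fun x => ln x * cos theta + sin theta) (fun=> cos theta) (sin theta) (cos theta).
  exists 0 => x x0; rewrite subrr normr0 mul0r lexx; split => //.
  by rewrite (_ : _ - _ = 0) ?normr0//; ring.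
have [K HK] := wronskian0 Bw Bu.
exists K => x x0 x1; apply: le_trans (HK x x0 x1).
rewrite (hasD_derive1 (hasD_rep Dw) x0) (hasD_derive1 (@hasD_u_theta theta) x0).
rewrite -normrN le_eqVlt; apply/orP; left; apply/eqP; congr (`|_|).
have s2 : sq x * sq x * x^-1 = 1 by rewrite -expr2 sqr_sqrtr ?(ltW x0)// divff ?gt_eqF.
rewrite /u_theta.
transitivity (- (sq x * sq x * x^-1 *
   ((ln x * cos theta + sin theta) * p x - cos theta * w x) - (sin theta * c2 - cos theta * c1))).
  by ring.
by rewrite s2; ring.
Qed.

Definition wronC theta h x : C :=
  (u_theta theta x)%:C * cderiv h x - (derive1 (u_theta theta) x)%:C * h x.

Lemma Re_wronC theta h x : Re (wronC theta h x) =
  u_theta theta x * (Rpart h)^`()%classic x - (u_theta theta)^`()%classic x * Rpart h x.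
Proof. by rewrite /wronC ReD ReN !ReM !ReC !ImC !mul0r !subr0. Qed.

Lemma Im_wronC theta h x : Im (wronC theta h x) =
  u_theta theta x * (Ipart h)^`()%classic x - (u_theta theta)^`()%classic x * Ipart h x.
Proof. by rewrite /wronC ImD ImN !ImM !ReC !ImC !mul0r !addr0. Qed.

Lemma Re_normC z : Re `|z| = sq (Re z ^+ 2 + Im z ^+ 2).
Proof. by case: z. Qed.

Lemma Re_normC_ge z : `|Re z| <= Re `|z| /\ `|Im z| <= Re `|z|.
Proof.
rewrite Re_normC -!sqrtr_sqr !ler_sqrt ?addr_ge0 ?sqr_ge0//.
by rewrite lerDl lerDr !sqr_ge0.
Qed.

Lemma Re_normC_le z : Re `|z| <= `|Re z| + `|Im z|.
Proof.
rewrite Re_normC -[leRHS]ger0_norm ?addr_ge0// -sqrtr_sqr ler_sqrt ?sqr_ge0//.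
rewrite sqrrD !real_normK ?num_real// lerD2r lerDl.
by rewrite mulrn_wge0// mulr_ge0.
Qed.

Lemma cvg_sqrt0 (K : R) : (fun x : R => K * sq x) x @[x --> 0^'+] --> (0 : R).
Proof.
rewrite -[X in _ --> X](mulr0 K); apply: cvgM; first exact: cvg_cst.
rewrite -[X in _ --> X](@sqrtr0 R); apply: cvg_at_right_filter.
exact: sqrt_continuous.
Qed.

Lemma near_right0 (P : R -> Prop) : (forall x, 0 < x -> x <= 1 -> P x) ->
  \forall x \near (0 : R)^'+, P x.
Proof.
move=> H; near=> x; apply: H; first by near: x; exact: nbhs_right_gt.
by near: x; apply: nbhs_right_le.
Unshelve. all: by end_near. Qed.

Lemma cvg0_close (F G : R -> R) (r K : R) : (forall x, 0 < x -> x <= 1 -> `|G x - r| <= K * sq x) ->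
  (forall x, 0 < x -> `|G x| <= F x) -> F x @[x --> 0^'+] --> (0 : R) -> r = 0.
Proof.
move=> HG GF F0.
have b : (fun x => F x + K * sq x) x @[x --> 0^'+] --> (0 : R).
  by rewrite -[X in _ --> X](addr0 0); apply: cvgD => //; exact: cvg_sqrt0.
have : `|r| <= 0.
  have c : (fun=> `|r|) x @[x --> (0 : R)^'+] --> `|r| by exact: cvg_cst.
  rewrite -(cvg_lim _ b)// -(cvg_lim _ c)//; apply: ler_lim.
  - by apply/cvg_ex; exists `|r|.
  - by apply/cvg_ex; exists 0.
  apply: near_right0 => x x0 x1; have := HG x x0 x1; have := GF x x0.
  by have := ler_normB (G x) (G x - r); rewrite opprB addrC subrK => *; lra.
by rewrite normr_le0 => /eqP.
Qed.

(** The continuously differentiable representative of f is sqrt x * w. As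
    u_theta has boundary values (sin theta, cos theta), its Wronskian with
    sqrt x * w tends at 0 to sin theta * d - cos theta * c. *)
Lemma H0thetaE (theta : R) : H0theta theta = bvop (Ptheta theta).
Proof.
apply/seteqP; split => [[f g] [/= fg [h [hC fh h0]]]|[f g] [c [d [/= H E]]]].
  have [c [d cd]] := L0max_cbv xi_cut fg; exists c, d; split => //=.
  have [[fr [w1 [p1 [s1 b1 e1]]]] [fi [w2 [p2 [s2 b2 e2]]]]] := cd.
  have [er ei] := (eqL2P f h).1 fh.
  have [[_ _ D1 _] [_ _ D2 _]] := (s1, s2).
  have hr x : 0 < x -> Rpart h x = sq x * w1 x.
    apply: (contp_ae_eq (f := Rpart h) (g := fun x => sq x * w1 x)).
    - by apply: hasD_contp; apply: derivable_hasD => y /hC[].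
    - exact: hasD_contp (hasD_rep D1).
    - by apply: filterS2 er e1 => y A B y0; rewrite -A// B.
  have hi x : 0 < x -> Ipart h x = sq x * w2 x.
    apply: (contp_ae_eq (f := Ipart h) (g := fun x => sq x * w2 x)).
    - by apply: hasD_contp; apply: derivable_hasD => y /hC[].
    - exact: hasD_contp (hasD_rep D2).
    - by apply: filterS2 ei e2 => y A B y0; rewrite -A// B.
  have [K1 HK1] := wronskian_u theta D1 b1.
  have [K2 HK2] := wronskian_u theta D2 b2.
  have Er x : 0 < x -> Re (wronC theta h x) = u_theta theta x * (fun x => sq x * w1 x)^`()%classic x -
    (u_theta theta)^`()%classic x * (sq x * w1 x).
    move=> x0; rewrite Re_wronC (hr x x0) (hasD_derive1 (hasD_rep D1) x0).
    by rewrite (hasD_derive1 (eq_hasD (F := fun x => sq x * w1 x) (fun y y0 => esym (hr y y0)) (fun _ _ => erefl) (hasD_rep D1)) x0).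
  have Ei x : 0 < x -> Im (wronC theta h x) = u_theta theta x * (fun x => sq x * w2 x)^`()%classic x -
    (u_theta theta)^`()%classic x * (sq x * w2 x).
    move=> x0; rewrite Im_wronC (hi x x0) (hasD_derive1 (hasD_rep D2) x0).
    by rewrite (hasD_derive1 (eq_hasD (F := fun x => sq x * w2 x) (fun y y0 => esym (hi y y0)) (fun _ _ => erefl) (hasD_rep D2)) x0).
  have r1 : sin theta * Re d - cos theta * Re c = 0.
    apply: (cvg0_close (G := fun x => Re (wronC theta h x)) (K := K1) _ _ h0).
      by move=> x x0 x1; rewrite Er//; exact: HK1.
    by move=> x x0; have [] := Re_normC_ge (wronC theta h x).
  have r2 : sin theta * Im d - cos theta * Im c = 0.
    apply: (cvg0_close (G := fun x => Im (wronC theta h x)) (K := K2) _ _ h0).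
      by move=> x x0 x1; rewrite Ei//; exact: HK2.
    by move=> x x0; have [] := Re_normC_ge (wronC theta h x).
  by rewrite /Ptheta; apply: complexP; rewrite !cE; lra.
split; first exact: cbv_L0max H.
case: H => [[fr [w1 [p1 [s1 b1 e1]]]] [fi [w2 [p2 [s2 b2 e2]]]]].
have [[_ _ D1 P1] [_ _ D2 P2]] := (s1, s2).
have [K1 HK1] := wronskian_u theta D1 b1.
have [K2 HK2] := wronskian_u theta D2 b2.
have cD (w p q : R -> R) : hasD w (fun x => p x / x) -> is_prim p q ->
    contp ((fun x => sq x * w x)^`()%classic).
  move=> Dw Pp.
  apply: (eq_contp (f := fun x => sq x * x^-1 * (2^-1 * w x + p x))).
    by move=> x x0; rewrite (hasD_derive1 (hasD_rep Dw) x0).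
  apply: contp_M; first by apply: contp_M; [exact: contp_sqrt|exact: contp_inv].
  apply: contp_D; last exact: prim_contp Pp.
  by apply: contp_M; [exact: contp_cst|exact: hasD_contp Dw].
exists (fun x => (sq x * w1 x) +i* (sq x * w2 x)); split.
- move=> x x0; split.
  + exact: hasD_derivable (hasD_rep D1) x0.
  + exact: hasD_derivable (hasD_rep D2) x0.
  + exact: cD D1 P1 x x0.
  + exact: cD D2 P2 x x0.
- by apply/eqL2P.
have Hb x : 0 < x -> x <= 1 -> Re `|wronC theta (fun x => (sq x * w1 x) +i* (sq x * w2 x)) x| <= (K1 + K2) * sq x.
  move=> x0 x1; apply: le_trans (Re_normC_le _) _; rewrite (mulrDl K1 K2).
  have := HK1 x x0 x1; have := HK2 x x0 x1.
  have E1 : sin theta * Re d - cos theta * Re c = 0.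
    by have := congr1 (@complex.Re R) E; rewrite !cE; lra.
  have E2 : sin theta * Im d - cos theta * Im c = 0.
    by have := congr1 (@complex.Im R) E; rewrite !cE; lra.
  rewrite E1 E2 !subr0 => h2 h1; apply: lerD.
    by apply: le_trans h1; rewrite Re_wronC.
  by apply: le_trans h2; rewrite Im_wronC.
apply: squeeze_cvgr (cvg_cst 0) (cvg_sqrt0 (K1 + K2)).
apply: near_right0 => x x0 x1; rewrite Hb// andbT.
by rewrite -/(wronC _ _ _) Re_normC sqrtr_ge0.
Qed.

End Cutoff.
End BoundaryConditions.

(** * H0 as A^* A *)

Section FormOfA.
Local Open Scope complex_scope.
Context {R : realType}.
Local Notation mu := (@lebesgue_measure R).
Local Notation C := R[i].
Local Notation Re := complex.Re.
Local Notation Im := complex.Im.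
Implicit Types (f g h k u v phi psi : R -> C) (a c d z : C) (x e : R).

Lemma VA_weakA (p q : R -> R) : VA p q -> weakA p q.
Proof.
move=> V; have [tp [qL _]] := V; apply: weakA_closed => //; first exact: rtest_rL2.
move=> e e0; exists p, q; split => //.
rewrite (_ : _ + _ = 0)//.
by rewrite /dotp !(@eq_I _ _ (fun=> 0)) ?I0 ?addr0// => x _; rewrite subrr mul0r.
Qed.

Lemma weakA_Lop (f k p : R -> R) : rL2 f -> weakA f k -> rtest p ->
  dotp k (Aop p) = dotp f (Lop p).
Proof.
move=> fL fk tp; have := fk _ (rtest_Aop tp).
move=> /(congr1 -%R); rewrite opprK => E.
have tA := rtest_Aadj (rtest_Aop tp).
rewrite /dotp -E -I_N//; last exact: rL2_mul (rtest_rL2 tA).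
by apply: eq_I => x x0; rewrite Lop_factor//; ring.
Qed.

Lemma weakA_uniq (eta f k k' : R -> R) : cutoff eta -> rL2 k -> rL2 k' ->
  weakA f k -> weakA f k' -> ae_eq mu (halfline R) k k'.
Proof.
move=> eta_cut kL kL' H H'; apply: aeeq_sub0.
apply: (fund_lemma eta_cut); first by apply: loc_integ_rL2; exact: rL2B.
move=> phi tp; have pL := rtest_rL2 tp.
have : dotp k phi = dotp k' phi.
  by apply: oppr_inj; rewrite /dotp -(H _ tp) -(H' _ tp).
move/eqP; rewrite -subr_eq0 /dotp -I_B; [|exact: rL2_mul..].
by move=> /eqP <-; apply: eq_I => x _; ring.
Qed.

Section Cutoff.
Variable eta : R -> R.
Hypothesis eta_cut : cutoff eta.

(** The identity <A f, A u> = <L f, u> holds for test functions u, which are a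
    core of A. *)
Lemma weakA_form (f g k u v : R -> R) : rL2 f -> rL2 g -> weakL f g ->
  rL2 k -> weakA f k -> rL2 u -> rL2 v -> weakA u v -> dotp k v = dotp g u.
Proof.
move=> fL gL fg kL fk uL vL uv.
have : dotp g u + dotp (fun x => - k x) v = 0.
  apply: (approx2_dotp (@VA_subspace R) uL vL gL (rL2N kL) (A_core eta_cut uL vL uv)).
  move=> phi psi [tp [psiL pE]]; rewrite dotpNl//.
  have -> : dotp k psi = dotp k (Aop phi) by apply: eq_I => x x0; rewrite pE.
  by rewrite (weakA_Lop fL fk tp) /dotp fg// subrr.
by rewrite dotpNl// => /eqP; rewrite subr_eq0 => /eqP.
Qed.

Lemma H0_form f g c : cbv f g c 0 -> exists2 h, A_half R (f, h) &
  inner f g = ((norm2 h) ^+ 2)%:C.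
Proof.
move=> H; have [fL gL] := cbv_L2 H; case: H => r i.
have [kr krL [wr er]] := H0r_form (ex_intro (fun t => rbv _ _ t 0) _ r).
have [ki kiL [wi ei]] := H0r_form (ex_intro (fun t => rbv _ _ t 0) _ i).
have hL : L2 (fun x => ki x +i* - kr x) by apply: L2_mk => //; exact: rL2N.
exists (fun x => ki x +i* - kr x).
  apply/A_halfP; split => //.
  by rewrite (_ : (fun x => _) = kr)//; apply/funext => x; rewrite /Ipart /= opprK.
rewrite sqr_norm2// innerE//; apply: complexP; rewrite !cE.
  rewrite -er -ei /sqnorm addrC; congr (_ + _).
  by apply: eq_I => x _; rewrite /Ipart /= mulrNN.
by rewrite [dotp (Ipart f) _]dotpC (rbv_green r i) Re0 Im0 mulr0 mul0r subrr.
Qed.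

Lemma A_half_uniq f h h' : A_half R (f, h) -> A_half R (f, h') -> eqL2 h h'.
Proof.
move=> /A_halfP[_ /L2P[hr hi] wr wi] /A_halfP[_ /L2P[hr' hi'] wr' wi'].
apply/eqL2P; split; first exact: (weakA_uniq eta_cut hr hr' wi wi').
have := weakA_uniq eta_cut (rL2N hi) (rL2N hi') wr wr'.
by apply: filterS => x /[apply] /oppr_inj.
Qed.

Lemma norm2_eqL2 f f' : L2 f -> L2 f' -> eqL2 f f' -> norm2 f = norm2 f'.
Proof. by move=> fL fL' E; rewrite /norm2 (inner_eqL2 fL fL' fL fL' E E). Qed.

Lemma inner_A f g h c : cbv f g c 0 -> A_half R (f, h) ->
  inner f g = ((norm2 h) ^+ 2)%:C.
Proof.
move=> /H0_form[h' Ah' ->] Ah; congr (_ %:C); congr (_ ^+ 2).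
have [_ hL _ _] := (A_halfP _ _).1 Ah; have [_ hL' _ _] := (A_halfP _ _).1 Ah'.
exact: norm2_eqL2 (A_half_uniq Ah' Ah).
Qed.

Lemma test_graph_dense : graph_dense (domain_op (bvop (@Pd0 R))) (A_half R).
Proof.
move=> f g /A_halfP[fL gL wr wi] e e0.
have [fr fi] := (L2P f).1 fL; have [gr gi] := (L2P g).1 gL.
have e2 : 0 < e ^+ 2 / 2 by rewrite divr_gt0// exprn_gt0.
have [p1 [q1 [V1 h1]]] := A_core eta_cut fr (rL2N gi) wr e2.
have [p2 [q2 [V2 h2]]] := A_core eta_cut fi gr wi e2.
have {}h1 : dotp (fun x => Rpart f x - p1 x) (fun x => Rpart f x - p1 x) +
  dotp (fun x => - Ipart g x - q1 x) (fun x => - Ipart g x - q1 x) < e ^+ 2 / 2 := h1.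
have [[t1 [q1L _]] [t2 [q2L _]]] := (V1, V2).
have tu := test_mk t1 t2; have bu := cbv_test tu.
have uL := test_L2 tu; have vL : L2 (fun x => q2 x +i* - q1 x).
  by apply: L2_mk => //; exact: rL2N.
exists (fun x => p1 x +i* p2 x), (fun x => q2 x +i* - q1 x).
have m1 := dotp_ge0 (fun x => Rpart f x - p1 x).
have m2 := dotp_ge0 (fun x => Ipart f x - p2 x).
have m3 := dotp_ge0 (fun x => - Ipart g x - q1 x).
have m4 := dotp_ge0 (fun x => Rpart g x - q2 x).
split.
- by eexists; exists 0, 0; split; [exact: bu|].
- apply/A_halfP; split => //; last exact: VA_weakA.
  rewrite (_ : (fun x => _) = q1); first exact: VA_weakA.
  by apply/funext => x; rewrite /Ipart /= opprK.
- rewrite norm2_lt//; last exact: L2_B.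
  by rewrite (sqnormBmk f p1 p2); move: m1 m2 m3 m4 h1 h2; gen_dotp => *; lra.
- rewrite norm2_lt//; last exact: L2_B.
  rewrite (sqnormBmk g q2 (fun x => - q1 x)).
  have -> : dotp (fun x => Ipart g x - - q1 x) (fun x => Ipart g x - - q1 x) =
    dotp (fun x => - Ipart g x - q1 x) (fun x => - Ipart g x - q1 x).
    by apply: eq_I => x _; ring.
  by move: m1 m2 m3 m4 h1 h2; gen_dotp => *; lra.
Qed.

(** If A f is in the domain of A^*, testing with test functions gives L f =
    A^* A f, and the logarithmic part of f vanishes by [rbv_weakA] because A f
    is square integrable. The converse is [weakA_form]. *)
Lemma Astar_A : comp_op (adjoint_op (A_half R)) (A_half R) = bvop (@Pd0 R).
Proof.
apply/seteqP; split=> [[f g] [h [/= Ah [hL gL adj]]]|[f g] [c [d [/= H d0]]]].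
  have [fL _ wr wi] := (A_halfP _ _).1 Ah.
  have [fr fi] := (L2P f).1 fL; have [gr gi] := (L2P g).1 gL.
  have [hr hi] := (L2P h).1 hL.
  have key (p : R -> R) : rtest p ->
      dotp (Rpart f) (Lop p) = dotp (Rpart g) p /\
      dotp (Ipart f) (Lop p) = dotp (Ipart g) p.
    move=> tp; have AL := rtest_rL2 (rtest_Aop tp).
    have uL : L2 (fun x => p x +i* 0) by apply: L2_mk; [exact: rtest_rL2|exact: rL2_0].
    have vL : L2 (fun x => 0 +i* - Aop p x) by apply: L2_mk; [exact: rL2_0|exact: rL2N].
    have Ap : A_half R (fun x => p x +i* 0, fun x => 0 +i* - Aop p x).
      apply/A_halfP; split => //.
        rewrite (_ : (fun x => _) = Aop p); first by apply: VA_weakA; exact: VA_test.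
        by apply/funext => x; rewrite /Ipart /= opprK.
      move=> t tt; rewrite !(@eq_I _ _ (fun=> 0)) ?I0 ?oppr0// => x _.
        by rewrite /Rpart /= mul0r.
      by rewrite /Ipart /= mul0r.
    have N (a : R -> R) : rL2 a -> dotp a (fun x => - Aop p x) = - dotp a (Aop p).
      by move=> aL; rewrite dotpC dotpNl// dotpC.
    have E : (- dotp (Ipart h) (Aop p)) +i* (- dotp (Rpart h) (Aop p)) =
        dotp (Rpart g) p +i* (- dotp (Ipart g) p).
      have := adj _ _ Ap; rewrite !innerE//=.
      rewrite -!/(dotp _ _) (_ : Rpart (fun x => p x +i* 0) = p)//.
      rewrite (_ : Ipart (fun x => p x +i* 0) = fun=> 0)//.
      rewrite (_ : Rpart (fun x => 0 +i* - Aop p x) = fun=> 0)//.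
      rewrite (_ : Ipart (fun x => 0 +i* - Aop p x) = fun x => - Aop p x)//.
      by rewrite !dotp_0r !N// !addr0 !add0r !subr0.
    have E1 := congr1 (@complex.Re R) E; have E2 := congr1 (@complex.Im R) E.
    rewrite !cE in E1 E2.
    rewrite -(weakA_Lop fr wr tp) -(weakA_Lop fi wi tp) dotpNl//.
    by split => //; apply: oppr_inj.
  have fg : L0max R (f, g).
    by apply/L0maxP; split => // p tp; have [] := key p tp.
  have [c [d cd]] := L0max_cbv eta_cut fg; exists c, d; split => //.
  case: cd => r i; apply: complexP.
    exact: (rbv_weakA eta_cut r (rL2N hi) wr).
  exact: (rbv_weakA eta_cut i hr wi).
rewrite d0 in H; have [h Ah _] := H0_form H; exists h; split => //=.
have [_ hL wr wi] := (A_halfP _ _).1 Ah; have [fL gL] := cbv_L2 H.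
have [fr fi] := (L2P f).1 fL; have [gr gi] := (L2P g).1 gL.
have [hr hi] := (L2P h).1 hL.
split => //= u v Auv; have [uL vL wur wui] := (A_halfP _ _).1 Auv.
have [ur ui] := (L2P u).1 uL; have [vr vi] := (L2P v).1 vL.
case: H => /rbv_weakL lr /rbv_weakL li.
have N (a b : R -> R) : rL2 a -> rL2 b -> dotp a (fun x => - b x) = - dotp a b.
  by move=> aL bL; rewrite dotpC dotpNl// dotpC.
have e1 := weakA_form fr gr lr (rL2N hi) wr ur (rL2N vi) wur.
have e2 := weakA_form fr gr lr (rL2N hi) wr ui vr wui.
have e3 := weakA_form fi gi li hr wi ur (rL2N vi) wur.
have e4 := weakA_form fi gi li hr wi ui vr wui.
move: e1 e2 e3 e4; rewrite !(dotpNl, N)//; last exact: rL2N.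
rewrite !innerE//; gen_dotp => *.
by apply: complexP; rewrite !cE; lra.
Qed.

End Cutoff.
End FormOfA.

(** * Positive extensions and negative eigenvalues *)

Section Extensions.
Local Open Scope complex_scope.
Context {R : realType}.
Local Notation mu := (@lebesgue_measure R).
Local Notation C := R[i].
Local Notation Re := complex.Re.
Local Notation Im := complex.Im.
Implicit Types (f g h k u v phi psi : R -> C) (a c d z : C) (x e : R).

Variable eta : R -> R.
Hypothesis eta_cut : cutoff eta.

Lemma conjR x : (x%:C)^* = x%:C.
Proof. exact: conjc_real. Qed.

Lemma conjRM x z : (x%:C * z)^* = x%:C * z^*.
Proof. by rewrite rmorphM; congr (_ * _); exact: conjR. Qed.

Lemma inner_self f : L2 f -> inner f f = (sqnorm f)%:C.
Proof.
move=> fL; rewrite innerE//; apply: complexP => //=.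
by rewrite dotpC subrr.
Qed.

Lemma inner_conj f g : L2 f -> L2 g -> inner f g = (inner g f)^*.
Proof.
move=> fL gL; rewrite !innerE//; apply: complexP; rewrite !cE.
  by rewrite dotpC [dotp (Ipart f) _]dotpC.
by rewrite [dotp (Rpart g) _]dotpC [dotp (Ipart g) _]dotpC opprB.
Qed.

Lemma L2_scale z f : L2 f -> L2 (scale z f).
Proof.
move=> fL; rewrite (_ : scale z f = scale z f \+ (fun=> 0)).
  by apply: L2_lin => //; exact: L2_0.
by apply/funext => x; rewrite /= addr0.
Qed.

Lemma inner_Zr z f g : L2 f -> L2 g -> inner f (scale z g) = z * inner f g.
Proof.
move=> fL gL; have zL := L2_scale z gL; rewrite !innerE//.
have [fr fi] := (L2P f).1 fL; have [gr gi] := (L2P g).1 gL.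
have key (a : R -> R) : rL2 a ->
    dotp a (Rpart (scale z g)) = Re z * dotp a (Rpart g) - Im z * dotp a (Ipart g) /\
    dotp a (Ipart (scale z g)) = Re z * dotp a (Ipart g) + Im z * dotp a (Rpart g).
  move=> aL; have ar := rL2_mul aL gr; have ai := rL2_mul aL gi; split.
    rewrite /dotp -!I_Z// -I_B; [|exact: integZ..].
    by apply: eq_I => x _; rewrite /Rpart /scale !cE; ring.
  rewrite /dotp -!I_Z// -I_D; [|exact: integZ..].
  by apply: eq_I => x _; rewrite /Ipart /scale !cE; ring.
have [-> ->] := key _ fr; have [-> ->] := key _ fi.
by apply: complexP; rewrite !cE; gen_dotp; ring.
Qed.

Lemma inner_Zl_real x f g : L2 f -> L2 g ->
  inner (scale x%:C f) g = x%:C * inner f g.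
Proof.
move=> fL gL; have xL := L2_scale x%:C fL; rewrite inner_conj// inner_Zr//.
transitivity (x%:C * (inner g f)^*); first exact: conjRM.
by congr (_ * _); exact: esym (inner_conj fL gL).
Qed.

Lemma inner_Dr f g h : L2 f -> L2 g -> L2 h -> inner f (g \+ h) = inner f g + inner f h.
Proof.
move=> fL gL hL; have sL : L2 (g \+ h).
  rewrite (_ : g \+ h = scale 1 g \+ h); first exact: L2_lin.
  by apply/funext => x; rewrite /scale /= mul1r.
have [fr fi] := (L2P f).1 fL; have [gr gi] := (L2P g).1 gL.
have [hr hi] := (L2P h).1 hL; rewrite !innerE//.
have key (a : R -> R) : rL2 a ->
    dotp a (Rpart (g \+ h)) = dotp a (Rpart g) + dotp a (Rpart h) /\
    dotp a (Ipart (g \+ h)) = dotp a (Ipart g) + dotp a (Ipart h).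
  move=> aL; split; rewrite /dotp -I_D; try exact: rL2_mul.
    by apply: eq_I => x _; rewrite /Rpart /= !cE mulrDr.
  by apply: eq_I => x _; rewrite /Ipart /= !cE mulrDr.
have [-> ->] := key _ fr; have [-> ->] := key _ fi.
by apply: complexP; rewrite !cE; gen_dotp; ring.
Qed.

Lemma H0_ge0 f g c : cbv f g c 0 -> 0 <= inner f g.
Proof.
by move=> /H0_form[h _ ->]; rewrite lecR exprn_ge0// sqrtr_ge0.
Qed.

Lemma sqnorm_gt0 f : L2 f -> ~ eqL2 f (fun=> 0) -> 0 < (sqnorm f)%:C.
Proof.
move=> fL f0; rewrite ltcR lt_neqAle sqnorm_ge0 andbT; apply/eqP => s0.
by apply: f0; apply: sqnorm0.
Qed.

Lemma H0_no_eigen f c z : cbv f (scale z f) c 0 -> ~~ (0 <= z) -> eqL2 f (fun=> 0).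
Proof.
move=> H zN; have [fL _] := cbv_L2 H; apply: contrapT => f0.
have s0 := sqnorm_gt0 fL f0.
by have := H0_ge0 H; rewrite inner_Zr// inner_self// pmulr_lge0// (negbTE zN).
Qed.

Lemma lin2_00 : lin2 (@P00 R).
Proof.
split; first by [].
by move=> a c d c' d' [-> ->] [-> ->]; split; rewrite mulr0 addr0.
Qed.

Lemma lin2_d0 : lin2 (@Pd0 R).
Proof. by split => // a c d c' d' -> ->; rewrite /Pd0 mulr0 addr0. Qed.

Lemma lin2_theta theta : lin2 (@Ptheta R theta).
Proof.
split; first by rewrite /Ptheta !mulr0.
move=> a c d c' d'; rewrite /Ptheta => e1 e2.
by rewrite !mulrDr e2 mulrCA e1 mulrCA.
Qed.

Lemma L0min_adjoint : adjoint_op (L0min R) = L0max R.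
Proof.
rewrite (L0minE eta_cut) (bvop_adjoint eta_cut) ?(L0maxE eta_cut)//.
by apply: bvop_eq => c d; split => // _ c' d' [-> ->]; rewrite !mulr0.
Qed.

Lemma L0min_sub P : P 0 0 -> L0min R `<=` bvop P.
Proof.
move=> P0; rewrite (L0minE eta_cut) => -[f g] [c [d [H [c0 d0]]]].
by exists c, d; split => //; rewrite c0 d0.
Qed.

Lemma L0min_hermitian : hermitian_op (L0min R).
Proof.
rewrite (L0minE eta_cut); split.
- exact: (bvop_operator eta_cut lin2_00).
- by apply: (bvop_dense eta_cut).
move=> f f' g g' [c [d [H [c0 d0]]]] [c' [d' [H' _]]].
by apply/eqP; rewrite -subr_eq0 (cbv_green H H') c0 d0 conjC0 !mul0r subrr.
Qed.

Lemma L0min_positive : positive_op (L0min R).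
Proof.
move=> f g; rewrite (L0minE eta_cut) => -[c [d [H [_ d0]]]].
by move: H; rewrite /= d0; exact: H0_ge0.
Qed.

(** Subtracting from a solution a multiple of k, whose logarithmic coefficient
    is 1, leads into H0, which has no eigenvalue outside [0, oo). *)
Lemma kernel_dim1 k z c : cbv k (scale z k) c 1 -> ~~ (0 <= z) ->
  has_dim [set f | adjoint_op (L0min R) (f, scale z f)] 1.
Proof.
move=> H zN; rewrite L0min_adjoint; exists (fun=> k); split.
- by move=> _; exact: cbv_L0max H.
- move=> a; rewrite (_ : (fun x => _) = scale (a ord0) k \+ (fun=> 0)); last first.
    by apply/funext => x; rewrite big_ord1 /= addr0.
  move=> E i; rewrite (ord1 i).
  have [_ _] := cbv_uniq eta_cut (cbv_lin (a ord0) H (cbv0 eta_cut)) (cbv0 eta_cut) E.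
  by rewrite mulr1 addr0.
move=> f /= /(L0max_cbv eta_cut)[c' [d' H']]; exists (fun=> d').
have := cbv_lin (- d') H H'.
rewrite mulr1 addNr (_ : scale (- d') (scale z k) \+ _ = scale z (scale (- d') k \+ f)); last first.
  by apply/funext => x; rewrite /scale /=; ring.
move=> /H0_no_eigen-/(_ zN); apply: filterS => x /[apply].
rewrite big_ord1 /scale /= => E.
by apply/eqP; rewrite -subr_eq0; apply/eqP; rewrite -E; ring.
Qed.

Lemma cbv_kernel (b : R) : b ^+ 2 = 1 -> exists k c, cbv k (scale (0 +i* b) k) c 1.
Proof.
move=> b1; have ab1 : 0 ^+ 2 + b ^+ 2 = 1 by rewrite b1 expr0n /= add0r.
have [k1 [k2 [c1 [c2 [H1 H2]]]]] := kernel_exists eta_cut (lexx 0) ab1.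
exists (fun x => k1 x +i* k2 x), (c1 +i* c2); split.
  rewrite (_ : Rpart (scale _ _) = fun x => 0 * k1 x - b * k2 x)//.
by rewrite (_ : Ipart (scale _ _) = fun x => 0 * k2 x + b * k1 x).
Qed.

Lemma L0min_deficiency : deficiency_indices (L0min R) 1 1.
Proof.
split.
  have [|k [c H]] := @cbv_kernel 1; first by rewrite expr1n.
  by apply: kernel_dim1 H _; rewrite lecE /= oner_eq0.
have [|k [c H]] := @cbv_kernel (-1); first by rewrite sqrrN expr1n.
have -> : - 'i%C = 0 +i* -1 :> C by apply: complexP; rewrite !cE ?oppr0.
by apply: kernel_dim1 H _; rewrite lecE /= oppr_eq0 oner_eq0.
Qed.

Lemma perp_d0 c d : perp (@Pd0 R) c d <-> Pd0 c d.
Proof.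
split=> [H|-> c' d' ->]; last by rewrite conjC0 mulr0 mul0r.
have := H 1 0 erefl; rewrite mulr0 mulr1 => /esym/eqP.
by rewrite conjC_eq0 => /eqP.
Qed.

Lemma H0_selfadjoint : selfadjoint (bvop (@Pd0 R)).
Proof.
split.
- exact: (bvop_operator eta_cut lin2_d0).
- by apply: (bvop_dense eta_cut).
by rewrite (bvop_adjoint eta_cut)//; apply: bvop_eq => c d; split => /perp_d0.
Qed.

Lemma H0_positive : positive_op (bvop (@Pd0 R)).
Proof. by move=> f g [c [d [H d0]]]; move: H; rewrite /= d0; exact: H0_ge0. Qed.

Lemma H0_extension : pos_selfadjoint_ext (L0min R) (bvop (@Pd0 R)).
Proof.
split; [exact: H0_selfadjoint|exact: H0_positive|exact: L0min_sub].
Qed.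

Lemma cbv_eigen t : exists kappa f, 0 < kappa /\
  cbv f (scale (- kappa ^+ 2)%:C f) t%:C 1.
Proof.
have [kappa [e [k0 H]]] := eigen_dilation eta_cut t.
exists kappa, (fun x => e x +i* 0); split => //; split.
  rewrite (_ : Rpart (scale _ _) = fun x => - kappa ^+ 2 * e x)//.
  by apply/funext => x; rewrite /Rpart /scale !cE mulr0 subr0.
rewrite (_ : Ipart (scale _ _) = fun=> 0); first exact: rbv_00 eta_cut.
by apply/funext => x; rewrite /Ipart /scale !cE mulr0 mul0r addr0.
Qed.

Lemma neg_not_ge0 x : x < 0 -> ~~ (0 <= x%:C).
Proof. by move=> x0; rewrite lecR -ltNge. Qed.

Lemma eigen_neq0 f g c : cbv f g c 1 -> ~ eqL2 f (fun=> 0).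
Proof.
move=> H E; have [_ _ /eqP] := cbv_uniq eta_cut H (cbv0 eta_cut) E.
by rewrite oner_eq0.
Qed.

Lemma conj_ratio c d : d != 0 -> c^* * d = d^* * c -> d^-1 * c = (Re (d^-1 * c))%:C.
Proof.
move=> d0 E; have : (d^-1 * c)^* = d^-1 * c.
  have cd0 : d^* != 0 by rewrite conjC_eq0.
  by rewrite rmorphM fmorphV /=; apply: (mulfI cd0); rewrite mulVKf// mulrCA -E mulrC mulfK.
case: (d^-1 * c) => a b /eqP; rewrite eq_complex /= => /andP[_ /eqP bb].
by congr (_ +i* _); lra.
Qed.

(** Let f in D(H) have boundary values (c, d) with d != 0. Symmetry forces c /
    d to be real; then f / d and the negative eigenfunction of [cbv_eigen]
    with boundary values (c / d, 1) differ by an element of D(L0min), so that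
    the latter belongs to D(H). *)
Lemma ext_sub_H0 H : pos_selfadjoint_ext (L0min R) H -> H `<=` bvop (@Pd0 R).
Proof.
move=> [[[HL He H00 Hlin _] _ Hadj] Hpos Hext] [f g] Hfg.
have sub : H `<=` L0max R.
  rewrite {1}Hadj -L0min_adjoint => -[f1 g1] [/= f1L g1L h]; split => // u v uv.
  by apply: h; exact: Hext.
have [c [d cd]] := L0max_cbv eta_cut (sub _ Hfg); exists c, d; split => //.
apply/eqP; apply/negPn/negP => d0.
have sym : inner f g = inner g f.
  have : adjoint_op H (f, g) by rewrite -Hadj.
  by move=> [_ _ /(_ _ _ Hfg)].
have := cbv_green cd cd; rewrite sym subrr => /esym/eqP; rewrite subr_eq0 => /eqP.
move=> /(conj_ratio d0) E.
have [kappa [w [k0 Hw]]] := cbv_eigen (Re (d^-1 * c)).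
have Hu := cbv_lin (- d^-1) cd Hw.
have Hmin : H (scale (- d^-1) f \+ w, scale (- d^-1) g \+ scale (- kappa ^+ 2)%:C w).
  apply: Hext; rewrite (L0minE eta_cut); do 2 eexists; split; first exact: Hu.
  by split; rewrite ?mulNr -?E ?mulVf// addNr.
have := Hlin d^-1 _ _ _ _ Hfg Hmin.
rewrite (_ : _ \+ (_ \+ w) = w); last by apply/funext => x; rewrite /scale /=; ring.
rewrite (_ : _ \+ (_ \+ _) = scale (- kappa ^+ 2)%:C w); last first.
  by apply/funext => x; rewrite /scale /=; ring.
move=> /Hpos; have [wL _] := cbv_L2 Hw.
rewrite inner_Zr// inner_self// pmulr_lge0; last exact: sqnorm_gt0 (eigen_neq0 Hw).
by apply/negP; apply: neg_not_ge0; rewrite oppr_lt0 exprn_gt0.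
Qed.

(** A self-adjoint operator has no proper self-adjoint restriction: from H <=
    H0 it follows that H0 = H0^* <= H^* = H. *)
Lemma ext_unique H : pos_selfadjoint_ext (L0min R) H -> H = bvop (@Pd0 R).
Proof.
move=> Hext; have sub := ext_sub_H0 Hext.
apply/seteqP; split => // -[f g].
have [_ _ ->] := H0_selfadjoint; move=> [/= fL gL h].
have [[_ _ ->] _ _] := Hext; split => // u v /sub; exact: h.
Qed.

Lemma form_le_refl (H : operator R) : form_le H H.
Proof. by move=> f q fq; exists q. Qed.

Lemma Friedrichs_unique (F : operator R) : is_Friedrichs (L0min R) F <-> F = bvop (@Pd0 R).
Proof.
split=> [[/ext_unique]//|->]; split; first exact: H0_extension.
by move=> H /ext_unique ->; exact: form_le_refl.
Qed.

Lemma Krein_unique (K : operator R) : is_Krein (L0min R) K <-> K = bvop (@Pd0 R).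
Proof.
split=> [[/ext_unique]//|->]; split; first exact: H0_extension.
by move=> H /ext_unique ->; exact: form_le_refl.
Qed.

Lemma Ptheta_pi2 c d : Ptheta (pi / 2) c d <-> Pd0 c d.
Proof.
rewrite /Ptheta /Pd0 sin_pihalf cos_pihalf mul0r mul1r; split => //.
Qed.

Section Theta.
Variable theta : R.
Hypothesis cos0 : cos theta != 0.

Lemma Ptheta_solve c d : Ptheta theta c d <-> c = (sin theta / cos theta)%:C * d.
Proof.
have cC : (cos theta)%:C != 0 :> C by rewrite eq_complex /= eqxx andbT.
rewrite /Ptheta; split => [E|->].
  apply: (mulfI cC); rewrite -E mulrA -rmorphM /=; congr (_ %:C * _).
  by rewrite mulrCA divff ?mulr1.
by rewrite mulrA -rmorphM /=; congr (_ %:C * _); rewrite mulrCA divff ?mulr1.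
Qed.

Lemma perp_theta c d : perp (Ptheta theta) c d <-> Ptheta theta c d.
Proof.
split=> [H|/Ptheta_solve -> c' d' /Ptheta_solve ->]; last first.
  by apply: complexP; rewrite !cE; ring.
have : Ptheta theta (sin theta)%:C (cos theta)%:C by rewrite /Ptheta mulrC.
move=> /H E; rewrite /Ptheta.
have := congr1 (@complex.Re R) E; have := congr1 (@complex.Im R) E.
by rewrite !cE => e1 e2; apply: complexP; rewrite !cE; lra.
Qed.

Lemma theta_selfadjoint : selfadjoint (bvop (Ptheta theta)).
Proof.
have P0 := (lin2_theta theta).1.
split.
- exact: (bvop_operator eta_cut (lin2_theta theta)).
- by apply: (bvop_dense eta_cut).
by rewrite (bvop_adjoint eta_cut)//; apply: bvop_eq => c d; split => /perp_theta.
Qed.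

Lemma theta_eigen : exists kappa f, 0 < kappa /\
  cbv f (scale (- kappa ^+ 2)%:C f) (sin theta / cos theta)%:C 1.
Proof. exact: cbv_eigen. Qed.

(** Eigenvectors f and g for distinct eigenvalues are orthogonal, and g - d' f
    has no logarithmic part if d' is that of g. The form of H0 at this element
    is x |d'| ^ 2 |f| ^ 2 + y |g| ^ 2, which would be negative. *)
Lemma theta_eigen_unique x y f g c : x < 0 -> y < 0 ->
  cbv f (scale x%:C f) c 1 -> Ptheta theta c 1 ->
  bvop (Ptheta theta) (g, scale y%:C g) -> ~ eqL2 g (fun=> 0) -> x = y.
Proof.
move=> x0 y0 Hf Pf [c' [d' [/= Hg Pg]]] gN0; apply/eqP; apply: contrapT => /negP xy.
have [fL xfL] := cbv_L2 Hf; have [gL ygL] := cbv_L2 Hg.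
have f0 : inner f g = 0.
  have [_ _ E] := theta_selfadjoint.
  have Bf : bvop (Ptheta theta) (f, scale x%:C f) by exists c, 1.
  have Bg : bvop (Ptheta theta) (g, scale y%:C g) by exists c', d'.
  have : adjoint_op (bvop (Ptheta theta)) (f, scale x%:C f) by rewrite -E.
  move=> [_ _ /(_ _ _ Bg) /=]; rewrite inner_Zr// inner_Zl_real// => /eqP.
  rewrite -subr_eq0 -mulrBl mulf_eq0.
  rewrite -rmorphB /= => /orP[/eqP/(congr1 (@complex.Re R))/= xy0|/eqP//].
  by case/negP: xy; apply/eqP; lra.
have H := cbv_lin (- d') Hf Hg; rewrite mulr1 addNr in H.
have [uL vL] := cbv_L2 H; have := H0_ge0 H.
have dfL := L2_scale (- d') fL; have dxfL := L2_scale (- d') xfL.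
set u := scale (- d') f \+ g in H uL *.
have fu : inner f u = - d' * (sqnorm f)%:C.
  by rewrite inner_Dr// inner_Zr// inner_self// f0 addr0.
have gf : inner g f = 0.
  by rewrite (inner_conj gL fL) f0; apply: complexP; rewrite !cE ?oppr0.
have gu : inner g u = (sqnorm g)%:C.
  by rewrite inner_Dr// inner_Zr// inner_self// gf mulr0 add0r.
rewrite inner_Dr// !inner_Zr// (inner_conj uL fL) fu (inner_conj uL gL) gu.
rewrite (_ : _ + _ = x%:C * (((- d') * (- d')^*) * (sqnorm f)%:C) +
   y%:C * (sqnorm g)%:C); last by apply: complexP; rewrite !cE; ring.
move=> /le_gtF/negP; apply.
rewrite -[X in _ < X](addr0 0); apply: ler_ltD; last first.
  by rewrite pmulr_llt0 ?sqnorm_gt0// ltcR.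
apply: mulr_le0_ge0; first by rewrite lecR ltW.
by rewrite mulr_ge0 ?mul_conjC_ge0// lecR sqnorm_ge0.
Qed.

Lemma theta_unique_eigenvalue :
  exists! lambda, lambda < 0 /\ eigenvalue_op (bvop (Ptheta theta)) lambda%:C.
Proof.
have [kappa [f [k0 H]]] := theta_eigen.
have P1 : Ptheta theta (sin theta / cos theta)%:C 1.
  by apply/Ptheta_solve; rewrite mulr1.
have n0 : - kappa ^+ 2 < 0 by rewrite oppr_lt0 exprn_gt0.
exists (- kappa ^+ 2); split.
  split => //; exists f; split; last exact: eigen_neq0 H.
  by exists (sin theta / cos theta)%:C, 1.
move=> y [y0 [g [Hg gN0]]]; exact: (theta_eigen_unique n0 y0 H P1 Hg gN0).
Qed.

End Theta.
End Extensions.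

Theorem proposition4p21 (R : realType) (xi : R -> R[i])
    (xi_smooth : smooth_hl xi)
    (xi_one : forall x : R, 0 < x -> x <= 1 -> xi x = 1)
    (xi_zero : forall x : R, 2 <= x -> xi x = 0) :
  [/\ hermitian_op (L0min R), positive_op (L0min R) &
      deficiency_indices (L0min R) 1 1]
  /\
  [/\ forall F : operator R, is_Friedrichs (L0min R) F <-> F = H0 xi,
      forall K : operator R, is_Krein (L0min R) K <-> K = H0 xi &
      H0 xi = H0theta (pi / 2)]
  /\
  [/\ linear_subspace (domain_op (H0 xi)),
      domain_op (H0 xi) `<=` domain_op (A_half R),
      graph_dense (domain_op (H0 xi)) (A_half R) &
      forall f g h : R -> R[i], H0 xi (f, g) -> A_half R (f, h) ->
        inner f g = ((norm2 h) ^+ 2)%:C%C]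
  /\
  (forall (f : R -> R[i]) (q : R),
     quad_form (H0 xi) f q <->
     quad_form (comp_op (adjoint_op (A_half R)) (A_half R)) f q)
  /\
  (forall theta : R, 0 <= theta -> theta < pi -> theta != pi / 2 ->
     [/\ selfadjoint (H0theta theta), L0min R `<=` H0theta theta &
         exists! lambda : R,
           lambda < 0 /\ eigenvalue_op (H0theta theta) lambda%:C%C]).
Proof.
have eta_cut := xi_cut xi_smooth xi_one xi_zero.
have H0b := H0E xi_smooth xi_one xi_zero.
have Htheta := H0thetaE xi_smooth xi_one xi_zero.
split; [|split; [|split; [|split]]].
- split; [exact: L0min_hermitian eta_cut|exact: L0min_positive eta_cut|].
  exact: L0min_deficiency eta_cut.
- rewrite H0b; split.
  + by move=> F; exact: (Friedrichs_unique eta_cut).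
  + by move=> K; exact: (Krein_unique eta_cut).
  + by rewrite Htheta; apply: bvop_eq => c d; split => /Ptheta_pi2.
- rewrite H0b; have [_ _ H00 Hlin _] := bvop_operator eta_cut (@lin2_d0 R).
  split.
  + split; first by eexists; exact: H00.
    by move=> c f g [f' Hf] [g' Hg]; eexists; exact: Hlin Hf Hg.
  + move=> f [g [c [d [H d0]]]]; move: H; rewrite /= d0 => /H0_form[h Ah _].
    by exists h.
  + exact: test_graph_dense eta_cut.
  + move=> f g h [c [d [H d0]]] Ah; move: H; rewrite /= d0 => H.
    exact: (inner_A eta_cut H Ah).
- by move=> f q; rewrite H0b (Astar_A eta_cut).
move=> theta th0 thpi thn; rewrite Htheta.
have cos0 : cos theta != 0.
  have [lt|gt|eq] := ltgtP theta (pi / 2).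
  - rewrite gt_eqF// cos_gt0_pihalf// lt andbT.
    by have := pi_gt0 R; lra.
  - have : 0 < cos (pi - theta).
      by apply: cos_gt0_pihalf; apply/andP; split; have := pi_gt0 R; lra.
    by rewrite addrC cosDpi cosN oppr_gt0 => /lt_eqF ->.
  - by rewrite eq eqxx in thn.
split.
- exact: (theta_selfadjoint eta_cut cos0).
- by apply: (L0min_sub eta_cut); have [] := @lin2_theta R theta.
exact: (theta_unique_eigenvalue eta_cut cos0).
Qed.
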